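(* Let $(X,\mathcal{X},\mu,T)$ be an ergodic invertible measure preserving system and let $p_1,\ldots,p_k$ be rationally independent integer polynomials. Then the rational Kronecker factor $\mathcal{K}_{rat}$ is a characteristic factor for the $L^2(\mu)$-convergence of the averages $\frac{1}{N-M}\sum_{n=M}^{N-1}T^{p_1(n)}f_1\cdot\ldots\cdot T^{p_k(n)}f_k$; that is, if $f_1,\ldots,f_k\in L^\infty(\mu)$ and $\tilde f_i=\mathbb{E}(f_i\,|\,\mathcal{K}_{rat})$ for $i=1,\ldots,k$, then the difference $$\frac{1}{N-M}\sum_{n=M}^{N-1} T^{p_1(n)}f_1\cdot\ldots\cdot T^{p_k(n)}f_k-\frac{1}{N-M}\sum_{n=M}^{N-1} T^{p_1(n)}\tilde f_1\cdot\ldots\cdot T^{p_k(n)}\tilde f_k$$ converges to $0$ in $L^2(\mu)$ as $N-M\to\infty$.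
   Context: A measure preserving system is a quadruple $(X,\mathcal{X},\mu,T)$ where $(X,\mathcal{X},\mu)$ is a probability space and $T\colon X\to X$ is measurable with $\mu(T^{-1}A)=\mu(A)$ for all $A\in\mathcal{X}$. $T$ acts on functions by $Tf=f\circ T$, so $T^nf=f\circ T^n$ for $n\in\mathbb{Z}$. The system is ergodic if every $f\in L^\infty(\mu)$ with $Tf=f$ is ($\mu$-a.e.) constant. An integer polynomial is a polynomial taking integer values on the integers. A family $p_1,\ldots,p_k$ of integer polynomials is rationally independent if every nontrivial integer combination (i.e. $\sum_i c_ip_i$ with $c_i\in\mathbb{Z}$ not all zero) is not constant. The rational Kronecker factor $\mathcal{K}_{rat}$ is the $T$-invariant sub-$\sigma$-algebra of $\mathcal{X}$ generated by the functions $\{f\in L^\infty(\mu): T^rf=f \text{ for some } r\in\mathbb{N}\}$, where $\mathbb{N}=\{1,2,\ldots\}$. For a sub-$\sigma$-algebra $\mathcal{Y}$, $\mathbb{E}(f\,|\,\mathcal{Y})$ denotes the conditional expectation (orthogonal projection of $f$ onto $L^2(\mathcal{Y})$). Here $M<N$ are integers and the limit as $N-M\to\infty$ is uniform in $M$. *)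

(* Defs.v *)
From mathcomp Require Import all_boot all_order all_algebra.
From mathcomp Require Import complex.
From mathcomp Require Import all_classical all_reals all_analysis.

Set Implicit Arguments.
Unset Strict Implicit.
Unset Printing Implicit Defensive.
Import Order.TTheory GRing.Theory Num.Theory.
Import numFieldNormedType.Exports.

Local Open Scope classical_set_scope.
Local Open Scope ring_scope.

(* The sigma-algebra generated by f : X -> C; the Borel sigma-algebra of C is
   the product one, so it is generated by the preimages of Borel sets of R
   under the real and imaginary parts. *)
Definition csigma (R : realType) (X : Type) (f : X -> R[i]) : set (set X) :=
  <<s preimage_set_system setT (fun x => complex.Re (f x)) measurable `|`
      preimage_set_system setT (fun x => complex.Im (f x)) measurable >>.

Definition cLnorm (R : realType) (d : measure_display) (X : measurableType d)
    (mu : probability X R) (p : \bar R) (f : X -> R[i]) : \bar R :=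
  Lnorm mu p (fun x => (ComplexField.Normc.normc (f x))%:E).

(* L^p(Y) for a sub-sigma-algebra Y, as a set of functions (not of classes);
   L^p(mu) is the case Y = measurable. *)
Definition cLp (R : realType) (d : measure_display) (X : measurableType d)
    (mu : probability X R) (Y : set (set X)) (p : \bar R) : set (X -> R[i]) :=
  [set f | csigma f `<=` Y /\ (cLnorm mu p f < +oo)%E].

Definition cLinfty (R : realType) (d : measure_display) (X : measurableType d)
    (mu : probability X R) : set (X -> R[i]) :=
  cLp mu measurable +oo%E.

(* Meaningful for f and g in L^2(mu): f * conj g is then integrable. *)
Definition cinner (R : realType) (d : measure_display) (X : measurableType d)
    (mu : probability X R) (f g : X -> R[i]) : R[i] :=
  Complex (\int[mu]_x complex.Re (f x * conjc (g x)))
          (\int[mu]_x complex.Im (f x * conjc (g x))).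

(* g is a version of E(f | Y): the orthogonal projection of f onto L^2(Y). *)
Definition is_cond_exp (R : realType) (d : measure_display)
    (X : measurableType d) (mu : probability X R) (Y : set (set X))
    (f g : X -> R[i]) : Prop :=
  cLp mu Y 2%:E g /\
  forall h, cLp mu Y 2%:E h -> cinner mu (fun x => f x - g x) h = 0.

Definition measure_preserving (R : realType) (d : measure_display)
    (X : measurableType d) (mu : probability X R) (T : X -> X) : Prop :=
  measurable_fun setT T /\
  forall A, measurable A -> mu (T @^-1` A) = mu A.

Definition invertible_mps (R : realType) (d : measure_display)
    (X : measurableType d) (mu : probability X R) (T Tinv : X -> X) : Prop :=
  [/\ measure_preserving mu T, measurable_fun setT Tinv,
      cancel T Tinv & cancel Tinv T].

(* Equalities between elements of L^oo(mu) are equalities mu-a.e. *)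
Definition ergodic (R : realType) (d : measure_display)
    (X : measurableType d) (mu : probability X R) (T : X -> X) : Prop :=
  forall f : X -> R[i], cLinfty mu f ->
    {ae mu, forall x, f (T x) = f x} ->
    exists c : R[i], {ae mu, forall x, f x = c}.

Definition rational_kronecker (R : realType) (d : measure_display)
    (X : measurableType d) (mu : probability X R) (T : X -> X) :
    set (set X) :=
  <<s \bigcup_(f in [set f : X -> R[i] | cLinfty mu f /\
         exists2 r : nat, (0 < r)%N & {ae mu, forall x, f (iter r T x) = f x}])
       csigma f >>.

Definition ziter (X : Type) (T Tinv : X -> X) (n : int) : X -> X :=
  match n with
  | Posz m => iter m T
  | Negz m => iter m.+1 Tinv
  end.

Definition integer_polynomial (R : realType) (p : {poly R}) : Prop :=
  forall n : int, p.[n%:~R] \is a Num.int.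

Definition rationally_independent (R : realType) (k : nat)
    (p : 'I_k -> {poly R}) : Prop :=
  forall c : 'I_k -> int, (exists i, c i != 0) ->
    ~ exists a : R, \sum_(i < k) p i *~ c i = a%:P.

(* The value at n of an integer polynomial, as an element of int. *)
Definition zeval (R : realType) (p : {poly R}) (n : int) : int :=
  Num.floor p.[n%:~R].

(* Meaningful for M < N: the index n = M + j runs over M, ..., N - 1. *)
Definition poly_average (R : realType) (X : Type) (T Tinv : X -> X)
    (k : nat) (p : 'I_k -> {poly R}) (f : 'I_k -> X -> R[i])
    (M N : int) (x : X) : R[i] :=
  ((N - M)%:~R)^-1 *
  \sum_(j < `|N - M|%N)
    \prod_(i < k) f i (ziter T Tinv (zeval (p i) (M + j%:Z)) x).

(* Main.v *)
From HB Require Import structures.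
Require Import Defs.
From mathcomp Require Import all_boot all_order all_algebra cyclic separable cyclotomic.
From mathcomp Require Import complex ring lra zify.
From mathcomp Require Import all_classical all_reals all_analysis measurable_realfun ess_sup_inf.

(** The difference of the two averages is a sum of [k] averages, in the [j]-th of
    which one function is [f j - ft j] and the others are bounded.  Conditional
    expectation makes that function orthogonal to all the bounded functions of a
    period [r], so it is enough that such averages tend to 0 ([SF_all]).  The proof
    is elementary: it uses no structure theory of ergodic systems beyond
    eigenfunctions.  It takes place in an abstract algebra of bounded functions
    with an integral and an action of the integers ([system]).

    Polynomial exhaustion: repeated use of van der Corput's inequality bounds from
    below, whenever the average is large, some box norm of any one of the
    functions, the finite form of a Gowers-Host-Kra seminorm
    ([controlled_poly]).  This uses that the polynomials and their differences are
    not constant.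

    Degree lowering: suppose that averages over longer and longer intervals stay
    large.  The function at [m] may be replaced by the dual function [F], a weak
    limit of the averages solved for that function, so a box norm of [F] of some
    degree is bounded from below.  If that degree is [t + 2], the cubes of dimension
    [t] built from [F] correlate with eigenfunctions; since [F] is itself a limit
    of averages with the function at [m] removed, and such averages with a character
    of large order in its place are small by induction on the number of functions
    ([SA_all]), the eigenvalues combine to roots of unity of bounded order.  The
    eigenfunctions can then be eliminated by the Cauchy-Schwarz inequality, which
    bounds a box norm of degree [t + 1] ([lowering]).

    At degree 2 a finite Fourier transform and the mean ergodic theorem give an
    eigenfunction correlated with [F] ([eigenfunction]), and this eigenfunction may
    take the place of the function at [m] in the average ([core]).  It comes out of
    the average as a character.  Continuing, all the functions become
    characters: the average is an exponential sum, and Weyl's theorem with the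
    rational independence of the polynomials forces all the eigenvalues to be roots
    of unity of bounded order ([weyl], [phase_weyl]).  Applied with the function
    orthogonal to the periodic ones as the last to be replaced, this says that
    it correlates with a periodic function, a contradiction. *)

Set Implicit Arguments.
Unset Strict Implicit.
Unset Printing Implicit Defensive.
Import Order.TTheory GRing.Theory Num.Theory.
Import numFieldNormedType.Exports.

Local Open Scope classical_set_scope.
Local Open Scope ring_scope.

(** * Averages over finite lists *)

Definition mean (R : realType) (I : Type) (s : seq I) (a : I -> R) : R :=
  (size s)%:R^-1 * \sum_(x <- s) a x.

Notation "\E_ ( x <- s ) F" := (mean s (fun x => F))
  (at level 41, x name, s at level 50, F at level 41).
Notation "\E_ ( x < n ) F" := (mean (iota 0 n) (fun x => F))
  (at level 41, x name, n at level 50, F at level 41).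

Section Mean.
Variables (R : realType) (I J : Type).
Implicit Types (s : seq I) (a b : I -> R) (c : R).

Lemma eq_mean s a b : a =1 b -> \E_(x <- s) a x = \E_(x <- s) b x.
Proof. by move=> e; congr (_ * _); apply: eq_bigr => x _. Qed.

Lemma meanD s a b : \E_(x <- s) (a x + b x) = \E_(x <- s) a x + \E_(x <- s) b x.
Proof. by rewrite /mean big_split mulrDr. Qed.

Lemma meanZ s c a : \E_(x <- s) (c * a x) = c * \E_(x <- s) a x.
Proof. by rewrite /mean -mulr_sumr mulrCA. Qed.

Lemma meanZr s c a : \E_(x <- s) (a x * c) = (\E_(x <- s) a x) * c.
Proof. by rewrite /mean -mulr_suml mulrA. Qed.

Lemma meanB s a b : \E_(x <- s) (a x - b x) = \E_(x <- s) a x - \E_(x <- s) b x.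
Proof. by rewrite /mean big_split /= sumrN mulrBr. Qed.

Lemma mean_cst s c : (0 < size s)%N -> \E_(x <- s) c = c.
Proof.
move=> s0; rewrite /mean big_const_seq count_predT iter_addr_0 -[c *+ _]mulr_natl mulrA mulVf ?mul1r//.
by rewrite pnatr_eq0 -lt0n.
Qed.

Lemma mean_cst_le s c : 0 <= c -> \E_(x <- s) c <= c.
Proof.
case: s => [|x s] c0; last by rewrite mean_cst.
by rewrite /mean big_nil mulr0.
Qed.

Lemma mean_ge0 s a : (forall x, 0 <= a x) -> 0 <= \E_(x <- s) a x.
Proof. by move=> a0; rewrite mulr_ge0 ?invr_ge0 ?ler0n ?sumr_ge0. Qed.

Lemma ler_mean s a b : (forall x, a x <= b x) -> \E_(x <- s) a x <= \E_(x <- s) b x.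
Proof. by move=> ab; rewrite ler_wpM2l ?invr_ge0 ?ler0n// ler_sum. Qed.

Lemma mean_le s a c : 0 <= c -> (forall x, a x <= c) -> \E_(x <- s) a x <= c.
Proof. by move=> c0 ac; apply: le_trans (mean_cst_le s c0); apply: ler_mean. Qed.

Lemma mean_sqr s a : (\E_(x <- s) a x) ^+ 2 <= \E_(x <- s) (a x ^+ 2).
Proof.
have [s0|s0] := posnP (size s); first by rewrite (size0nil s0) /mean !big_nil !mulr0 expr2 mulr0.
set m := mean s a.
have : 0 <= \E_(x <- s) ((a x - m) ^+ 2) by apply: mean_ge0 => x; apply: sqr_ge0.
have -> : \E_(x <- s) ((a x - m) ^+ 2) = \E_(x <- s) (a x ^+ 2 + (- (2 * m) * a x + m ^+ 2)).
  by apply: eq_mean => x; ring.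
rewrite meanD meanD meanZ mean_cst// -/m => h.
by rewrite -subr_ge0; apply: le_trans h _; rewrite le_eqVlt; apply/orP; left; apply/eqP; ring.
Qed.

Lemma mean_pow2 s a t : (forall x, 0 <= a x) ->
  (\E_(x <- s) a x) ^+ (2 ^ t) <= \E_(x <- s) (a x ^+ (2 ^ t)).
Proof.
move=> a0; elim: t => [|t ih].
  by rewrite expr1; apply: ler_mean => x; rewrite expr1.
rewrite expnSr exprM.
apply: le_trans (_ : (\E_(x <- s) (a x ^+ (2 ^ t))) ^+ 2 <= _).
  by rewrite ler_pXn2r ?nnegrE ?exprn_ge0 ?mean_ge0// => x; rewrite exprn_ge0.
apply: le_trans (mean_sqr _ _) _; apply: ler_mean => x.
by rewrite -exprM.
Qed.

(** The powers of two are the exponents produced by iterating the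
    Cauchy-Schwarz inequality; a positive one is even, so signs do not matter. *)
Lemma mean_pow2_even s a t : (\E_(x <- s) a x) ^+ (2 ^ t.+1) <= \E_(x <- s) (a x ^+ (2 ^ t.+1)).
Proof.
rewrite expnS exprM; apply: le_trans (_ : (\E_(x <- s) (a x ^+ 2)) ^+ (2 ^ t) <= _).
  by rewrite ler_pXn2r ?expn_gt0 ?nnegrE ?sqr_ge0 ?mean_ge0 ?mean_sqr// => x; apply: sqr_ge0.
apply: le_trans (mean_pow2 _ _ _) _; first by move=> x; apply: sqr_ge0.
by apply: ler_mean => x; rewrite -exprM.
Qed.

Lemma mean_exch s (s' : seq J) (a : I -> J -> R) :
  \E_(x <- s) \E_(y <- s') a x y = \E_(y <- s') \E_(x <- s) a x y.
Proof.
by rewrite /mean -!mulr_sumr mulrCA exchange_big.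
Qed.

Lemma mean_ex s a c : (0 < size s)%N -> c <= \E_(x <- s) a x -> exists x, c <= a x.
Proof.
move=> s0 h; apply: contrapT => /forallNP n.
have lt x : a x < c by rewrite ltNge; apply/negP.
suff : \E_(x <- s) a x < c by rewrite ltNge h.
case: s s0 {h} => // x s _.
rewrite -[ltRHS](@mean_cst (x :: s))// /mean ltr_pM2l ?invr_gt0 ?ltr0n//.
rewrite !big_cons; apply: ltr_leD => //; apply: ler_sum => y _; exact: ltW.
Qed.

Lemma mean_allpairs (K : Type) s (s' : seq J) (f : I -> J -> K) (a : K -> R) :
  \E_(z <- [seq f x y | x <- s, y <- s']) a z = \E_(x <- s) \E_(y <- s') a (f x y).
Proof.
rewrite /mean size_allpairs natrM invfM -mulrA; congr (_ * _).
rewrite -mulr_sumr; congr (_ * _).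
by rewrite big_allpairs_dep.
Qed.

End Mean.

Lemma ler_mean_in (R : realType) (I : eqType) (s : seq I) (a b : I -> R) :
  {in s, forall x, a x <= b x} -> \E_(x <- s) a x <= \E_(x <- s) b x.
Proof.
move=> ab; rewrite ler_wpM2l ?invr_ge0 ?ler0n//.
by rewrite big_seq [leRHS]big_seq; apply: ler_sum => x /ab.
Qed.

Lemma eq_mean_in (R : realType) (I : eqType) (s : seq I) (a b : I -> R) :
  {in s, forall x, a x = b x} -> \E_(x <- s) a x = \E_(x <- s) b x.
Proof. by move=> e; congr (_ * _); apply: eq_big_seq. Qed.

Lemma mean_ex_in (R : realType) (I : eqType) (s : seq I) (a : I -> R) c :
  (0 < size s)%N -> c <= \E_(x <- s) a x -> exists2 x, x \in s & c <= a x.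
Proof.
move=> s0 h.
have [x] : exists x, c <= (if x \in s then a x else c - 1).
  by apply: (mean_ex s0); rewrite (eq_mean_in (b := a))// => x ->.
case: ifP => [xs cx|_]; first by exists x.
by rewrite lerBrDr gerDl ler10.
Qed.

Lemma mean_iotaM (R : realType) (H K : nat) (a : nat -> R) :
  \E_(x < K * H) a x = \E_(k < K) \E_(h < H) a (k * H + h)%N.
Proof.
rewrite -(mean_allpairs _ _ (fun k h => (k * H + h)%N)).
congr mean; elim: K => [|K ih]; first by rewrite mul0n.
have -> : iota 0 K.+1 = iota 0 K ++ [:: K] by rewrite -addn1 iotaD.
rewrite allpairs_cat -ih mulSn addnC iotaD; congr (_ ++ _).
rewrite /= cats0 !add0n.
by rewrite -[X in iota X _]addn0 iotaDl.
Qed.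

(** * Measure preserving systems seen through their bounded functions *)

(** The algebra of bounded measurable functions, with complex scalars
    [sc], complex conjugation [star], the action [U] of the integers and the
    real part [tau] of the integral.  The inner product is the real one, so
    that every inequality below is between real numbers; the imaginary part of
    an integral is recovered as [- tau (sc 'i * f)].  A function is a
    contraction for multiplication exactly when it is bounded by 1 almost
    everywhere, which lets boundedness be expressed without a second norm. *)
Record system (R : realType) := System {
  alg :> comPzRingType;
  sc : {rmorphism R[i] -> alg};
  star : {rmorphism alg -> alg};
  U : int -> {rmorphism alg -> alg};
  tau : {additive alg -> R};
  starK : forall f, star (star f) = f;
  star_sc : forall z, star (sc z) = sc (conjc z);
  U0 : forall f, U 0 f = f;
  UD : forall m n f, U (m + n) f = U m (U n f);
  U_sc : forall n z, U n (sc z) = sc z;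
  U_star : forall n f, U n (star f) = star (U n f);
  tauZ : forall r f, tau (sc (real_complex R r) * f) = r * tau f;
  tau1 : tau 1 = 1;
  tau_star : forall f, tau (star f) = tau f;
  tau_ge0 : forall f, 0 <= tau (f * star f);
  tauU : forall n f, tau (U n f) = tau f;
  contraction := fun f : alg =>
    forall g, tau (f * g * star (f * g)) <= tau (g * star g);
  bounded_alg : forall f, exists2 c : R, 0 < c &
    forall g, tau (f * g * star (f * g)) <= c * tau (g * star g);
  complete_alg : forall F : nat -> alg, (forall k, contraction (F k)) ->
    (forall e : R, 0 < e -> exists n0, forall i j, (n0 <= i)%N -> (n0 <= j)%N ->
       tau ((F i - F j) * star (F i - F j)) < e) ->
    exists2 G, contraction G & forall e : R, 0 < e -> exists n0, forall i, (n0 <= i)%N ->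
       tau ((F i - G) * star (F i - G)) < e;
  truncation : forall f, exists2 g, contraction g & forall h, contraction h ->
     tau ((g - h) * star (g - h)) <= tau ((f - h) * star (f - h));
  ergodic_alg : forall f, tau ((U 1 f - f) * star (U 1 f - f)) = 0 ->
     exists z, tau ((f - sc z) * star (f - sc z)) = 0
}.

Section Basics.
Variables (R : realType) (S : system R).
Implicit Types (f g h : S) (r : R) (z w : R[i]).

Definition rs r : S := sc S (real_complex R r).
Definition nrm2 f : R := tau S (f * star S f).
Definition nrm f : R := Num.sqrt (nrm2 f).
Definition ip f g : R := tau S (f * star S g).
Definition le1 f := forall g, nrm2 (f * g) <= nrm2 g.
Definition unim z := z * conjc z = 1.

Lemma nrm2_ge0 f : 0 <= nrm2 f. Proof. exact: tau_ge0. Qed.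
Lemma nrm_ge0 f : 0 <= nrm f. Proof. exact: sqrtr_ge0. Qed.
Lemma nrmE f : nrm f ^+ 2 = nrm2 f. Proof. by rewrite sqr_sqrtr ?nrm2_ge0. Qed.

Lemma star_rs r : star S (rs r) = rs r.
Proof. by rewrite star_sc conjc_real. Qed.
Lemma U_rs n r : U S n (rs r) = rs r. Proof. exact: U_sc. Qed.
Lemma tau_rs r f : tau S (rs r * f) = r * tau S f. Proof. exact: tauZ. Qed.
Lemma rsM r r' : rs (r * r') = rs r * rs r'. Proof. by rewrite /rs !rmorphM. Qed.
Lemma rsD r r' : rs (r + r') = rs r + rs r'. Proof. by rewrite /rs !rmorphD. Qed.
Lemma rs1 : rs 1 = 1. Proof. by rewrite /rs !rmorph1. Qed.
Lemma rsN r : rs (- r) = - rs r. Proof. by rewrite /rs !rmorphN. Qed.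
Lemma rs_nat n : rs n%:R = n%:R. Proof. by rewrite /rs !rmorph_nat. Qed.

Lemma ip_sym f g : ip f g = ip g f.
Proof. by rewrite /ip -tau_star rmorphM /= starK mulrC. Qed.
Lemma ipDl f g h : ip (f + g) h = ip f h + ip g h.
Proof. by rewrite /ip mulrDl raddfD. Qed.
Lemma ipZl r f g : ip (rs r * f) g = r * ip f g.
Proof. by rewrite /ip -mulrA tau_rs. Qed.
Lemma ipDr f g h : ip h (f + g) = ip h f + ip h g.
Proof. by rewrite !(ip_sym h) ipDl. Qed.
Lemma ipZr r f g : ip f (rs r * g) = r * ip f g.
Proof. by rewrite !(ip_sym f) ipZl. Qed.
Lemma ipNl f g : ip (- f) g = - ip f g.
Proof. by rewrite /ip mulNr raddfN. Qed.
Lemma ipNr f g : ip f (- g) = - ip f g.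
Proof. by rewrite !(ip_sym f) ipNl. Qed.
Lemma ipff f : ip f f = nrm2 f. Proof. by []. Qed.

Lemma nrm2D f g : nrm2 (f + g) = nrm2 f + nrm2 g + 2 * ip f g.
Proof. by rewrite -ipff ipDl !ipDr -!ipff (ip_sym g f); ring. Qed.
Lemma nrm2B f g : nrm2 (f - g) = nrm2 f + nrm2 g - 2 * ip f g.
Proof. by rewrite nrm2D -!ipff ipNl !ipNr; ring. Qed.
Lemma nrm2Z r f : nrm2 (rs r * f) = r ^+ 2 * nrm2 f.
Proof. by rewrite -ipff ipZl ipZr ipff; ring. Qed.
Lemma nrm2N f : nrm2 (- f) = nrm2 f.
Proof. by rewrite -!ipff ipNl ipNr opprK. Qed.
Lemma nrmN f : nrm (- f) = nrm f. Proof. by rewrite /nrm nrm2N. Qed.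
Lemma nrm2_0 : nrm2 0 = 0. Proof. by rewrite /nrm2 mul0r raddf0. Qed.
Lemma nrm0 : nrm 0 = 0. Proof. by rewrite /nrm nrm2_0 sqrtr0. Qed.
Lemma nrm2_1 : nrm2 1 = 1. Proof. by rewrite /nrm2 rmorph1 mulr1 tau1. Qed.
Lemma nrm1 : nrm 1 = 1. Proof. by rewrite /nrm nrm2_1 sqrtr1. Qed.
Lemma nrm2_star f : nrm2 (star S f) = nrm2 f.
Proof. by rewrite /nrm2 starK mulrC. Qed.
Lemma nrm2_U n f : nrm2 (U S n f) = nrm2 f.
Proof. by rewrite /nrm2 -U_star -rmorphM tauU. Qed.
Lemma nrm_star f : nrm (star S f) = nrm f. Proof. by rewrite /nrm nrm2_star. Qed.
Lemma nrm_U n f : nrm (U S n f) = nrm f. Proof. by rewrite /nrm nrm2_U. Qed.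
Lemma nrm_Z r f : nrm (rs r * f) = `|r| * nrm f.
Proof. by rewrite /nrm nrm2Z sqrtrM ?sqr_ge0// sqrtr_sqr. Qed.

Lemma CS2 f g : ip f g ^+ 2 <= nrm2 f * nrm2 g.
Proof.
set p := ip f g.
have h r : 0 <= nrm2 f + r ^+ 2 * nrm2 g - 2 * r * p.
  by have := nrm2_ge0 (f - rs r * g); rewrite nrm2B nrm2Z ipZr mulrA.
have [g0|g0] := eqVneq (nrm2 g) 0.
  rewrite g0 mulr0.
  have [->|p0] := eqVneq p 0; first by rewrite expr2 mulr0.
  have := h ((nrm2 f + 1) / (2 * p)); rewrite g0 mulr0 addr0.
  have -> : 2 * ((nrm2 f + 1) / (2 * p)) * p = nrm2 f + 1 by field.
  by rewrite opprD addNKr oppr_ge0 ler10.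
have gp : 0 < nrm2 g by rewrite lt0r g0 nrm2_ge0.
have := h (p / nrm2 g); rewrite -(pmulr_lge0 _ gp) => h'.
rewrite -subr_ge0; apply: le_trans h' _; rewrite le_eqVlt; apply/orP; left.
by apply/eqP; field.
Qed.

Lemma CS f g : `|ip f g| <= nrm f * nrm g.
Proof. by rewrite -sqrtrM ?nrm2_ge0// -sqrtr_sqr ler_sqrt ?CS2// mulr_ge0 ?nrm2_ge0. Qed.

Lemma CS_le f g : ip f g <= nrm f * nrm g.
Proof. exact: le_trans (ler_norm _) (CS f g). Qed.

Lemma nrmD f g : nrm (f + g) <= nrm f + nrm g.
Proof.
rewrite -(@ler_pXn2r _ 2) ?nnegrE ?addr_ge0 ?nrm_ge0// nrmE nrm2D sqrrD !nrmE.
by have := CS_le f g; lra.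
Qed.

Lemma nrmB f g : nrm (f - g) <= nrm f + nrm g.
Proof. by rewrite -(nrmN g) nrmD. Qed.

Lemma nrm_tri f g h : nrm (f - h) <= nrm (f - g) + nrm (g - h).
Proof. by have := nrmD (f - g) (g - h); rewrite addrA subrK. Qed.

Lemma nrmBC f g : nrm (f - g) = nrm (g - f). Proof. by rewrite -nrmN opprB. Qed.

Lemma nrm_le f g : nrm f - nrm g <= nrm (f - g).
Proof. by have := nrmD (f - g) g; rewrite subrK; lra. Qed.

Lemma tau_le f : `|tau S f| <= nrm f.
Proof. by have := CS f 1; rewrite /ip rmorph1 !mulr1 nrm1 mulr1. Qed.

Lemma tau_le' f : tau S f <= nrm f.
Proof. exact: le_trans (ler_norm _) (tau_le f). Qed.

Lemma nrm2_le f g : nrm2 f <= nrm2 g -> nrm f <= nrm g.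
Proof. by rewrite /nrm => h; apply: ler_wsqrtr. Qed.

Lemma nrm_le2 f r : 0 <= r -> nrm f <= r -> nrm2 f <= r ^+ 2.
Proof. by move=> r0 h; rewrite -nrmE ler_pXn2r ?nnegrE ?nrm_ge0. Qed.

Lemma nrm2_le_sqr f r : 0 <= r -> nrm2 f <= r ^+ 2 -> nrm f <= r.
Proof. by move=> r0; rewrite -nrmE ler_pXn2r ?nnegrE ?nrm_ge0. Qed.

(** ** Multiplication contractions *)

Lemma le1P f : le1 f <-> forall g, nrm (f * g) <= nrm g.
Proof.
split=> h g; first exact: nrm2_le.
by rewrite -!nrmE ler_pXn2r ?nnegrE ?nrm_ge0.
Qed.

Lemma le1_nrm f g : le1 f -> nrm (f * g) <= nrm g.
Proof. by move/le1P. Qed.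
Lemma le1_nrmr f g : le1 g -> nrm (f * g) <= nrm f.
Proof. by rewrite mulrC; apply: le1_nrm. Qed.
Lemma le1_nrm1 f : le1 f -> nrm f <= 1.
Proof. by move=> h; have := le1_nrm 1 h; rewrite mulr1 nrm1. Qed.
Lemma le1_nrm21 f : le1 f -> nrm2 f <= 1.
Proof. by move=> /(_ 1); rewrite mulr1 nrm2_1. Qed.
Lemma le1_1 : le1 1. Proof. by move=> g; rewrite mul1r. Qed.
Lemma le1_0 : le1 0. Proof. by move=> g; rewrite mul0r nrm2_0 nrm2_ge0. Qed.
Lemma le1M f g : le1 f -> le1 g -> le1 (f * g).
Proof. by move=> hf hg h; rewrite -mulrA; apply: le_trans (hf _) (hg _). Qed.
Lemma le1_star f : le1 f -> le1 (star S f).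
Proof.
move=> hf g; suff -> : nrm2 (star S f * g) = nrm2 (f * g) by [].
by rewrite /nrm2 !rmorphM /= starK; congr (tau S _); ring.
Qed.
Lemma le1U n f : le1 f -> le1 (U S n f).
Proof.
move=> hf g.
rewrite -[X in nrm2 (_ * X)](U0 g) -[0](subrr n) UD -rmorphM nrm2_U.
by apply: le_trans (hf _) _; rewrite nrm2_U.
Qed.
Lemma le1_iso f : f * star S f = 1 -> le1 f.
Proof.
move=> h g; rewrite /nrm2 rmorphM /=.
suff -> : f * g * (star S f * star S g) = (f * star S f) * (g * star S g) by rewrite h mul1r.
by ring.
Qed.
Lemma unim_star z : unim z -> sc S z * star S (sc S z) = 1.
Proof. by move=> h; rewrite star_sc -rmorphM h rmorph1. Qed.
Lemma le1_unim z : unim z -> le1 (sc S z).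
Proof. by move=> /unim_star/le1_iso. Qed.
Lemma nrm_unim z f : unim z -> nrm (sc S z * f) = nrm f.
Proof.
move=> /unim_star h; congr Num.sqrt; rewrite /nrm2 rmorphM /=.
suff -> : sc S z * f * (star S (sc S z) * star S f) = (sc S z * star S (sc S z)) * (f * star S f)
  by rewrite h mul1r.
by ring.
Qed.
Lemma le1_prod (I : Type) (s : seq I) (P : pred I) (F : I -> S) :
  (forall i, P i -> le1 (F i)) -> le1 (\prod_(i <- s | P i) F i).
Proof. by move=> h; elim/big_ind : _ => //; [exact: le1_1|exact: le1M]. Qed.
Lemma le1_tauM f g : le1 f -> tau S (f * g) <= nrm g.
Proof. by move=> h; apply: le_trans (tau_le' _) (le1_nrm _ h). Qed.

Lemma unim1 : unim 1. Proof. by rewrite /unim conjc1 mulr1. Qed.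
Lemma unimM z w : unim z -> unim w -> unim (z * w).
Proof.
rewrite /unim rmorphM /= => hz hw.
have -> : z * w * (z^*%C * w^*%C) = (z * z^*%C) * (w * w^*%C) by ring.
by rewrite hz hw mulr1.
Qed.
Lemma unimJ z : unim z -> unim (conjc z).
Proof. by rewrite /unim conjcK mulrC. Qed.
Lemma unim_neq0 z : unim z -> z != 0.
Proof. by apply: contra_eq_neq => ->; rewrite mul0r eq_sym oner_eq0. Qed.
Lemma unimV z : unim z -> z^-1 = conjc z.
Proof.
move=> h; have z0 := unim_neq0 h.
by rewrite -[LHS]mulr1 -h mulrA mulVf// mul1r.
Qed.
Lemma unim_exp z (n : nat) : unim z -> unim (z ^+ n).
Proof. by move=> h; elim: n => [|n ih]; [rewrite expr0; exact: unim1|rewrite exprS; exact: unimM]. Qed.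
Lemma unim_expz z (n : int) : unim z -> unim (z ^ n).
Proof.
move=> h; case: n => n; first exact: unim_exp.
by rewrite NegzE -exprz_inv unimV//; exact: (unim_exp n.+1 (unimJ h)).
Qed.
Lemma unim_prod (I : Type) (s : seq I) (P : pred I) (F : I -> R[i]) :
  (forall i, P i -> unim (F i)) -> unim (\prod_(i <- s | P i) F i).
Proof. by move=> h; elim/big_ind : _ => //; [exact: unim1|exact: unimM]. Qed.

(** ** Averages in the algebra *)

Definition amean (I : Type) (s : seq I) (v : I -> S) : S :=
  rs (size s)%:R^-1 * \sum_(x <- s) v x.

Section AMean.
Variable I : Type.
Implicit Types (s : seq I) (v : I -> S).

Lemma eq_amean s v v' : v =1 v' -> amean s v = amean s v'.
Proof. by move=> e; congr (_ * _); apply: eq_bigr => x _. Qed.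
Lemma ameanMl s f v : f * amean s v = amean s (fun x => f * v x).
Proof. by rewrite /amean mulrCA mulr_sumr. Qed.
Lemma ameanMr s f v : amean s v * f = amean s (fun x => v x * f).
Proof. by rewrite mulrC ameanMl; apply: eq_amean => x; rewrite mulrC. Qed.
Lemma ameanB s v v' : amean s (fun x => v x - v' x) = amean s v - amean s v'.
Proof. by rewrite /amean big_split /= sumrN mulrBr. Qed.
Lemma U_amean n s v : U S n (amean s v) = amean s (fun x => U S n (v x)).
Proof. by rewrite /amean rmorphM U_rs rmorph_sum. Qed.
Lemma tau_amean s v : tau S (amean s v) = \E_(x <- s) tau S (v x).
Proof. by rewrite /amean tau_rs raddf_sum. Qed.
Lemma sc_amean s (c : I -> R[i]) :
  amean s (fun x => sc S (c x)) = sc S (real_complex R (size s)%:R^-1 * \sum_(x <- s) c x).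
Proof. by rewrite /amean /rs [in RHS]rmorphM rmorph_sum. Qed.

Lemma ip_ameanl s v g : ip (amean s v) g = \E_(x <- s) ip (v x) g.
Proof. by rewrite /ip ameanMr tau_amean. Qed.
Lemma ip_ameanr s v g : ip g (amean s v) = \E_(x <- s) ip g (v x).
Proof. by rewrite ip_sym ip_ameanl; apply: eq_mean => x; rewrite ip_sym. Qed.
Lemma nrm2_amean s v : nrm2 (amean s v) = \E_(x <- s) \E_(y <- s) ip (v x) (v y).
Proof. by rewrite -ipff ip_ameanl; apply: eq_mean => x; rewrite ip_ameanr. Qed.

Lemma nrm_amean s v : nrm (amean s v) <= \E_(x <- s) nrm (v x).
Proof.
rewrite -(@ler_pXn2r _ 2) ?nnegrE ?nrm_ge0 ?mean_ge0//; last by move=> x; exact: nrm_ge0.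
rewrite nrmE nrm2_amean expr2 -meanZr; apply: ler_mean => x; rewrite -meanZ.
by apply: ler_mean => y; exact: CS_le.
Qed.

Lemma nrm2_amean_le s v : nrm2 (amean s v) <= \E_(x <- s) nrm2 (v x).
Proof.
rewrite -nrmE; apply: le_trans (_ : (\E_(x <- s) nrm (v x)) ^+ 2 <= _).
  rewrite ler_pXn2r ?nnegrE ?nrm_ge0 ?nrm_amean ?mean_ge0// => x; exact: nrm_ge0.
by apply: le_trans (mean_sqr _ _) _; apply: ler_mean => x; rewrite nrmE.
Qed.

Lemma le1_amean s v : (forall x, le1 (v x)) -> le1 (amean s v).
Proof.
move=> h; apply/le1P => g; rewrite ameanMr; apply: le_trans (nrm_amean _ _) _.
by apply: mean_le; [exact: nrm_ge0|move=> x; exact: le1_nrm].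
Qed.

Lemma nrm_amean_cst s v f e : (0 < size s)%N -> 0 <= e -> (forall x, nrm (v x - f) <= e) ->
  nrm (amean s v - f) <= e.
Proof.
move=> s0 e0 h.
have -> : f = amean s (fun=> f).
  rewrite /amean big_const_seq count_predT iter_addr_0 -[f *+ _]mulr_natl -rs_nat mulrA -rsM mulVf ?rs1 ?mul1r//.
  by rewrite pnatr_eq0 -lt0n.
by rewrite -ameanB; apply: le_trans (nrm_amean _ _) (mean_le _ _ h).
Qed.

End AMean.

Lemma amean_exch (I J : Type) (s : seq I) (s' : seq J) (v : I -> J -> S) :
  amean s (fun x => amean s' (v x)) = amean s' (fun y => amean s (v^~ y)).
Proof. by rewrite /amean -!mulr_sumr mulrCA exchange_big. Qed.

Lemma amean_iotaM (H K : nat) (v : nat -> S) :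
  amean (iota 0 (K * H)%N) v =
  amean (iota 0 K) (fun k => amean (iota 0 H) (fun i => v (k * H + i)%N)).
Proof.
rewrite /amean !size_iota -mulr_sumr mulrA -rsM -invfM natrM; congr (rs _ * _).
elim: K => [|K ih]; first by rewrite mul0n !big_nil.
have -> : iota 0 K.+1 = iota 0 K ++ [:: K] by rewrite -addn1 iotaD.
rewrite big_cat /= big_seq1 -ih.
rewrite mulSn addnC iotaD big_cat /= !add0n; congr (_ + _).
by rewrite -[X in iota X _]addn0 iotaDl big_map.
Qed.

(** ** Equality almost everywhere *)

Definition null f := nrm f = 0.

Lemma null0 : null 0. Proof. exact: nrm0. Qed.
Lemma nullN f : null f -> null (- f). Proof. by rewrite /null nrmN. Qed.
Lemma nullD f g : null f -> null g -> null (f + g).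
Proof.
rewrite /null => hf hg; apply/eqP; rewrite eq_le nrm_ge0 andbT.
by apply: le_trans (nrmD _ _) _; rewrite hf hg addr0.
Qed.
Lemma nullM f g : null f -> null (f * g).
Proof.
move=> hf; have [c c0 hc] := bounded_alg g.
apply/eqP; rewrite eq_le nrm_ge0 andbT -[X in _ <= X]sqrtr0 ler_sqrt//.
have : nrm2 (g * f) <= c * nrm2 f by exact: hc.
by rewrite -(nrmE f) hf expr2 mulr0 mulr0 mulrC.
Qed.
Lemma nullMr f g : null g -> null (f * g).
Proof. by rewrite mulrC; exact: nullM. Qed.
Lemma null_star f : null f -> null (star S f). Proof. by rewrite /null nrm_star. Qed.
Lemma null_U n f : null f -> null (U S n f). Proof. by rewrite /null nrm_U. Qed.
Lemma null_tau f : null f -> tau S f = 0.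
Proof. by move=> h; have := tau_le f; rewrite h normr_le0 => /eqP. Qed.

Definition eqv f g := null (f - g).
Lemma eqv_refl f : eqv f f. Proof. by rewrite /eqv subrr; exact: null0. Qed.
Lemma eqv_sym f g : eqv f g -> eqv g f. Proof. by move/nullN; rewrite opprB. Qed.
Lemma eqv_trans g f h : eqv f g -> eqv g h -> eqv f h.
Proof. by move=> a b; have := nullD a b; rewrite addrA subrK. Qed.
Lemma eqvM f f' g g' : eqv f f' -> eqv g g' -> eqv (f * g) (f' * g').
Proof.
move=> a b; have -> : eqv (f * g) (f' * g') = null ((f - f') * g + f' * (g - g')).
  by congr (null _); ring.
by apply: nullD; [exact: nullM|exact: nullMr].
Qed.
Lemma eqv_star f g : eqv f g -> eqv (star S f) (star S g).
Proof. by move=> /null_star; rewrite rmorphB. Qed.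
Lemma eqvU n f g : eqv f g -> eqv (U S n f) (U S n g).
Proof. by move=> /(null_U n); rewrite rmorphB. Qed.
Lemma eqv_tau f g : eqv f g -> tau S f = tau S g.
Proof. by move=> /null_tau/eqP; rewrite raddfB subr_eq0 => /eqP. Qed.
Lemma eqv_nrm2 f g : eqv f g -> nrm2 f = nrm2 g.
Proof. by move=> h; apply/eqv_tau/eqvM => //; exact: eqv_star. Qed.
Lemma eqv_nrm f g : eqv f g -> nrm f = nrm g.
Proof. by move=> h; rewrite /nrm (eqv_nrm2 h). Qed.

Lemma le1_eqv_iso f : eqv (f * star S f) 1 -> le1 f.
Proof.
move=> h g; rewrite /nrm2 rmorphM /=.
have -> : f * g * (star S f * star S g) = (f * star S f) * (g * star S g) by ring.
by rewrite (eqv_tau (eqvM h (eqv_refl _))) mul1r.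
Qed.

End Basics.

(** * Box norms *)

Section MeanMore.
Variable R : realType.

Lemma mean_exch4 (I J K L : Type) (s1 : seq I) (s2 : seq J) (s3 : seq K) (s4 : seq L)
    (a : I -> J -> K -> L -> R) :
  \E_(x <- s1) \E_(y <- s2) \E_(z <- s3) \E_(t <- s4) a x y z t =
  \E_(z <- s3) \E_(t <- s4) \E_(x <- s1) \E_(y <- s2) a x y z t.
Proof.
transitivity (\E_(x <- s1) \E_(z <- s3) \E_(t <- s4) \E_(y <- s2) a x y z t).
  apply: eq_mean => x; rewrite mean_exch; apply: eq_mean => z; exact: mean_exch.
by rewrite mean_exch; apply: eq_mean => z; exact: mean_exch.
Qed.

Lemma mean_ge_term (I : eqType) (s : seq I) (a : I -> R) x : (forall y, 0 <= a y) ->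
  x \in s -> (size s)%:R^-1 * a x <= \E_(y <- s) a y.
Proof.
move=> a0 xs; rewrite ler_wpM2l ?invr_ge0 ?ler0n//.
by rewrite (big_rem x)//= lerDl sumr_ge0.
Qed.

End MeanMore.

Section BoxNorm.
Variables (R : realType) (S : system R).
Implicit Types (f g F G : S).

Lemma UC m n f : U S m (U S n f) = U S n (U S m f).
Proof. by rewrite -!UD addrC. Qed.

Lemma UK m f : U S m (U S (- m) f) = f.
Proof. by rewrite -UD subrr U0. Qed.

Lemma nrm_amean_in (I : eqType) (s : seq I) (v : I -> S) f e : (0 < size s)%N -> 0 <= e ->
  {in s, forall x, nrm (v x - f) <= e} -> nrm (amean s v - f) <= e.
Proof.
move=> s0 e0 h; pose v' x := if x \in s then v x else f.
have -> : amean s v = amean s v'.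
  by congr (_ * _); apply: eq_big_seq => x xs; rewrite /v' xs.
apply: nrm_amean_cst => // x; rewrite /v'; case: ifPn => [xs|_]; first exact: h.
by rewrite subrr nrm0.
Qed.

(** Gowers-Host-Kra seminorms before the limit: averaging over finite boxes
    keeps every manipulation below an identity between finite sums, and the
    seminorm is the infimum over the lengths of the boxes. *)
Fixpoint boxnorm (Hs : seq nat) F : R :=
  if Hs is H :: Hs' then
    \E_(a < H) \E_(b < H) boxnorm Hs' (U S a%:Z F * star S (U S b%:Z F))
  else tau S F.

Lemma boxnormU Hs n F : boxnorm Hs (U S n F) = boxnorm Hs F.
Proof.
elim: Hs F => [|H Hs ih] F /=; first exact: tauU.
apply: eq_mean => a; apply: eq_mean => b.
by rewrite -[RHS]ih rmorphM /= U_star !(UC n).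
Qed.

Lemma boxnorm_swap H1 H2 Hs F : boxnorm [:: H1, H2 & Hs] F = boxnorm [:: H2, H1 & Hs] F.
Proof.
rewrite /= mean_exch4; apply: eq_mean => a; apply: eq_mean => b.
apply: eq_mean => c; apply: eq_mean => d; congr boxnorm.
by rewrite !rmorphM /= !U_star !starK !(UC a%:Z) !(UC b%:Z); ring.
Qed.

Lemma boxnorm1 H F : boxnorm [:: H] F = nrm2 (amean (iota 0 H) (fun a => U S a%:Z F)).
Proof. by rewrite nrm2_amean. Qed.

Lemma boxnorm_ge0 Hs F : Hs != [::] -> 0 <= boxnorm Hs F.
Proof.
elim: Hs F => [|H [|H' Hs] ih] F _ //; first by rewrite boxnorm1 nrm2_ge0.
by apply: mean_ge0 => a; apply: mean_ge0 => b; exact: ih.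
Qed.

Lemma boxnorm_le1 Hs F : le1 F -> boxnorm Hs F <= 1.
Proof.
elim: Hs F => [|H Hs ih] F h /=; first exact: le_trans (tau_le' _) (le1_nrm1 h).
do 2!(apply: mean_le => // ?); apply: ih; apply: le1M; first exact: le1U.
by apply/le1_star/le1U.
Qed.

Lemma boxnorm_mulhead K H Hs F : (0 < K)%N -> boxnorm ((K * H)%N :: Hs) F <= boxnorm (H :: Hs) F.
Proof.
move=> K0; elim: Hs F => [|H2 Hs ih] F.
  rewrite !boxnorm1 amean_iotaM; apply: le_trans (nrm2_amean_le _ _) _.
  apply: mean_le => [|k]; first exact: nrm2_ge0.
  rewrite -(nrm2_U (k * H)%:Z) le_eqVlt; apply/orP; left; apply/eqP.
  rewrite nrm2_U -[RHS](nrm2_U (k * H)%:Z) U_amean; congr nrm2.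
  by apply: eq_amean => a; rewrite -UD PoszD.
rewrite !(boxnorm_swap _ H2) /=; apply: ler_mean => a; apply: ler_mean => b.
exact: ih.
Qed.

(** The lengths may be enlarged to multiples, so that finitely many choices of
    boxes always have a common improvement. *)
Lemma boxnorm_mono Hs Hs' F : all2 (fun H H' => (H %| H')%N && (0 < H')%N) Hs Hs' ->
  boxnorm Hs' F <= boxnorm Hs F.
Proof.
elim: Hs Hs' F => [|H Hs ih] [|H' Hs'] F //= /andP[/andP[/dvdnP[K ->]]].
rewrite muln_gt0 => /andP[K0 H0] hs.
apply: le_trans (_ : boxnorm ((K * H)%N :: Hs) F <= _); last exact: boxnorm_mulhead.
by do 2!(apply: ler_mean => ?); exact: ih.
Qed.

Lemma tau_amean_U J F : (0 < J)%N -> tau S F = tau S (amean (iota 0 J) (fun j => U S j%:Z F)).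
Proof.
move=> J0; rewrite tau_amean -[LHS](@mean_cst R nat (iota 0 J)) ?size_iota//.
by apply: eq_mean => j; rewrite tauU.
Qed.

(** At the innermost level the integral of a function is that of the average of
    its translates, hence at most the norm of this average; the Cauchy-Schwarz
    inequality carries the square outside. *)
Lemma boxnorm_raise Hs J F : (0 < J)%N -> boxnorm Hs F ^+ 2 <= boxnorm (rcons Hs J) F.
Proof.
move=> J0; elim: Hs F => [|H Hs ih] F.
  rewrite -cats1 cat0s boxnorm1 /= (tau_amean_U F J0).
  rewrite -nrmE -real_normK ?num_real// ler_pXn2r ?nnegrE ?nrm_ge0 ?normr_ge0//; exact: tau_le.
rewrite /=; apply: le_trans (mean_sqr _ _) _; apply: ler_mean => a.
by apply: le_trans (mean_sqr _ _) _; apply: ler_mean => b; exact: ih.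
Qed.

(** The multiples of [k] form one residue class among [k], and all the classes
    contribute nonnegative amounts; hence the loss of a factor [k]. *)
Lemma boxnorm_dilate_nat (k : nat) H Hs F : (0 < k)%N -> Hs != [::] ->
  \E_(a < H) \E_(b < H) boxnorm Hs (U S (k * a)%N%:Z F * star S (U S (k * b)%N%:Z F)) <=
  k%:R * boxnorm ((k * H)%N :: Hs) F.
Proof.
move=> k0 Hs0; rewrite /= mulnC mean_iotaM -meanZ.
apply: ler_mean => a; rewrite -ler_pdivrMl ?ltr0n//.
rewrite -[leLHS](@mean_cst R nat (iota 0 k)) ?size_iota//; apply: ler_mean_in => r.
rewrite mem_iota => /andP[_ rk].
rewrite mean_iotaM -meanZ; apply: ler_mean => b.
apply: le_trans (mean_ge_term (x := r) _ _); rewrite ?mem_iota//; last first.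
  by move=> y; exact: boxnorm_ge0.
rewrite size_iota ler_pdivlMl ?ltr0n// mulrA divff ?mul1r ?pnatr_eq0 -?lt0n//.
rewrite -[leLHS](boxnormU _ r%:Z) rmorphM /= U_star -!UD.
by rewrite !PoszD !PoszM ![r%:Z + _]addrC ![k%:Z * _]mulrC.
Qed.

Lemma boxnorm_dilate (k : int) H Hs F : k != 0 -> Hs != [::] ->
  \E_(a < H) \E_(b < H) boxnorm Hs (U S (k * a%:Z) F * star S (U S (k * b%:Z) F)) <=
  `|k|%:R * boxnorm ((`|k| * H)%N :: Hs) F.
Proof.
move=> k0 Hs0; apply: le_trans (boxnorm_dilate_nat _ _ _ Hs0); last by rewrite absz_gt0.
case: k k0 => k k0 /=; first by apply: ler_mean => a; apply: ler_mean => b; rewrite !PoszM.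
rewrite mean_exch; apply: ler_mean => a; apply: ler_mean => b.
rewrite -(boxnormU _ (k.+1%:Z * (a%:Z + b%:Z))) rmorphM /= U_star -!UD.
by rewrite NegzE !mulNr mulrDr addrK addrC addKr !PoszM.
Qed.

(** ** Van der Corput's inequality *)

Lemma nrm_amean_shift1 (v : int -> S) M N : (forall n, nrm (v n) <= 1) -> (0 < N)%N ->
  nrm (amean (iota 0 N) (fun j => v (M + 1 + j%:Z)) - amean (iota 0 N) (fun j => v (M + j%:Z)))
  <= 2 / N%:R.
Proof.
move=> v1 N0; rewrite -ameanB /amean size_iota nrm_Z ger0_norm ?invr_ge0 ?ler0n//.
rewrite mulrC ler_pM2r ?invr_gt0 ?ltr0n//.
have -> : \sum_(j <- iota 0 N) (v (M + 1 + j%:Z) - v (M + j%:Z)) = v (M + N%:Z) - v M.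
  elim: N {N0} => [|N ih]; first by rewrite big_nil addr0 subrr.
  rewrite -[N.+1]addn1 iotaD big_cat /= big_seq1 ih add0n PoszD.
  by rewrite addrC subrKA addrAC -addrA.
by apply: le_trans (nrmB _ _) _; have := v1 M; have := v1 (M + N%:Z); lra.
Qed.

Lemma nrm_amean_shift (v : int -> S) M N (k : nat) : (forall n, nrm (v n) <= 1) -> (0 < N)%N ->
  nrm (amean (iota 0 N) (fun j => v (M + k%:Z + j%:Z)) - amean (iota 0 N) (fun j => v (M + j%:Z)))
  <= 2 * k%:R / N%:R.
Proof.
move=> v1 N0; elim: k => [|k ih].
  by rewrite addr0 subrr nrm0 mulr0 mul0r.
rewrite -[k.+1]addn1 PoszD addrA.
apply: le_trans (nrm_tri _ (amean (iota 0 N) (fun j => v (M + k%:Z + j%:Z))) _) _.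
apply: le_trans (lerD (nrm_amean_shift1 (M + k%:Z) v1 N0) ih) _ => //.
by rewrite -mulrDl natrD ler_wpM2r ?invr_ge0 ?ler0n//; lra.
Qed.

(** Averaging [v] over windows of length [H] changes its average by at most the
    two ends of the interval; expanding the square of a window gives the
    correlations. *)
Lemma van_der_corput (v : int -> S) M N H : (forall n, nrm (v n) <= 1) -> (0 < N)%N -> (0 < H)%N ->
  nrm2 (amean (iota 0 N) (fun j => v (M + j%:Z))) <=
  \E_(a < H) \E_(b < H) \E_(j < N) ip (v (M + j%:Z + a%:Z)) (v (M + j%:Z + b%:Z))
  + 4 * H%:R / N%:R.
Proof.
move=> v1 N0 H0; set w := amean _ _.
pose w' := amean (iota 0 N) (fun j => amean (iota 0 H) (fun a => v (M + j%:Z + a%:Z))).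
have ww' : nrm (w' - w) <= 2 * H%:R / N%:R.
  have c0 : 0 <= 2 * H%:R / N%:R :> R by rewrite !mulr_ge0 ?invr_ge0 ?ler0n.
  rewrite /w' amean_exch; apply: nrm_amean_in c0 _; first by rewrite size_iota.
  move=> a; rewrite mem_iota => /andP[_ aH].
  under eq_amean do rewrite -addrA [_ + a%:Z]addrC addrA.
  apply: le_trans (nrm_amean_shift M a v1 N0) _.
  rewrite ler_wpM2r ?invr_ge0 ?ler0n// ler_wpM2l// ler_nat; exact: ltnW.
have w1 : nrm w <= 1 by apply: le_trans (nrm_amean _ _) _; apply: mean_le.
have w'1 : nrm w' <= 1.
  do 2!(apply: le_trans (nrm_amean _ _) _; apply: mean_le => // ?); exact: v1.
have -> : \E_(a < H) \E_(b < H) \E_(j < N) ip (v (M + j%:Z + a%:Z)) (v (M + j%:Z + b%:Z)) =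
   \E_(j < N) nrm2 (amean (iota 0 H) (fun a => v (M + j%:Z + a%:Z))).
  transitivity (\E_(j < N) \E_(a < H) \E_(b < H)
     ip (v (M + j%:Z + a%:Z)) (v (M + j%:Z + b%:Z))).
    by rewrite [RHS]mean_exch; apply: eq_mean => a; exact: mean_exch.
  by apply: eq_mean => j; rewrite nrm2_amean.
apply: le_trans (_ : nrm2 w' + 4 * H%:R / N%:R <= _); last by rewrite lerD2r nrm2_amean_le.
have := nrm_le w w'; rewrite nrmBC => lew.
have d : nrm w - nrm w' <= 2 * H%:R / N%:R by apply: le_trans lew ww'.
have := nrm_ge0 w; have := nrm_ge0 w'.
have e : 4 * H%:R / N%:R = 2 * (2 * H%:R / N%:R) :> R by ring.
have e0 : 0 <= 2 * H%:R / N%:R :> R by rewrite !mulr_ge0 ?invr_ge0 ?ler0n.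
rewrite -!nrmE e; nra.
Qed.

End BoxNorm.

Arguments boxnorm : simpl never.

Lemma boxnorm_cons (R : realType) (S : system R) H Hs (F : S) : boxnorm (H :: Hs) F =
  \E_(a < H) \E_(b < H) boxnorm Hs (U S a%:Z F * star S (U S b%:Z F)).
Proof. by []. Qed.

Lemma ex_nat_ge (R : realType) (x : R) : exists n : nat, x <= n%:R.
Proof.
exists (Num.bound `|x|); apply: le_trans (ler_norm x) _.
by apply/ltW/archi_boundP.
Qed.

(** * Averages along linear sequences *)

Section Linear.
Variables (R : realType) (S : system R).
Implicit Types (f g F G : S).

Lemma le1_prod_seq (I : eqType) (s : seq I) (F : I -> S) :
  {in s, forall i, le1 (F i)} -> le1 (\prod_(i <- s) F i).
Proof. by move=> h; rewrite big_seq; apply: le1_prod. Qed.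

(** The form in which the inequality is used: a large average leaves, for the
    interval long enough, a large average of any upper bound [y] of the
    correlations. *)
Lemma van_der_corput_lower (v : int -> S) M N H e (y : nat -> nat -> R) :
  0 < e -> (forall n, le1 (v n)) -> (0 < N)%N -> (0 < H)%N -> 8 * H%:R / e <= N%:R ->
  e <= nrm2 (amean (iota 0 N) (fun j => v (M + j%:Z))) ->
  (forall a b, \E_(j < N) ip (v (M + j%:Z + a%:Z)) (v (M + j%:Z + b%:Z)) <= y a b) ->
  e / 2 <= \E_(a < H) \E_(b < H) y a b.
Proof.
move=> e0 v1 N0 H0 NH ev hy.
have := van_der_corput M (fun n => le1_nrm1 (v1 n)) N0 H0 => h.
have d : 4 * H%:R / N%:R <= e / 2.
  rewrite ler_pdivrMr ?ltr0n//; move: NH; rewrite ler_pdivrMr//; lra.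
apply: le_trans (_ : \E_(a < H) \E_(b < H) \E_(j < N)
  ip (v (M + j%:Z + a%:Z)) (v (M + j%:Z + b%:Z)) <= _); last by do 2!(apply: ler_mean => ?).
by lra.
Qed.

Definition linprod (Q : seq (int * S)) (n : int) : S := \prod_(x <- Q) U S (x.1 * n) x.2.

Lemma le1_linprod Q n : {in Q, forall x, le1 x.2} -> le1 (linprod Q n).
Proof. by move=> h; apply: le1_prod_seq => x xQ; apply/le1U/h. Qed.

Definition linavg (c : int -> R[i]) a F Q M N : S :=
  amean (iota 0 N) (fun j => sc S (c (M + j%:Z)) * U S (a * (M + j%:Z)) F * linprod Q (M + j%:Z)).

Definition lin_diff (k l : int) (x : int * S) : int * S :=
  (x.1, U S (x.1 * k) x.2 * star S (U S (x.1 * l) x.2)).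

Arguments lin_diff : simpl never.

Lemma le1_lin_diff k l x : le1 x.2 -> le1 (lin_diff k l x).2.
Proof. by move=> h; apply: le1M; [exact: le1U|exact/le1_star/le1U]. Qed.

Lemma lin_diff_term k l n x :
  U S (x.1 * (n + k)) x.2 * star S (U S (x.1 * (n + l)) x.2) = U S (x.1 * n) (lin_diff k l x).2.
Proof. by rewrite !mulrDr !UD rmorphM /= U_star. Qed.

Lemma linprod_diff Q k l n :
  linprod Q (n + k) * star S (linprod Q (n + l)) = linprod (map (lin_diff k l) Q) n.
Proof.
rewrite /linprod big_map rmorph_prod -big_split /=; apply: eq_bigr => x _.
exact: lin_diff_term.
Qed.

Lemma linprod_shift Q b n :
  U S (- (b * n)) (linprod Q n) = linprod [seq (x.1 - b, x.2) | x <- Q] n.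
Proof.
rewrite /linprod big_map rmorph_prod; apply: eq_bigr => x _ /=.
by rewrite -UD mulrBl addrC.
Qed.

Section Step.
Variables (c : int -> R[i]) (a : int) (F : S) (Q : seq (int * S)).
Let v n := sc S (c n) * U S (a * n) F * linprod Q n.

Lemma lin_ip n k l :
  ip (v (n + k)) (v (n + l)) =
  tau S (sc S (c (n + k) * conjc (c (n + l))) * U S (a * n) (lin_diff k l (a, F)).2
         * linprod (map (lin_diff k l) Q) n).
Proof.
rewrite -linprod_diff -(lin_diff_term k l n (a, F)) /ip /v !rmorphM /= star_sc.
by congr (tau S _); ring.
Qed.

Lemma lin_ip_shift n k l b :
  ip (v (n + k)) (v (n + l)) =
  tau S (sc S (c (n + k) * conjc (c (n + l))) * U S ((a - b) * n) (lin_diff k l (a, F)).2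
         * linprod [seq (x.1 - b, x.2) | x <- map (lin_diff k l) Q] n).
Proof.
rewrite lin_ip -(tauU (- (b * n))) rmorphM [U S _ (sc S _ * _)]rmorphM /= U_sc.
by rewrite linprod_shift -UD [- (b * n) + _]addrC mulrBl.
Qed.

End Step.

Lemma sc_invariant_bound z G J : le1 (sc S z) -> (0 < J)%N ->
  tau S (sc S z * G) <= nrm (amean (iota 0 J) (fun j => U S j%:Z G)).
Proof.
move=> z1 J0; rewrite (tau_amean_U _ J0).
apply: le_trans (le1_tauM _ z1); rewrite ameanMl le_eqVlt; apply/orP; left; apply/eqP.
by congr (tau S _); apply: eq_amean => j; rewrite rmorphM /= U_sc.
Qed.

(** Each use of van der Corput's inequality removes one of the linear
    sequences at the cost of replacing [F] by the product of two of its
    translates, whose box norms average to a box norm of [F] of one degree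
    more. *)
Lemma linear_control (As : seq int) (a : int) : a != 0 -> a \notin As ->
  forall e : R, 0 < e -> exists2 eta : R, 0 < eta &
  forall Hs, size Hs = (size As).+2 -> all (leq 1) Hs ->
  exists L, forall N M c F Q, (L <= N)%N -> (forall n, unim (c n)) -> le1 F ->
    map fst Q = As -> {in Q, forall x, le1 x.2} ->
    e <= nrm2 (linavg c a F Q M N) -> eta <= boxnorm Hs F.
Proof.
move sz: (size As) => n; elim: n As sz a => [|n ih] [|b As] //= sz a a0 aAs e e0.
  exists (e ^+ 2 / (4 * `|a|%:R)).
    by rewrite divr_gt0 ?mulr_gt0 ?exprn_gt0// ltr0n absz_gt0.
  case=> [|H [|J []]]// _ /= /and3P[H0 J0 _].
  have [L hL] := ex_nat_ge (8 * H%:R / e).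
  exists (maxn 1 L) => N M c F Q; rewrite geq_max => /andP[N0 LN] c1 F1 Q0 _.
  case: Q Q0 => // _ h.
  pose Fd (k l : nat) := (lin_diff k l (a, F)).2.
  have Fd1 k l : le1 (Fd k l) by exact: le1_lin_diff.
  have : e / 2 <= \E_(k < H) \E_(l < H) nrm (amean (iota 0 J) (fun j => U S j%:Z (Fd k l))).
    apply: (@van_der_corput_lower (fun n => sc S (c n) * U S (a * n) F * linprod [::] n)
      M N H e _ _ _ _ _ _ h) => // [n||k l].
    - by apply: le1M; [apply: le1M; [exact: le1_unim|exact: le1U]|exact: le1_linprod].
    - by apply: le_trans hL _; rewrite ler_nat.
    rewrite (_ : mean _ _ = tau S (sc S (real_complex R (size (iota 0 N))%:R^-1 * \sum_(j <- iota 0 N)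
      (c (M + j%:Z + k%:Z) * conjc (c (M + j%:Z + l%:Z)))) * Fd k l)).
      apply: sc_invariant_bound => //; rewrite -sc_amean; apply: le1_amean => j.
      by apply/le1_unim/unimM; [exact: c1|exact/unimJ/c1].
    rewrite -sc_amean ameanMr tau_amean; apply: eq_mean => j.
    rewrite lin_ip /linprod big_nil mulr1 -(tauU (- (a * (M + j%:Z)))) rmorphM /= U_sc -UD addNr U0.
    by [].
  set y := mean _ _ => ye.
  have y2 : (e / 2) ^+ 2 <= \E_(k < H) \E_(l < H) boxnorm [:: J] (Fd k l).
    apply: le_trans (_ : y ^+ 2 <= _).
      by rewrite ler_pXn2r ?nnegrE ?(le_trans _ ye)// divr_ge0 ?ltW.
    rewrite /y; apply: le_trans (mean_sqr _ _) _; apply: ler_mean => k.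
    apply: le_trans (mean_sqr _ _) _; apply: ler_mean => l.
    by rewrite nrmE boxnorm1.
  have := le_trans y2 (boxnorm_dilate H F a0 (isT : [:: J] != [::])) => y3.
  have := boxnorm_mulhead H [:: J] F (K := `|a|%N); rewrite absz_gt0 => /(_ a0) y4.
  have aR : 0 < `|a|%:R :> R by rewrite ltr0n absz_gt0.
  rewrite ler_pdivrMr ?mulr_gt0//.
  have : `|a|%:R * boxnorm ((`|a| * H)%N :: [:: J]) F <= `|a|%:R * boxnorm [:: H; J] F.
    by rewrite ler_wpM2l// ltW.
  have e2 : (e / 2) ^+ 2 = e ^+ 2 / 4 by field.
  by move: y3; rewrite e2; lra.
move: aAs; rewrite inE negb_or => /andP[ab aAs].
have ab0 : a - b != 0 by rewrite subr_eq0.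
have abAs : a - b \notin [seq x - b | x <- As].
  by apply: contra aAs => /mapP[x xA /addIr ->].
have e4 : 0 < (e / 4) ^+ 2 by rewrite exprn_gt0 ?divr_gt0.
have szm : size [seq x - b | x <- As] = n by rewrite size_map; case: sz.
have [eta eta0 heta] := ih _ szm _ ab0 abAs _ e4.
have aR : 0 < `|a|%:R :> R by rewrite ltr0n absz_gt0.
exists (eta * e / (4 * `|a|%:R)); first by rewrite divr_gt0 ?mulr_gt0.
case=> // H Hs [sHs] /= /andP[H0 Hs0].
have [L1 hL1] := heta Hs sHs Hs0.
have [L hL] := ex_nat_ge (8 * H%:R / e).
exists (maxn 1 (maxn L1 L)) => N M c F [|[b' f] Q]// + c1 F1 [-> QAs] Q1 h.
rewrite !geq_max => /and3P[N0 L1N LN].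
have Hs0' : Hs != [::] by case: (Hs) sHs.
pose Fd (k l : nat) := (lin_diff k l (a, F)).2.
have Fd1 k l : le1 (Fd k l) by exact: le1_lin_diff.
pose y (k l : nat) := nrm (linavg (fun n => c (n + k%:Z) * conjc (c (n + l%:Z))) (a - b) (Fd k l)
   [seq (x.1 - b, x.2) | x <- map (lin_diff k l) Q] M N).
have f1 : le1 f by apply: (Q1 (b, f)); rewrite mem_head.
have Q1' : {in Q, forall x, le1 x.2} by move=> x xQ; apply: Q1; rewrite inE xQ orbT.
have cc1 k l m : unim (c (m + k%:Z) * conjc (c (m + l%:Z))).
  by apply: unimM; [exact: c1|exact/unimJ/c1].
have Qd1 k l : {in [seq (x.1 - b, x.2) | x <- map (lin_diff k l) Q], forall x, le1 x.2}.
  by move=> x /mapP[z /mapP[t tQ ->] ->]; apply/le1_lin_diff/Q1'.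
have y1 k l : y k l <= 1.
  apply/le1_nrm1/le1_amean => j; apply: le1M; last exact/le1_linprod.
  by apply: le1M; [exact/le1_unim|exact: le1U].
have : e / 2 <= \E_(k < H) \E_(l < H) y k l.
  apply: (@van_der_corput_lower (fun n => sc S (c n) * U S (a * n) F * linprod ((b, f) :: Q) n)
    M N H e _ _ _ _ _ _ h) => // [m||k l].
  - by apply: le1M; [apply: le1M; [exact: le1_unim|exact: le1U]|exact: le1_linprod].
  - by apply: le_trans hL _; rewrite ler_nat.
  rewrite [leLHS](_ : _ = tau S ((lin_diff k l (b, f)).2 * linavg (fun n => c (n + k%:Z) * conjc (c (n + l%:Z))) (a - b) (Fd k l)
   [seq (x.1 - b, x.2) | x <- map (lin_diff k l) Q] M N)).
    by apply: le1_tauM; exact: le1_lin_diff.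
  rewrite /linavg ameanMl tau_amean; apply: eq_mean => j.
  rewrite (lin_ip_shift _ _ _ _ _ _ _ b) /linprod /= big_cons /= subrr mul0r U0 /linprod.
  by congr (tau S _); rewrite /Fd /lin_diff /=; ring.
move=> ye.
(* either the new average is small or the induction hypothesis bounds a box norm *)
have key k l : y k l <= e / 4 + eta^-1 * boxnorm Hs (Fd k l).
  have [ylt|yge] := leP (y k l) (e / 4).
    by apply: le_trans ylt _; rewrite lerDl mulr_ge0 ?invr_ge0 ?boxnorm_ge0// ltW.
  apply: le_trans (y1 k l) _; apply: le_trans (_ : eta^-1 * boxnorm Hs (Fd k l) <= _).
    rewrite ler_pdivlMl// mulr1.
    apply: (hL1 N M _ _ _ L1N (cc1 k l) (Fd1 k l) _ (Qd1 k l)).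
      by rewrite -map_comp -QAs -!map_comp; apply: eq_map.
    by rewrite -nrmE ler_pXn2r ?nnegrE ?nrm_ge0 ?divr_ge0// ltW.
  by rewrite lerDr divr_ge0// ltW.
have : e / 2 <= e / 4 + eta^-1 * \E_(k < H) \E_(l < H) boxnorm Hs (Fd k l).
  apply: le_trans ye _; rewrite -[X in X + _](@mean_cst R nat (iota 0 H)) ?size_iota//.
  rewrite -meanZ -meanD; apply: ler_mean => k.
  rewrite -[X in X + _](@mean_cst R nat (iota 0 H)) ?size_iota//.
  by rewrite -meanZ -meanD; apply: ler_mean => l.
have := boxnorm_dilate H F a0 Hs0' => y3.
have := boxnorm_mulhead H Hs F (K := `|a|%N); rewrite absz_gt0 => /(_ a0) y4.
have : `|a|%:R * boxnorm ((`|a| * H)%N :: Hs) F <= `|a|%:R * boxnorm (H :: Hs) F.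
  by rewrite ler_wpM2l// ltW.
set z := mean _ _ in y3 *.
move=> y5 y6.
have : eta * (e / 4) <= z by rewrite -ler_pdivlMl//; lra.
by rewrite ler_pdivrMr ?mulr_gt0//; move: y3 y5; lra.
Qed.

End Linear.

(** * Integer polynomials *)

Section IntegerPoly.
Variable R : realType.
Implicit Types p q : {poly R}.

Definition shp (k : int) p : {poly R} := p \Po ('X + (k%:~R)%:P).

Lemma zevalE p n : integer_polynomial p -> (zeval p n)%:~R = p.[n%:~R].
Proof. by move=> /(_ n) h; apply: floorK. Qed.

Lemma zevalB p q n : integer_polynomial p -> integer_polynomial q ->
  zeval (p - q) n = zeval p n - zeval q n.
Proof.
move=> hp hq; apply: (@intr_inj R); rewrite rmorphB /= !zevalE// ?hornerD ?hornerN//.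
by move=> m; rewrite hornerD hornerN rpredB.
Qed.

Lemma zevalN q n : integer_polynomial q -> zeval (- q) n = - zeval q n.
Proof.
move=> hq; apply: (@intr_inj R); rewrite rmorphN /= !zevalE// ?hornerN//.
by move=> m; rewrite hornerN rpredN.
Qed.

Lemma horner_shp k p x : (shp k p).[x] = p.[x + k%:~R].
Proof. by rewrite /shp horner_comp !hornerE. Qed.

Lemma zeval_shp k p n : zeval (shp k p) n = zeval p (n + k).
Proof. by rewrite /zeval horner_shp intrD. Qed.

Lemma intp_shp k p : integer_polynomial p -> integer_polynomial (shp k p).
Proof. by move=> h n; rewrite horner_shp -intrD. Qed.

Lemma intpB p q : integer_polynomial p -> integer_polynomial q -> integer_polynomial (p - q).
Proof. by move=> hp hq n; rewrite hornerD hornerN rpredB. Qed.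

Lemma intpN q : integer_polynomial q -> integer_polynomial (- q).
Proof. by move=> hq n; rewrite hornerN rpredN. Qed.

Lemma zeval_cst p n : (size p <= 1)%N -> zeval p n = zeval p 0.
Proof. by move=> /size1_polyC ->; rewrite /zeval !hornerC. Qed.

Lemma zeval_linear p n : integer_polynomial p -> (size p <= 2)%N ->
  zeval p n = (zeval p 1 - zeval p 0) * n + zeval p 0.
Proof.
move=> hp sp; apply: (@intr_inj R); rewrite rmorphD rmorphM rmorphB /= !zevalE//.
have hor x : p.[x] = p`_0 + p`_1 * x.
  by rewrite (horner_coef_wide _ sp) !big_ord_recl big_ord0 /= expr0 mulr1 expr1 addr0.
by rewrite !hor; ring.
Qed.

Lemma shpB k p q : shp k (p - q) = shp k p - shp k q.
Proof. by rewrite /shp comp_polyB. Qed.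

Lemma size_shp k p : size (shp k p) = size p.
Proof. by rewrite /shp size_comp_poly2// size_XaddC. Qed.

Lemma lead_shp k p : lead_coef (shp k p) = lead_coef p.
Proof. by rewrite /shp lead_coef_comp ?size_XaddC// lead_coefXaddC expr1n mulr1. Qed.

Lemma inf_roots_eq0 p : (forall n : nat, p.[n%:R] = 0) -> p = 0.
Proof.
move=> h; apply/eqP; apply: contraT => p0.
have := @max_poly_roots R p [seq n%:R | n <- iota 0 (size p)] p0.
rewrite size_map size_iota ltnn => -> //.
  by apply/allP => x /mapP[n _ ->]; rewrite rootE h.
rewrite map_inj_uniq ?iota_uniq// => m n /eqP.
by rewrite eqr_nat => /eqP.
Qed.

(** A polynomial differing by a constant from one of its nontrivial translates
    grows linearly along an arithmetic progression. *)
Lemma size_shpB k l p : k != l -> (size (shp k p - shp l p)%R <= 1)%N -> (size p <= 2)%N.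
Proof.
move=> kl /size1_polyC; set c := _`_0 => hc.
pose t : R := k%:~R - l%:~R.
have t0 : t != 0 by rewrite subr_eq0 eqr_int.
have inc x : p.[x + t] = p.[x] + c.
  have := congr1 (horner^~ (x - l%:~R)) hc.
  rewrite hornerD hornerN !horner_shp hornerC subrK => <-.
  by rewrite [RHS]addrC subrK /t addrAC addrA.
have it n : p.[n%:R * t] = p.[0] + n%:R * c.
  elim: n => [|n ih]; first by rewrite !mul0r addr0.
  by rewrite -addn1 natrD mulrDl mul1r inc ih; ring.
have st : size (t *: 'X : {poly R}) = 2%N by rewrite size_scale// size_polyX.
have := @inf_roots_eq0 (p \Po (t *: 'X) - (p.[0]%:P + c *: 'X)).
have h : forall n : nat, (p \Po (t *: 'X) - (p.[0]%:P + c *: 'X)).[n%:R] = 0.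
  by move=> n; rewrite hornerD hornerN horner_comp !hornerE [t * _]mulrC it; ring.
move=> /(_ h)/eqP; rewrite subr_eq0 => /eqP e.
rewrite -(size_comp_poly2 p st) e.
apply: leq_trans (size_polyD _ _) _; rewrite geq_max.
by rewrite (leq_trans (size_polyC_leq1 _))// (leq_trans (size_scale_leq _ _))// size_polyX.
Qed.

Lemma size_subl p q : (size q < size p)%N ->
  size (p - q) = size p /\ lead_coef (p - q) = lead_coef p.
Proof.
by move=> h; rewrite size_polyDl ?lead_coefDl ?size_polyN.
Qed.

Lemma size_subr p q : (size p < size q)%N -> size (p - q) = size q.
Proof. by move=> h; rewrite addrC size_polyDl size_polyN. Qed.

Lemma size_sub_same p q : size p = size q -> p != 0 ->
  (size (p - q) = size p) <-> (lead_coef p <> lead_coef q).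
Proof.
move=> s p0; have ps : (0 < size p)%N by rewrite size_poly_gt0.
have ceq : (p - q)`_(size p).-1 = lead_coef p - lead_coef q.
  by rewrite coefB !lead_coefE s.
split=> [h e|h].
  have : lead_coef (p - q) = 0 by rewrite lead_coefE h ceq e subrr.
  by move/eqP; rewrite lead_coef_eq0 => /eqP e0; move: h ps; rewrite e0 size_poly0 => <-.
apply/eqP; rewrite eqn_leq; apply/andP; split.
  by apply: leq_trans (size_polyD _ _) _; rewrite size_polyN s maxnn.
rewrite leqNgt; apply/negP => lt; apply: h; apply/eqP; rewrite -subr_eq0 -ceq.
by rewrite nth_default//; case: (size p) lt ps.
Qed.

Lemma lead_sub_same p q : size p = size q -> size (p - q) = size p ->
  lead_coef (p - q) = lead_coef p - lead_coef q.
Proof. by move=> s h; rewrite !lead_coefE h coefB s. Qed.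

End IntegerPoly.

(** * Lexicographic induction *)

Definition lexlt d (w' w : nat -> nat) := exists e,
  [/\ (0 < e <= d)%N, (w' e < w e)%N & forall e', (e < e' <= d)%N -> (w' e' <= w e')%N].

Lemma lex_ind (T : Type) (w : T -> nat -> nat) d (P : T -> Prop) :
  (forall x, (forall y, lexlt d (w y) (w x) -> P y) -> P x) -> forall x, P x.
Proof.
elim: d P => [|d ihd] P H x.
  by apply: H => y [e [/andP[]]]; case: e.
have [n] := ubnP (w x d.+1); elim: n x => // n ihn x wx.
move: x wx; apply: ihd => x ihx; rewrite ltnS => wx.
apply: H => y [e [/andP[e0]]]; rewrite leq_eqVlt => /predU1P[-> lt _|].
  by apply: ihn; exact: leq_trans lt wx.
rewrite ltnS => ed lt h; apply: ihx; last by rewrite ltnS; apply: leq_trans wx; apply: h; rewrite ltnS ed leqnn.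
exists e; split; rewrite ?e0 ?ed// => e' /andP[ee' e'd]; apply: h.
by rewrite ee' leqW.
Qed.

(** * Averages along polynomials *)

Section PET.
Variables (R : realType) (S : system R).
Implicit Types (f g F G : S) (p q : {poly R}).

Definition polyprod (Q : seq ({poly R} * S)) (n : int) : S :=
  \prod_(x <- Q) U S (zeval x.1 n) x.2.

Lemma le1_polyprod Q n : {in Q, forall x, le1 x.2} -> le1 (polyprod Q n).
Proof. by move=> h; apply: le1_prod_seq => x xQ; apply/le1U/h. Qed.

Definition polyavg (c : int -> R[i]) q F Q M N : S :=
  amean (iota 0 N)
    (fun j => sc S (c (M + j%:Z)) * U S (zeval q (M + j%:Z)) F * polyprod Q (M + j%:Z)).

Lemma le1_polyterm (c : int -> R[i]) q F Q n : unim (c n) -> le1 F -> {in Q, forall x, le1 x.2} ->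
  le1 (sc S (c n) * U S (zeval q n) F * polyprod Q n).
Proof.
move=> c1 F1 Q1; apply: le1M; last exact: le1_polyprod.
by apply: le1M; [exact: le1_unim|exact: le1U].
Qed.

Definition controls m H F := exists2 s, (2 <= s <= m)%N & m.+1%:R^-1 <= boxnorm (nseq s H) F.

(** Large averages force a lower bound for some box norm of the function [F]
    attached to [q].  The bound only depends on the polynomials: the weights and
    the other functions are arbitrary. *)
Definition controlled q (P : seq {poly R}) := forall e : R, 0 < e ->
  exists m, forall H, (0 < H)%N -> exists L, forall N M c F Q, (L <= N)%N ->
    (forall n, unim (c n)) -> le1 F -> map fst Q = P -> {in Q, forall x, le1 x.2} ->
    e <= nrm2 (polyavg c q F Q M N) -> controls m H F.

Lemma controls_mono m m' H F : (m <= m')%N -> controls m H F -> controls m' H F.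
Proof.
move=> mm [s /andP[s2 sm] h]; exists s; first by rewrite s2 (leq_trans sm).
by apply: le_trans h; rewrite lef_pV2 ?posrE ?ltr0n// ler_nat.
Qed.

Lemma controlled_linear q P : integer_polynomial q -> {in P, forall p, integer_polynomial p} ->
  (1 < size q <= 2)%N -> {in P, forall p, (size p <= 2)%N && (1 < size (q - p)%R)%N} ->
  controlled q P.
Proof.
move=> iq iP /andP[q1 q2] hP e e0.
pose sl (p : {poly R}) := zeval p 1 - zeval p 0.
have slE p : integer_polynomial p -> (size p <= 2)%N -> sl p = 0 -> (size p <= 1)%N.
  move=> ip sp s0; suff -> : p = (p.[0])%:P by exact: size_polyC_leq1.
  apply/eqP; rewrite -subr_eq0; apply/eqP; apply: inf_roots_eq0 => n.
  have := zevalE n%:Z ip; rewrite zeval_linear// -/(sl p) s0 mul0r add0r zevalE// => h.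
  by rewrite hornerD hornerN hornerC pmulrn -h mulr0z subrr.
have sq0 : sl q != 0.
  by apply/eqP => /(slE _ iq q2); rewrite leqNgt q1.
have sqP : sl q \notin map sl P.
  apply/negP => /mapP[p pP spq]; have /andP[p2 qp] := hP _ pP.
  have ipq : integer_polynomial (q - p) by apply: intpB => //; exact: iP.
  have : (size (q - p)%R <= 1)%N.
    apply: slE => //; last by rewrite /sl !zevalB//; [move: spq; rewrite /sl; lia|exact: iP..].
    by apply: leq_trans (size_polyD _ _) _; rewrite size_polyN geq_max q2 p2.
  by rewrite leqNgt qp.
have [eta eta0 heta] := @linear_control R S _ _ sq0 sqP e e0.
have [m1 hm1] := ex_nat_ge eta^-1.
exists (maxn m1 (size P).+2) => H H0.
have [] := heta (nseq (size P).+2 H); rewrite ?size_nseq ?size_map//.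
  by apply/allP => x; rewrite mem_nseq => /andP[_ /eqP ->].
move=> L hL; exists L => N M c F Q LN c1 F1 QP Q1 h.
exists (size P).+2; first by rewrite leq_maxr.
apply: le_trans (_ : eta <= _).
  rewrite -[leRHS]invrK lef_pV2 ?posrE ?ltr0n ?invr_gt0//.
  by apply: le_trans hm1 _; rewrite ler_nat leqW// leq_maxl.
pose cst (x : {poly R} * S) := (sl x.1, U S (zeval x.1 0) x.2).
rewrite -(boxnormU _ (zeval q 0)).
apply: (hL N M c _ (map cst Q) LN c1 (le1U (zeval q 0) F1)) => [||].
- by rewrite -!map_comp -QP -map_comp.
- by move=> x /mapP[y yQ ->]; exact/le1U/Q1.
apply: le_trans h _; rewrite le_eqVlt; apply/orP; left; apply/eqP; congr nrm2.
apply: eq_amean => j; congr (_ * _ * _); first by rewrite (zeval_linear _ iq q2) UD.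
rewrite /linprod big_map; apply: eq_big_seq => x xQ.
have xP : x.1 \in P by rewrite -QP map_f.
rewrite (zeval_linear _ (iP _ xP)) ?UD//.
by case/andP: (hP _ xP).
Qed.

Lemma controlled_filter q P : controlled q [seq p : {poly R} <- P | (1 < size p)%N] -> controlled q P.
Proof.
move=> h e /h[m hm]; exists m => H /hm[L hL]; exists L => N M c F Q LN c1 F1 QP Q1 he.
pose isc (x : {poly R} * S) := (1 < size x.1)%N.
apply: (hL N M c F [seq x <- Q | isc x]) => //.
- by rewrite -QP filter_map.
- by move=> x; rewrite mem_filter => /andP[_]; exact: Q1.
apply: le_trans he _; pose g := \prod_(x <- Q | ~~ isc x) U S (zeval x.1 0) x.2.
have g1 : le1 g.
  by rewrite /g big_seq_cond; apply: le1_prod => x /andP[xQ _]; exact/le1U/Q1.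
suff -> : polyavg c q F Q M N = g * polyavg c q F [seq x <- Q | isc x] M N by exact: g1.
rewrite ameanMl; apply: eq_amean => j.
suff -> : polyprod Q (M + j%:Z) = polyprod [seq x <- Q | isc x] (M + j%:Z) * g by ring.
rewrite /polyprod (bigID isc) /= big_filter; congr (_ * _).
by apply: eq_bigr => x xc; rewrite zeval_cst// leqNgt.
Qed.

(** Moving the average against itself and translating by [q0] makes [q0] play
    the role of the constant sequence: no difference is taken, so [F] is kept. *)
Lemma controlled_swap q P q0 : integer_polynomial q -> {in P, forall p, integer_polynomial p} ->
  q0 \in P -> controlled (q - q0) (- q0 :: [seq p - q0 | p <- P]) -> controlled q P.
Proof.
move=> iq iP q0P h e e0; have iq0 := iP _ q0P.
have [m hm] := h (e ^+ 2) (exprn_gt0 2 e0); exists m => H /hm[L hL].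
exists L => N M c F Q LN c1 F1 QP Q1 he.
set w := polyavg _ _ _ _ _ _ in he.
have w1 : le1 w by apply: le1_amean => j; exact: le1_polyterm.
pose Q' := (- q0, star S w) :: [seq (x.1 - q0, x.2) | x <- Q].
have Q'1 : {in Q', forall x, le1 x.2}.
  move=> x; rewrite inE => /predU1P[->|/mapP[y yQ ->]]; last exact: (Q1 y yQ).
  exact: le1_star.
apply: (hL N M c F Q') => //; first by rewrite /= -!map_comp -QP -map_comp.
rewrite -nrmE ler_pXn2r ?nnegrE ?nrm_ge0 ?(ltW e0)//.
apply: le_trans he _; apply: le_trans (tau_le' _).
rewrite /nrm2 {1}/w ameanMr !tau_amean le_eqVlt; apply/orP; left; apply/eqP.
apply: eq_mean => j; rewrite /Q'; move: (M + j%:Z) (w) => n G.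
have -> : polyprod ((- q0, star S G) :: [seq (x.1 - q0, x.2) | x <- Q]) n =
    U S (- zeval q0 n) (star S G * polyprod Q n).
  rewrite /polyprod big_cons big_map rmorphM rmorph_prod /= zevalN//; congr (_ * _).
  apply: eq_big_seq => x xQ; rewrite -UD zevalB// 1?addrC//.
  by apply: iP; rewrite -QP map_f.
rewrite -[LHS](tauU (- zeval q0 n)) !rmorphM /= U_sc -UD zevalB// [- _ + zeval q n]addrC.
by congr (tau S _); ring.
Qed.

Definition vdc_special (k l : int) q0 q := shp k q - shp l q0.
Definition vdc_family (k l : int) q0 q P : seq {poly R} :=
  vdc_special l l q0 q :: map (vdc_special k l q0) P ++ map (vdc_special l l q0) P.

(** One step of polynomial exhaustion: van der Corput's inequality compares the
    averages at [n + k] and [n + l], and translating by [- q0 (n + l)] lowers the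
    complexity.  The family is doubled and [q] stays special through its copy
    shifted by [k], with the same function [F].  The pairs of shifts that would
    make two members coincide are bad; there are boundedly many of them for each
    [l], so for long windows they carry little weight. *)
Lemma controlled_vdc q P q0 (bad : nat -> nat -> bool) (B : nat) :
  integer_polynomial q -> {in P, forall p, integer_polynomial p} -> q0 \in q :: P ->
  (forall H l, (count (bad^~ l) (iota 0 H) <= B)%N) ->
  (forall k l : nat, ~~ bad k l -> controlled (vdc_special k l q0 q) (vdc_family k l q0 q P)) ->
  controlled q P.
Proof.
move=> iq iP q0P badB h e e0.
have iq0 : integer_polynomial q0.
  by move: q0P; rewrite inE => /predU1P[->//|]; exact: iP.
have e4 : 0 < (e / 4) ^+ 2 by rewrite exprn_gt0 ?divr_gt0.
(* a window this long gives the bad pairs weight less than e / 4 *)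
have [H1 hH1] := ex_nat_ge (4 * (B%:R + 1) / e).
have H10 : (0 < H1)%N.
  by rewrite -(@ltr0n R); apply: lt_le_trans hH1; rewrite divr_gt0 ?mulr_gt0// ltr_wpDl ?ler0n.
have /choice[mm hmm] : forall kl : nat * nat, exists m, ~~ bad kl.1 kl.2 ->
    forall H, (0 < H)%N -> exists L, forall N M c F Q, (L <= N)%N ->
    (forall n, unim (c n)) -> le1 F -> map fst Q = vdc_family kl.1 kl.2 q0 q P ->
    {in Q, forall x, le1 x.2} ->
    (e / 4) ^+ 2 <= nrm2 (polyavg c (vdc_special kl.1 kl.2 q0 q) F Q M N) -> controls m H F.
  move=> [k l] /=; have [b|nb] := boolP (bad k l); first by exists 0%N.
  by have [m hm] := h _ _ nb _ e4; exists m.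
pose m := \max_(k < H1) \max_(l < H1) mm (val k, val l).
exists m => H H0.
have /choice[LL hLL] : forall kl : nat * nat, exists L, ~~ bad kl.1 kl.2 ->
    forall N M c F Q, (L <= N)%N ->
    (forall n, unim (c n)) -> le1 F -> map fst Q = vdc_family kl.1 kl.2 q0 q P ->
    {in Q, forall x, le1 x.2} ->
    (e / 4) ^+ 2 <= nrm2 (polyavg c (vdc_special kl.1 kl.2 q0 q) F Q M N) -> controls (mm kl) H F.
  move=> kl; have [b|nb] := boolP (bad kl.1 kl.2); first by exists 0%N.
  by have [L hL] := hmm kl nb _ H0; exists L.
pose L1 := \max_(k < H1) \max_(l < H1) LL (val k, val l).
have [L hL] := ex_nat_ge (8 * H1%:R / e).
exists (maxn 1 (maxn L1 L)) => N M c F Q.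
rewrite !geq_max => /and3P[N0 L1N LN] c1 F1 QP Q1 he.
pose cc (k l : nat) n := c (n + k%:Z) * conjc (c (n + l%:Z)).
have cc1 k l n : unim (cc k l n) by apply: unimM; [exact: c1|exact/unimJ/c1].
pose QQ (k l : nat) : seq ({poly R} * S) := (vdc_special l l q0 q, star S F) ::
  [seq (vdc_special k l q0 x.1, x.2) | x <- Q] ++ [seq (vdc_special l l q0 x.1, star S x.2) | x <- Q].
have QQ1 k l : {in QQ k l, forall x, le1 x.2}.
  move=> x; rewrite inE mem_cat => /predU1P[->|]; first exact: le1_star.
  by move=> /orP[] /mapP[z zQ ->]; [exact: (Q1 z zQ)|exact/le1_star/(Q1 z zQ)].
have QQP k l : map fst (QQ k l) = vdc_family k l q0 q P.
  rewrite /QQ /vdc_family /= map_cat -!map_comp; congr (_ :: _ ++ _).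
    by rewrite -QP -map_comp.
  by rewrite -QP -map_comp.
pose y (k l : nat) := nrm (polyavg (cc k l) (vdc_special k l q0 q) F (QQ k l) M N).
have y1 k l : y k l <= 1.
  by apply/le1_nrm1/le1_amean => j; apply: le1_polyterm.
have : e / 2 <= \E_(k < H1) \E_(l < H1) y k l.
  apply: (@van_der_corput_lower _ _
    (fun n => sc S (c n) * U S (zeval q n) F * polyprod Q n) M N H1 e _ _ _ _ _ _ he) => //.
  - by move=> n; exact: le1_polyterm.
  - by apply: le_trans hL _; rewrite ler_nat.
  move=> k l; apply: le_trans (tau_le' _); rewrite tau_amean le_eqVlt; apply/orP; left; apply/eqP.
  apply: eq_mean => j; set n := M + j%:Z.
  rewrite /ip -[LHS](tauU (- zeval q0 (n + l%:Z))); congr (tau S _).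
  have ev p (k' : nat) : integer_polynomial p ->
      zeval (vdc_special k' l q0 p) n = - zeval q0 (n + l%:Z) + zeval p (n + k'%:Z).
    by move=> ip0; rewrite zevalB ?zeval_shp 1?addrC//; exact: intp_shp.
  rewrite /polyprod big_cons big_cat !big_map /= !rmorphM /= !star_sc !U_sc !ev//.
  have -> : \prod_(x <- Q) U S (zeval (vdc_special k l q0 x.1) n) x.2 =
      U S (- zeval q0 (n + l%:Z)) (\prod_(x <- Q) U S (zeval x.1 (n + k%:Z)) x.2).
    rewrite rmorph_prod; apply: eq_big_seq => x xQ; rewrite ev ?UD//.
    by apply: iP; rewrite -QP map_f.
  have -> : \prod_(x <- Q) U S (zeval (vdc_special l l q0 x.1) n) (star S x.2) =
      U S (- zeval q0 (n + l%:Z)) (star S (\prod_(x <- Q) U S (zeval x.1 (n + l%:Z)) x.2)).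
    rewrite !rmorph_prod; apply: eq_big_seq => x xQ; rewrite ev ?UD ?U_star//.
    by apply: iP; rewrite -QP map_f.
  by rewrite !UD !U_star; ring.
rewrite mean_exch => ye.
suff [k [l [kH lH nb hy]]] : exists k l, [/\ (k < H1)%N, (l < H1)%N, ~~ bad k l & e / 4 <= y k l].
  have mle : (mm (k, l) <= m)%N.
    apply: leq_trans (leq_bigmax (Ordinal kH)); exact: (leq_bigmax (F := fun l : 'I_H1 => mm (k, val l)) (Ordinal lH)).
  have Lle : (LL (k, l) <= L1)%N.
    apply: leq_trans (leq_bigmax (Ordinal kH)); exact: (leq_bigmax (F := fun l : 'I_H1 => LL (k, val l)) (Ordinal lH)).
  apply: controls_mono mle _; apply: (hLL (k, l) nb N M _ _ _ (leq_trans Lle L1N) (cc1 k l) F1 (QQP k l) (QQ1 k l)).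
  by rewrite -nrmE ler_pXn2r ?nnegrE ?nrm_ge0 ?divr_ge0// ltW.
apply: contrapT => nex.
have ylt k l : (k < H1)%N -> (l < H1)%N -> y k l <= e / 4 + (bad k l)%:R.
  move=> kH lH; have [b|nb] := boolP (bad k l).
    by apply: le_trans (y1 k l) _; rewrite lerDr divr_ge0// ltW.
  rewrite addr0 leNgt; apply/negP => lt; apply: nex; exists k, l; split=> //; exact: ltW.
suff : \E_(l < H1) \E_(k < H1) y k l <= e / 4 + B%:R / H1%:R.
  have : B%:R / H1%:R < e / 4.
    rewrite ltr_pdivrMr ?ltr0n//; move: hH1; rewrite ler_pdivrMr//; lra.
  by move: ye; lra.
apply: le_trans (_ : \E_(l < H1) (e / 4 + B%:R / H1%:R) <= _); last by rewrite mean_cst ?size_iota.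
apply: ler_mean_in => l; rewrite mem_iota => /andP[_ lH].
apply: le_trans (_ : \E_(k < H1) (e / 4 + (bad k l)%:R) <= _).
  by apply: ler_mean_in => k; rewrite mem_iota => /andP[_ kH]; exact: ylt.
rewrite meanD mean_cst ?size_iota// lerD2l /mean size_iota mulrC.
rewrite ler_wpM2r ?invr_ge0 ?ler0n//.
have -> : \sum_(k <- iota 0 H1) ((bad k l)%:R : R) = (count (bad^~ l) (iota 0 H1))%:R.
  by rewrite -sum1_count natr_sum [RHS]big_mkcond; apply: eq_bigr => k _; case: (bad k l).
by rewrite ler_nat.
Qed.

End PET.

Section PETInduction.
Variables (R : realType) (S : system R).
Implicit Types (p q : {poly R}) (P : seq {poly R}).

(** The number of distinct leading coefficients among the members of degree
    [e]; the polynomial exhaustion argument decreases these numbers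
    lexicographically, high degrees first. *)
Definition leads (P : seq {poly R}) (e : nat) : seq R :=
  undup [seq lead_coef p | p : {poly R} <- P & size p == e.+1].
Definition cls P e := size (leads P e).

Lemma mem_leads P e c : reflect (exists2 p, p \in P & size p = e.+1 /\ lead_coef p = c)
  (c \in leads P e).
Proof.
rewrite mem_undup; apply: (iffP mapP) => [[p]|[p pP [sp <-]]].
  by rewrite mem_filter => /andP[/eqP sp pP] ->; exists p.
by exists p; rewrite // mem_filter sp eqxx.
Qed.

Lemma cls_sub P P' e : {subset leads P' e <= leads P e} -> (cls P' e <= cls P e)%N.
Proof. by move=> h; apply: uniq_leq_size => //; exact: undup_uniq. Qed.

Lemma cls_shift P P' e c : c \in leads P e ->
  (forall b, b \in leads P' e -> exists2 a, a \in leads P e & a != c /\ b = a - c) ->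
  (cls P' e < cls P e)%N.
Proof.
move=> cP h; rewrite /cls.
have le : (cls P' e <= size [seq (a - c)%R | a <- rem c (leads P e)])%N.
  apply: uniq_leq_size => [|b /h[a aP [ac ->]]]; first exact: undup_uniq.
  by apply: map_f; rewrite mem_rem_uniq ?undup_uniq// !inE ac aP.
apply: leq_ltn_trans le _.
by rewrite size_map size_rem// prednK// lt0n size_eq0; case: (leads P e) cP.
Qed.

Lemma size_shpB2 (k l : int) p q0 : (size q0 <= size p)%N ->
  (size (shp k p - shp l q0)%R <= size p)%N.
Proof.
move=> h; apply: leq_trans (size_polyD _ _) _.
by rewrite size_polyN !size_shp geq_max leqnn.
Qed.

(** Translating by a member [q0] of minimal degree keeps the leading coefficients
    of the larger degrees; at the degree of [q0] it subtracts the leading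
    coefficient of [q0] from all, and one of them disappears. *)
Lemma vdc_lexlt D q P q0 k l : q0 \in q :: P -> (1 < size q0 <= D.+1)%N ->
  {in q :: P, forall p, (size q0 <= size p)%N} ->
  lexlt D (cls (vdc_special k l q0 q :: vdc_family k l q0 q P)) (cls (q :: P)).
Proof.
move=> q0P /andP[q01 q0D] hmin.
have mem p : p \in vdc_special k l q0 q :: vdc_family k l q0 q P ->
    exists2 p', p' \in q :: P & exists k' : int, p = shp k' p' - shp l q0.
  rewrite !inE mem_cat => /or4P[/eqP->|/eqP->|/mapP[p' pP ->]|/mapP[p' pP ->]].
  - by exists q; rewrite ?mem_head//; exists k.
  - by exists q; rewrite ?mem_head//; exists l.
  - by exists p'; rewrite ?inE ?pP ?orbT//; exists k.
  - by exists p'; rewrite ?inE ?pP ?orbT//; exists l.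
have q00 : q0 != 0 by rewrite -size_poly_gt0 ltnW.
exists (size q0).-1; split.
- by case: (size q0) q01 q0D => // -[].
- have sq0 : size q0 = (size q0).-1.+1 by rewrite prednK// ltnW.
  apply: (cls_shift (c := lead_coef q0)); first by apply/mem_leads; exists q0.
  move=> b /mem_leads[p /mem[p' p'P [k' ->]] [sp <-]].
  rewrite -sq0 in sp; have := hmin _ p'P; rewrite leq_eqVlt => /predU1P[e|lt]; last first.
    have [] := @size_subl R (shp k' p') (shp l q0); first by rewrite !size_shp.
    by rewrite sp size_shp => e; rewrite e ltnn in lt.
  have p'0 : p' != 0 by rewrite -size_poly_gt0 -e ltnW.
  have s : size (shp k' p') = size (shp l q0) by rewrite !size_shp e.
  exists (lead_coef p'); first by apply/mem_leads; exists p' => //; rewrite -e -sq0.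
  have sp' : size (shp k' p' - shp l q0) = size (shp k' p') by rewrite sp size_shp e.
  rewrite (lead_sub_same s sp') !lead_shp; split=> //.
  have sp0 : shp k' p' != 0 by rewrite -size_poly_gt0 size_shp -e ltnW.
  by apply/eqP; have := (size_sub_same s sp0).1 sp'; rewrite !lead_shp.
move=> e /andP[qe eD]; apply: cls_sub => c /mem_leads[p /mem[p' p'P [k' ->]] [sp <-]].
have qp' : (size q0 < size p')%N.
  have := @size_shpB2 k' l p' q0 (hmin _ p'P); rewrite sp => h.
  by apply: leq_trans h; rewrite -(prednK (ltnW q01)) ltnS.
have [] := @size_subl R (shp k' p') (shp l q0); first by rewrite !size_shp.
rewrite sp size_shp lead_shp => sp' ->.
by apply/mem_leads; exists p'.
Qed.

Lemma lexlt_mono D w w1 w' : (forall e, (0 < e)%N -> (w1 e <= w e)%N) -> lexlt D w' w1 -> lexlt D w' w.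
Proof.
move=> h [e [eD lt le]]; have /andP[e0 _] := eD; exists e; split=> //.
  by apply: leq_trans lt _; exact: h.
move=> e' /andP[ee' e'D]; apply: leq_trans (le e' _) _; rewrite ?ee'//.
by apply: h; exact: leq_trans ee'.
Qed.

Lemma cls_filter q P e : (0 < e)%N ->
  (cls (q :: [seq p : {poly R} <- P | (1 < size p)%N]) e <= cls (q :: P) e)%N.
Proof.
move=> e0; apply: cls_sub => c /mem_leads[p]; rewrite inE mem_filter => h [sp lp].
apply/mem_leads; exists p => //; move: h; rewrite inE => /predU1P[->|/andP[_ ->]].
  by rewrite eqxx.
by rewrite orbT.
Qed.

Definition vdc_bad (k l : int) q P := (k == l) || has (fun p => (size (shp k q - shp l p)%R <= 1)%N) P.

Lemma count_vdc_bad q P (l H : nat) : (2 < size q)%N ->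
  (count (fun k : nat => vdc_bad k l q P) (iota 0 H) <= (size P).+1)%N.
Proof.
move=> q2; have one (T : eqType) (a : pred T) (s : seq T) : uniq s ->
    (forall x y, a x -> a y -> x = y) -> (count a s <= 1)%N.
  move=> us h; rewrite -size_filter.
  have := seq.filter_uniq a us; case e : (seq.filter a s) => [|x [|y t]]//=.
  rewrite inE negb_or => /andP[/andP[/eqP xy _] _]; case: xy.
  by apply: h; have := seq.filter_all a s; rewrite e => /and3P[].
have le1 p : (count (fun k : nat => (size (shp k q - shp l p)%R <= 1)%N) (iota 0 H) <= 1)%N.
  apply: one => [|k k' hk hk']; first exact: iota_uniq.
  apply/eqP/negP => /negP kk'; have := @size_shpB R k k' q.
  rewrite eqz_nat => /(_ kk') hs.
  suff : (size q <= 2)%N by rewrite leqNgt q2.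
  apply: hs.
  have -> : shp k q - shp k' q = (shp k q - shp l p) - (shp k' q - shp l p).
    by rewrite opprB addrA subrK.
  by apply: leq_trans (size_polyD _ _) _; rewrite size_polyN geq_max hk hk'.
rewrite /vdc_bad; elim: P => [|p P ih].
  rewrite (eq_count (a2 := pred1 l)); last by move=> k /=; rewrite orbF eqz_nat.
  by apply: one; [exact: iota_uniq|move=> x y /eqP-> /eqP->].
rewrite (eq_count (a2 := predU (fun k : nat => (size (shp k q - shp l p)%R <= 1)%N)
   (fun k : nat => (k%:Z == l%:Z) || has (fun p => (size (shp k q - shp l p)%R <= 1)%N) P))); last first.
  by move=> k /=; rewrite orbCA.
apply: leq_trans (_ : _ <= 1 + (size P).+1)%N _ => //.
apply: leq_trans (leq_add (le1 p) ih).
by rewrite -count_predUI leq_addr.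
Qed.

(** Polynomial exhaustion.  When [q] has maximal degree, van der Corput's
    inequality and a translation by a member of minimal degree decrease the
    numbers of leading coefficients lexicographically; otherwise one first
    translates by a member of maximal degree, which makes [q] maximal.  That [q]
    differs from zero and from the other members by more than a constant survives
    both steps. *)
Theorem controlled_poly q P : {in q :: P, forall p, integer_polynomial p} -> (1 < size q)%N ->
  {in P, forall p, (1 < size (q - p)%R)%N} -> controlled S q P.
Proof.
have [D] := ubnP (\max_(p <- q :: P) size p).
elim: D q P => // D ihD q P; rewrite ltnS => hD iqP q1 hess.
have iq : integer_polynomial q by apply: iqP; rewrite mem_head.
have iP : {in P, forall p, integer_polynomial p} by move=> p pP; apply: iqP; rewrite inE pP orbT.
have szD : {in q :: P, forall p, (size p <= D)%N}.
  by move=> p pP; apply: leq_trans hD; exact: (leq_bigmax_seq (F := fun p : {poly R} => size p)).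
have ihD' q' P' : {in q' :: P', forall p, integer_polynomial p} -> (1 < size q')%N ->
    {in P', forall p, (1 < size (q' - p)%R)%N} -> {in q' :: P', forall p, (size p < D)%N} ->
    controlled S q' P'.
  move=> a b c h; apply: ihD => //.
  have D0 : (0 < D)%N by apply: leq_ltn_trans (h q' (mem_head _ _)).
  rewrite -(prednK D0) ltnS; apply/bigmax_leqP_seq => p pP _.
  by rewrite -ltnS (prednK D0); exact: h.
have [D2|D2] := leqP D 2.
  apply: controlled_linear => //; first by rewrite q1 (leq_trans (szD _ (mem_head _ _))).
  by move=> p pP; rewrite hess// andbT (leq_trans (szD p _)) ?inE ?pP ?orbT.
have main q' P' : {in q' :: P', forall p, integer_polynomial p} -> size q' = D ->
    {in P', forall p, (1 < size (q' - p)%R)%N} -> {in q' :: P', forall p, (size p <= D)%N} ->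
    controlled S q' P'.
  move=> {q P hD iqP q1 hess iq iP szD}.
  pose T := ({poly R} * seq {poly R})%type.
  suff H : forall x : T, {in x.1 :: x.2, forall p, integer_polynomial p} -> size x.1 = D ->
      {in x.2, forall p, (1 < size (x.1 - p)%R)%N} -> {in x.1 :: x.2, forall p, (size p <= D)%N} ->
      controlled S x.1 x.2 by exact: (H (q', P')).
  (* now q has the maximal degree: induction on the numbers of leading coefficients *)
  apply: (@lex_ind T (fun x => cls (x.1 :: x.2)) D.-1); move=> [q P] /= ih iqP sq hess szD.
  apply: controlled_filter; set P1 := seq.filter _ _.
  have P1P : {subset P1 <= P} by move=> p; rewrite mem_filter => /andP[].
  have P1c p : p \in P1 -> (1 < size p)%N by rewrite mem_filter => /andP[].
  have qP1 : {subset q :: P1 <= q :: P}.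
    by move=> p; rewrite !inE => /predU1P[->|/P1P ->]; rewrite ?eqxx ?orbT.
  have iq : integer_polynomial q by apply: iqP; rewrite mem_head.
  have iP1 : {in P1, forall p, integer_polynomial p}.
    by move=> p pP; apply: iqP; rewrite inE (P1P _ pP) orbT.
  have step q0 : q0 \in q :: P1 -> (forall k l : nat, ~~ vdc_bad k l q P1 ->
      controlled S (vdc_special k l q0 q) (vdc_family k l q0 q P1)) -> controlled S q P1.
    move=> q0P h; apply: (controlled_vdc (bad := fun k l : nat => vdc_bad k l q P1) (B := (size P1).+1) iq iP1 q0P _ h).
    by move=> H l; apply: count_vdc_bad; rewrite sq.
  have iv k' l q0 p : q0 \in q :: P1 -> p \in q :: P1 -> integer_polynomial (vdc_special k' l q0 p).
    by move=> /qP1/iqP ? /qP1/iqP ?; apply: intpB; exact: intp_shp.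
  have iv2 k l q0 : q0 \in q :: P1 ->
      {in vdc_special k l q0 q :: vdc_family k l q0 q P1, forall p, integer_polynomial p}.
    move=> q0P p; rewrite !inE mem_cat => /or4P[/eqP->|/eqP->|/mapP[p' pP ->]|/mapP[p' pP ->]].
    + by apply: iv => //; exact: mem_head.
    + by apply: iv => //; exact: mem_head.
    + by apply: iv => //; rewrite inE pP orbT.
    + by apply: iv => //; rewrite inE pP orbT.
  have ess k l q0 : ~~ vdc_bad k l q P1 ->
      {in vdc_family k l q0 q P1, forall p, (1 < size (vdc_special k l q0 q - p)%R)%N}.
    rewrite /vdc_bad negb_or => /andP[kl /hasPn hb] p.
    have dif a b c : vdc_special k l q0 q - (shp a b - shp l q0) = shp k q - shp a b + c - c.
      by rewrite addrK /vdc_special opprB addrA subrK.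
    rewrite !inE mem_cat => /or3P[/eqP->|/mapP[p' pP ->]|/mapP[p' pP ->]]; rewrite (dif _ _ 0) addrK.
    + by rewrite ltnNge; apply/negP => /(size_shpB kl); rewrite sq leqNgt D2.
    + by rewrite -shpB size_shp; apply/hess/P1P.
    + by rewrite ltnNge; exact: hb.
  have [/hasP[q1 q1P1 hq1]|/hasPn hno] := boolP (has (fun p => (size p < size q)%N || (lead_coef p != lead_coef q)) P1).
    (* some member is not of the shape of q: subtract such a member of least degree *)
    pose cand (p : {poly R}) := (p \in P1) && ((size p < size q)%N || (lead_coef p != lead_coef q)).
    have [q0 /andP[q0P1 hq0] q0min] : exists2 q0, cand q0 & forall p, cand p -> (size q0 <= size p)%N.
      have ex : exists n, has (fun p => cand p && (size p == n)) P1.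
        by exists (size q1); apply/hasP; exists q1; rewrite // /cand q1P1 hq1 eqxx.
      case: (ex_minnP ex) => n /hasP[q0 _ /andP[c0 /eqP <-]] hn; exists q0 => // p cp.
      by apply: hn; apply/hasP; exists p; [case/andP: cp|rewrite cp eqxx].
    have q0m : q0 \in q :: P1 by rewrite inE q0P1 orbT.
    have q0D : (size q0 <= D)%N by apply: szD; exact: qP1.
    have q0min' : {in q :: P1, forall p, (size q0 <= size p)%N}.
      move=> p pP; have [lt|ge] := ltnP (size p) (size q); last by apply: leq_trans ge; rewrite sq.
      apply: q0min; rewrite /cand lt orTb andbT; move: pP; rewrite inE => /predU1P[e|//].
      by rewrite e ltnn in lt.
    apply: (step _ q0m) => k l nb.
    apply: (ih (vdc_special k l q0 q, vdc_family k l q0 q P1)) => /=.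
    + apply: (lexlt_mono (w1 := cls (q :: P1))) => [e e0|]; first exact: cls_filter.
      apply: vdc_lexlt => //; rewrite P1c//= prednK//; exact: leq_trans D2.
    + exact: iv2.
    + move: hq0; have [lt _|ge /= hl] := ltnP (size q0) (size q).
        have [] := @size_subl R (shp k q) (shp l q0); first by rewrite !size_shp.
        by rewrite /vdc_special => -> _; rewrite size_shp.
      have e : size q = size q0 by apply/eqP; rewrite eqn_leq ge sq q0D.
      have s : size (shp k q) = size (shp l q0) by rewrite !size_shp.
      have sp0 : shp k q != 0 by rewrite -size_poly_gt0 size_shp sq (leq_trans _ D2).
      rewrite /vdc_special -[RHS]sq -[RHS](size_shp k); apply: (size_sub_same s sp0).2.
      by rewrite !lead_shp => /esym/eqP; exact/negP.
    + exact: ess.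
    move=> p; have b p' k' : p' \in q :: P1 -> (size (vdc_special k' l q0 p') <= D)%N.
      by move=> h; apply: leq_trans (size_shpB2 _ _ (q0min' _ h)) _; apply/szD/qP1.
    rewrite !inE mem_cat => /or4P[/eqP->|/eqP->|/mapP[p' pP ->]|/mapP[p' pP ->]]; apply: b;
      by rewrite ?mem_head// inE pP orbT.
  (* all members have the degree and the leading coefficient of q: subtracting q lowers the degree *)
  apply: (step q); rewrite ?mem_head// => k l nb.
  have allq p k' : p \in q :: P1 -> (size (vdc_special k' l q p) < D)%N.
    move=> pP; have [sp lp] : size p = D /\ lead_coef p = lead_coef q.
      move: pP; rewrite inE => /predU1P[->//|pP]; have := hno _ pP.
      rewrite negb_or -leqNgt negbK => /andP[qp /eqP ->]; split=> //.
      by apply/eqP; rewrite eqn_leq -{2}sq qp szD// inE P1P ?orbT.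
    have s : size (shp k' p) = size (shp l q) by rewrite !size_shp sp sq.
    have sp0 : shp k' p != 0 by rewrite -size_poly_gt0 size_shp sp (leq_trans _ D2).
    rewrite ltn_neqAle; apply/andP; split.
      apply/eqP => h; have : size (shp k' p - shp l q) = size (shp k' p) by rewrite size_shp sp.
      by move/(size_sub_same s sp0); rewrite !lead_shp.
    by rewrite -[leqRHS]sp; apply: size_shpB2; rewrite sp sq.
  apply: ihD'.
  - by apply: iv2; exact: mem_head.
  - move: nb; rewrite /vdc_bad negb_or => /andP[kl _].
    by rewrite ltnNge; apply/negP => /(size_shpB kl); rewrite sq leqNgt D2.
  - exact: ess.
  move=> p; rewrite !inE mem_cat => /or4P[/eqP->|/eqP->|/mapP[p' pP ->]|/mapP[p' pP ->]]; apply: allq;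
    by rewrite ?mem_head// inE pP orbT.
have [sq|sq] := eqVneq (size q) D; first exact: main.
have ltq : (size q < D)%N by rewrite ltn_neqAle sq szD ?mem_head.
have [/hasP[q0 q0P /eqP sq0]|/hasPn hno] := boolP (has (fun p => size p == D) P); last first.
  apply: ihD' => // p; rewrite inE => /predU1P[->//|pP].
  by rewrite ltn_neqAle hno// szD// inE pP orbT.
(* q is not of maximal degree: subtract a member that is *)
apply: (controlled_swap iq iP q0P).
have iq0 := iP _ q0P.
apply: main.
- move=> p; rewrite !inE => /or3P[/eqP->|/eqP->|/mapP[p' pP ->]].
  + exact: intpB.
  + exact: intpN.
  + by apply: intpB => //; exact: iP.
- by rewrite size_subr sq0.
- move=> p; rewrite inE => /predU1P[->|/mapP[p' pP ->]]; first by rewrite opprK subrK.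
  by rewrite opprB addrA subrK; exact: hess.
move=> p; have b p' : p' \in q :: P -> (size (p' - q0)%R <= D)%N.
  by move=> /szD h; apply: leq_trans (size_polyD _ _) _; rewrite size_polyN sq0 geq_max h leqnn.
rewrite !inE => /or3P[/eqP->|/eqP->|/mapP[p' pP ->]].
- by apply: b; rewrite mem_head.
- by rewrite size_polyN sq0.
- by apply: b; rewrite inE pP orbT.
Qed.

End PETInduction.

(** * Limits along an ultrafilter *)

Section UltraLimit.
Variables (R : realType) (V : set_system nat) (hV : UltraFilter V) (Vinf : eventually `<=` V).

Definition ucvg (a : nat -> R) l := forall e : R, 0 < e -> V [set k | `|a k - l| < e].

Lemma V_ge K : V [set k | (K <= k)%N].
Proof. by apply: Vinf; exists K. Qed.

Lemma V_ex A K : V A -> exists2 k, A k & (K <= k)%N.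
Proof. by move=> VA; have [k [Ak Kk]] := filter_ex (filterI VA (V_ge K)); exists k. Qed.

Lemma ucvg_bounded a c : (forall k, `|a k| <= c) -> exists l, ucvg a l.
Proof.
move=> ac; pose E := [set x | V [set k | x <= a k]].
have supE : has_sup E.
  split; first by exists (- c); apply: filterS filterT => k _ /=; have := ac k; rewrite ler_norml => /andP[].
  exists c => x /filter_ex[k /= xa]; apply: le_trans xa _; exact: le_trans (ler_norm _) (ac k).
exists (sup E) => e e0.
have [x Ex xs] := sup_adherent e0 supE.
have nE : ~ E (sup E + e / 2).
  move=> h; have := sup_upper_bound supE h; rewrite gerDl => h'; have : 0 < e / 2 by rewrite divr_gt0.
  by rewrite ltNge h'.
have [//|h] := in_ultra_setVsetC [set k | sup E + e / 2 <= a k] hV.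
apply: filterS2 Ex h => k /= xa /negP; rewrite -ltNge => h.
by rewrite ltr_norml; apply/andP; split; lra.
Qed.

Lemma ucvg_cst c : ucvg (fun=> c) c.
Proof. by move=> e e0; apply: filterS filterT => k _ /=; rewrite subrr normr0. Qed.

Lemma ucvgD a b l m : ucvg a l -> ucvg b m -> ucvg (fun k => a k + b k) (l + m).
Proof.
move=> ha hb e e0; have e2 : 0 < e / 2 by rewrite divr_gt0.
apply: filterS2 (ha _ e2) (hb _ e2) => k /=; rewrite !ltr_norml => /andP[? ?] /andP[? ?].
by apply/andP; split; lra.
Qed.

Lemma ucvgZ a c l : ucvg a l -> ucvg (fun k => c * a k) (c * l).
Proof.
move=> ha e e0; have [->|c0] := eqVneq c 0.
  by apply: filterS filterT => k _ /=; rewrite !mul0r subrr normr0.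
have ec : 0 < e / `|c| by rewrite divr_gt0 ?normr_gt0.
apply: filterS (ha _ ec) => k /=.
by rewrite -mulrBr normrM ltr_pdivlMr ?normr_gt0// mulrC.
Qed.

Lemma ucvg_le a b l m : ucvg a l -> ucvg b m -> (forall k, a k <= b k) -> l <= m.
Proof.
move=> ha hb ab; rewrite leNgt; apply/negP => lt.
have e2 : 0 < (l - m) / 2 by rewrite divr_gt0// subr_gt0.
have [k [/= ]] := filter_ex (filterI (ha _ e2) (hb _ e2)).
by rewrite !ltr_norml => /andP[? ?] /andP[? ?]; have := ab k; lra.
Qed.

Lemma ucvg_unique a l m : ucvg a l -> ucvg a m -> l = m.
Proof. by move=> h h'; apply/eqP; rewrite eq_le (ucvg_le h h')//= (ucvg_le h' h). Qed.

End UltraLimit.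

Lemma ex_null_seq (R : realType) : exists2 r : nat -> R, forall n, 0 < r n &
  forall e : R, 0 < e -> exists n0, forall n, (n0 <= n)%N -> r n < e.
Proof.
exists (fun n => n.+1%:R^-1) => [n|e e0]; first by rewrite invr_gt0.
have [n0 hn0] := ex_nat_ge e^-1; exists n0 => n nn.
rewrite invf_plt ?posrE ?ltr0n//; apply: le_lt_trans hn0 _.
by rewrite ltr_nat ltnS.
Qed.

Section WeakLimit.
Variables (R : realType) (S : system R).
Variables (V : set_system nat) (hV : UltraFilter V).
Implicit Types (f g F G : S).

Lemma nrm2_half f g : nrm2 (rs S 2^-1 * (f + g)) = (nrm2 f + nrm2 g) / 2 - nrm2 (f - g) / 4.
Proof. by rewrite nrm2Z nrm2D nrm2B; field. Qed.

Lemma quad_eq0 (A B : R) : 0 <= A -> (forall t : R, 0 <= t ^+ 2 * A + t * B) -> B = 0.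
Proof.
move=> A0 h; apply/eqP; apply: contraT => B0.
have := h (- B / (A + 1)).
have A1 : 0 < A + 1 by apply: ltr_wpDl.
have -> : (- B / (A + 1)) ^+ 2 * A + - B / (A + 1) * B = - (B ^+ 2 / (A + 1) ^+ 2).
  by field; apply: lt0r_neq0.
have B2 : 0 < B ^+ 2 by rewrite exprn_even_gt0.
by rewrite oppr_ge0 leNgt divr_gt0// exprn_gt0.
Qed.

(** The weak limit minimises [nrm2 g - 2 lim ip g (F k)]; cutting off at
    absolute value 1 does not increase this, so a minimising sequence may be
    taken bounded by 1, and the minimum is then attained because bounded
    sequences that are Cauchy in mean square converge. *)
Lemma weak_limit (F : nat -> S) : (forall k, le1 (F k)) ->
  exists2 G, le1 G & forall g, ucvg V (fun k => ip g (F k)) (ip g G).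
Proof.
move=> F1.
have /choice[l hl] : forall g, exists l, ucvg V (fun k => ip g (F k)) l.
  move=> g; apply: (@ucvg_bounded _ _ hV _ (nrm g)) => k; apply: le_trans (CS _ _) _.
  by rewrite ler_piMr ?nrm_ge0 ?le1_nrm1.
have lD f g : l (f + g) = l f + l g.
  apply: (ucvg_unique hV (hl _)); rewrite (_ : (fun k => _) = fun k => ip f (F k) + ip g (F k)).
    exact: ucvgD.
  by apply: funext => k; rewrite ipDl.
have lZ r f : l (rs S r * f) = r * l f.
  apply: (ucvg_unique hV (hl _)); rewrite (_ : (fun k => _) = fun k => r * ip f (F k)).
    exact: ucvgZ.
  by apply: funext => k; rewrite ipZl.
have lle f : `|l f| <= nrm f.
  rewrite ler_norml; apply/andP; split.
    apply: (ucvg_le hV (ucvg_cst hV _) (hl f)) => k; rewrite lerNl.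
    by apply: le_trans (le_trans (ler_norm _) _); rewrite ?normrN// (le_trans (CS _ _))//
       ?ler_piMr ?nrm_ge0 ?le1_nrm1// normrN.
  apply: (ucvg_le hV (hl f) (ucvg_cst hV _)) => k.
  by apply: le_trans (CS_le _ _) _; rewrite ler_piMr ?nrm_ge0 ?le1_nrm1.
(* J g is the squared distance from g to the limit, up to a constant *)
pose J g := nrm2 g - 2 * l g.
have JB g : -1 <= J g.
  have := lle g; rewrite ler_norml => /andP[_ h]; rewrite /J -nrmE.
  by have := sqr_ge0 (nrm g - 1); rewrite sqrrB1 mulr2n; lra.
have Jtr f : exists2 g, le1 g & J g <= J f.
  have [g g1 hg] := truncation f; exists g => //.
  have lN x : - l x = l (- x) by rewrite -mulN1r -lZ rsN rs1 mulN1r.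
  suff : 2 * (l f - l g) <= nrm2 f - nrm2 g by rewrite /J; lra.
  have h := ucvgZ hV 2 (hl (f - g)); rewrite lD -lN in h.
  apply: (ucvg_le hV h (ucvg_cst hV _)) => k.
  by have := hg (F k) (F1 k); rewrite -!/(nrm2 _) !nrm2B ipDl ipNl; lra.
pose E := [set J g | g in [set: S]].
have infE : has_inf E.
  by split; [exists (J 0), 0|exists (-1) => _ [g _ <-]].
have mJ g : inf E <= J g by apply: ge_inf; [case: infE|exists g].
have [r r0 inv_small] := ex_null_seq R.
have /choice[g hg] : forall n : nat, exists g, le1 g /\ J g < inf E + r n.
  move=> n; have [_ [f _ <-] h] := inf_adherent (r0 n) infE; have [g g1 gf] := Jtr f.
  by exists g; split=> //; exact: le_lt_trans gf h.
have mid f f' : nrm2 (f - f') = 2 * (J f + J f') - 4 * J (rs S 2^-1 * (f + f')).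
  by rewrite /J nrm2_half lZ lD; field.
have [||G G1 hG] := @complete_alg R S g; first by move=> n; exact: (hg n).1.
  move=> e e0; have e4 : 0 < e / 4 by rewrite divr_gt0.
  have [n0 hn0] := inv_small _ e4; exists n0 => i j ii jj.
  rewrite -/(nrm2 _) mid; have := mJ (rs S 2^-1 * (g i + g j)).
  by have := (hg i).2; have := (hg j).2; have := hn0 _ ii; have := hn0 _ jj; lra.
exists G => // h.
have JG : J G <= inf E.
  rewrite -subr_le0 leNgt; apply/negP => lt.
  pose d := J G - inf E; have d8 : 0 < d / 8 by rewrite divr_gt0.
  have [n0 hn0] := hG _ (exprn_gt0 2 d8); have [n1 hn1] := inv_small _ d8.
  pose n := maxn n0 n1.
  have nn : nrm (G - g n) < d / 8.
    rewrite nrmBC -(@ltr_pXn2r _ 2) ?nnegrE ?nrm_ge0 ?(ltW d8)// nrmE; apply: hn0; exact: leq_maxl.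
  have := hn1 n (leq_maxr _ _); have := (hg n).2.
  have : nrm2 G - nrm2 (g n) <= 2 * nrm (G - g n).
    rewrite -!nrmE; have := nrm_le G (g n); have := le1_nrm1 G1; have := le1_nrm1 (hg n).1.
    by have := nrm_ge0 G; have := nrm_ge0 (g n); have := nrm_ge0 (G - g n); nra.
  have := lle (G - g n); rewrite ler_norml => /andP[lo _].
  have : l (G - g n) = l G - l (g n) by rewrite lD -[- g n]mulN1r -rs1 -rsN lZ mulN1r.
  move=> e; rewrite e in lo.
  have e1 : J G = nrm2 G - 2 * l G by [].
  have e2 : J (g n) = nrm2 (g n) - 2 * l (g n) by [].
  by have e3 : d = J G - inf E by []; lra.
suff <- : l h = ip h G by exact: hl.
apply/eqP; rewrite eq_sym -subr_eq0; apply/eqP.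
suff : 2 * (ip h G - l h) = 0 by lra.
apply: (quad_eq0 (nrm2_ge0 h)) => t.
have := le_trans JG (mJ (G + rs S t * h)); rewrite /J nrm2D nrm2Z ipZr lD lZ (ip_sym G).
by lra.
Qed.

End WeakLimit.

(** * The mean ergodic theorem *)

Section MeanErgodic.
Variables (R : realType) (S : system R).
Implicit Types (f g F G P : S) (z : R[i]).

Definition tw z (n : int) G : S := sc S (z ^ (- n)) * U S n G.

Lemma twD z m n G : unim z -> tw z (m + n) G = tw z m (tw z n G).
Proof.
move=> z1; rewrite /tw rmorphM /= U_sc UD opprD expfzDr ?unim_neq0// rmorphM.
by ring.
Qed.

Lemma tw0 z G : tw z 0 G = G.
Proof. by rewrite /tw oppr0 expr0z rmorph1 mul1r U0. Qed.

Lemma nrm_tw z n G : unim z -> nrm (tw z n G) = nrm G.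
Proof. by move=> z1; rewrite /tw nrm_unim ?nrm_U//; exact: unim_expz. Qed.

Lemma twB z n f g : tw z n (f - g) = tw z n f - tw z n g.
Proof. by rewrite /tw rmorphB mulrBr. Qed.

Lemma le1_tw z n G : unim z -> le1 G -> le1 (tw z n G).
Proof. by move=> z1 G1; apply: le1M; [exact/le1_unim/unim_expz|exact: le1U]. Qed.

Lemma ip_tw z n f g : unim z -> ip (tw z n f) (tw z n g) = ip f g.
Proof.
move=> z1; rewrite /ip /tw rmorphM /=.
have := unim_star S (unim_expz (- n) z1) => h.
rewrite -[RHS](tauU n) rmorphM /= U_star.
rewrite (_ : _ * _ * _ = (sc S (z ^ (- n)) * star S (sc S (z ^ (- n)))) * (U S n f * star S (U S n g))).
  by rewrite h mul1r.
by ring.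
Qed.

Definition erg z (H : nat) G : S := amean (iota 0 H) (fun h => tw z h%:Z G).

Lemma nrm_erg z H G : unim z -> nrm (erg z H G) <= nrm G.
Proof.
move=> z1; apply: le_trans (nrm_amean _ _) _; apply: mean_le => [|x]; first exact: nrm_ge0.
by rewrite nrm_tw.
Qed.

Lemma le1_erg z H G : unim z -> le1 G -> le1 (erg z H G).
Proof. by move=> z1 G1; apply: le1_amean => h; exact: le1_tw. Qed.

Lemma erg_mean (I : Type) (s : seq I) (v : I -> S) z L :
  erg z L (amean s v) = amean s (fun x => erg z L (v x)).
Proof.
rewrite /erg -amean_exch; apply: eq_amean => l.
by rewrite /tw U_amean ameanMl.
Qed.

Lemma ergD z L f g : erg z L (f + g) = erg z L f + erg z L g.
Proof.
rewrite /erg /amean -mulrDr -big_split; congr (_ * _); apply: eq_bigr => l _.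
by rewrite /tw rmorphD mulrDr.
Qed.

Lemma erg_rs z L r f : erg z L (rs S r * f) = rs S r * erg z L f.
Proof.
rewrite /erg ameanMl; apply: eq_amean => l.
by rewrite /tw rmorphM /= U_rs; ring.
Qed.

Lemma ergM z K H G : unim z -> (0 < K)%N -> nrm (erg z (K * H)%N G) <= nrm (erg z H G).
Proof.
move=> z1 K0; rewrite /erg amean_iotaM; apply: le_trans (nrm_amean _ _) _.
apply: mean_le => [|k]; first exact: nrm_ge0.
rewrite -(nrm_tw (k * H)%:Z _ z1) le_eqVlt; apply/orP; left; apply/eqP; rewrite nrm_tw//.
rewrite -[RHS](nrm_tw (k * H)%:Z _ z1); congr nrm; rewrite /tw U_amean ameanMl.
by apply: eq_amean => h; rewrite -/(tw _ _ _) -/(tw _ _ _) -/(tw _ _ _) -twD// PoszD.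
Qed.

Lemma erg_shift z k L G : unim z -> nrm G <= 1 -> (0 < L)%N ->
  nrm (erg z L (tw z k%:Z G) - erg z L G) <= 2 * k%:R / L%:R.
Proof.
move=> z1 G1 L0.
have := @nrm_amean_shift R S (fun n => tw z n G) 0 L k _ L0.
rewrite /erg; under eq_amean do rewrite add0r addrC twD//.
have -> : amean (iota 0 L) (fun j => tw z (0 + j%:Z) G) = amean (iota 0 L) (fun h => tw z h%:Z G).
  by apply: eq_amean => j; rewrite add0r.
by apply=> n; rewrite nrm_tw.
Qed.

Lemma erg_erg z L H G : unim z -> nrm G <= 1 -> (0 < L)%N -> (0 < H)%N ->
  nrm (erg z L (erg z H G) - erg z L G) <= 2 * H%:R / L%:R.
Proof.
move=> z1 G1 L0 H0; rewrite {2}/erg erg_mean.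
apply: nrm_amean_in; rewrite ?size_iota ?mulr_ge0 ?invr_ge0 ?ler0n// => k.
rewrite mem_iota => /andP[_ kH]; apply: le_trans (erg_shift k z1 G1 L0) _.
rewrite ler_wpM2r ?invr_ge0 ?ler0n// ler_wpM2l// ler_nat; exact: ltnW.
Qed.

Lemma ex_div_small (c e : R) : 0 < e -> exists n0, forall n, (n0 <= n)%N -> (0 < n)%N /\ c / n%:R <= e.
Proof.
move=> e0; have [n0 hn0] := ex_nat_ge (c / e); exists (maxn 1 n0) => n.
rewrite geq_max => /andP[n1 nn]; split=> //.
by rewrite ler_pdivrMr ?ltr0n// mulrC -ler_pdivrMr// (le_trans hn0)// ler_nat.
Qed.

(** The averages have nearly minimal norm among themselves and, because
    averaging again hardly changes them, so have their midpoints; by the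
    parallelogram identity they converge. *)
Lemma mean_ergodic z G : unim z -> le1 G -> exists P,
  [/\ le1 P, eqv (U S 1 P) (sc S z * P), ip G P = nrm2 P &
      forall e : R, 0 < e -> exists n0, forall H, (n0 <= H)%N -> nrm (erg z H G - P) < e].
Proof.
move=> z1 G1; have G1' := le1_nrm1 G1.
pose E := [set nrm (erg z H.+1 G) | H in [set: nat]].
have infE : has_inf E by split; [exists (nrm (erg z 1 G)), 0%N|exists 0 => _ [H _ <-]; exact: nrm_ge0].
pose a := inf E.
have a0 : 0 <= a by apply: lb_le_inf; [case: infE|move=> _ [H _ <-]; exact: nrm_ge0].
have aE H : (0 < H)%N -> a <= nrm (erg z H G).
  by case: H => // H _; apply: ge_inf; [case: infE|exists H].
have a1 : a <= 1 by apply: le_trans (aE 1%N isT) _; apply: le_trans (nrm_erg _ _ z1) _.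
have up e : 0 < e -> exists n0, forall H, (n0 <= H)%N -> (0 < H)%N /\ nrm (erg z H G) <= a + e.
  move=> e0; have e2 : 0 < e / 2 by rewrite divr_gt0.
  have [_ [H0 _ <-] hH] := inf_adherent e2 infE.
  have [n0 hn0] := ex_div_small (2 * H0.+1%:R) e2; exists n0 => H /hn0[Hp hs]; split=> //.
  have := erg_erg z1 G1' Hp (ltn0Sn H0); have := nrm_le (erg z H G) (erg z H (erg z H0.+1 G)).
  rewrite nrmBC; have := nrm_erg H (erg z H0.+1 G) z1; rewrite -/a in hH; lra.
(* an average of a midpoint is close to an average of G, so its norm is not less than a *)
have mid H K : (0 < H)%N -> (0 < K)%N -> a <= nrm (rs S 2^-1 * (erg z H G + erg z K G)).
  move=> H0 K0; set m := rs S _ * _; apply/ler_addgt0Pl => e e0.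
  have [L hL] := ex_div_small (2 * H%:R + 2 * K%:R) e0.
  have [L0] := hL _ (leqnn L); rewrite mulrDl => hs.
  have h1 := erg_erg z1 G1' L0 H0; have h2 := erg_erg z1 G1' L0 K0.
  have d : nrm (erg z L m - erg z L G) <= e.
    have -> : erg z L m - erg z L G = rs S 2^-1 * ((erg z L (erg z H G) - erg z L G) + (erg z L (erg z K G) - erg z L G)).
      rewrite /m erg_rs ergD.
      have two : rs S 2^-1 * (1 + 1) = 1 by rewrite -rs1 -rsD -rsM; congr (rs S _); field.
      by rewrite -[X in _ - X]mul1r -two; ring.
    rewrite nrm_Z ger0_norm ?invr_ge0//; have := nrmD (erg z L (erg z H G) - erg z L G) (erg z L (erg z K G) - erg z L G); lra.
  have := aE L L0; have := nrm_le (erg z L G) (erg z L m); rewrite nrmBC.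
  by have := nrm_erg L m z1; lra.
have par f g : nrm2 (f - g) = 2 * (nrm2 f + nrm2 g) - 4 * nrm2 (rs S 2^-1 * (f + g)).
  by rewrite nrm2_half; field.
have cau (e : R) : 0 < e -> exists n0, forall i j, (n0 <= i)%N -> (n0 <= j)%N ->
    nrm2 (erg z i G - erg z j G) < e.
  move=> e0; pose d := Num.min 1 (e / 16).
  have d0 : 0 < d by rewrite lt_min ltr01 divr_gt0.
  have d1 : d <= 1 by rewrite ge_min lexx.
  have de : d <= e / 16 by rewrite ge_min lexx orbT.
  have [n0 hn0] := up _ d0; exists n0 => i j /hn0[i0 hi] /hn0[j0 hj].
  rewrite par; have := mid _ _ i0 j0; rewrite -!nrmE.
  have := nrm_ge0 (erg z i G); have := nrm_ge0 (erg z j G).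
  set x := nrm (erg z i G) in hi *; set y := nrm (erg z j G) in hj *; set w := nrm _.
  move=> y0 x0 hw.
  have : x ^+ 2 <= (a + d) ^+ 2 by rewrite ler_pXn2r ?nnegrE ?addr_ge0 ?(ltW d0).
  have : y ^+ 2 <= (a + d) ^+ 2 by rewrite ler_pXn2r ?nnegrE ?addr_ge0 ?(ltW d0).
  have : a ^+ 2 <= w ^+ 2 by rewrite ler_pXn2r ?nnegrE// (le_trans a0).
  have : (a + d) ^+ 2 <= a ^+ 2 + 3 * d by nra.
  lra.
have [||P P1 hP] := @complete_alg R S (fun H => erg z H G) => //.
  by move=> H; exact: le1_erg.
have cv (e : R) : 0 < e -> exists n0, forall H, (n0 <= H)%N -> nrm (erg z H G - P) < e.
  move=> e0; have [n0 hn0] := hP _ (exprn_gt0 2 e0); exists n0 => H /hn0 h.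
  by rewrite -(@ltr_pXn2r _ 2) ?nnegrE ?nrm_ge0 ?(ltW e0)// nrmE.
have small (x : R) : 0 <= x -> (forall e : R, 0 < e -> x <= e) -> x = 0.
  by move=> x0 h; apply/eqP; rewrite eq_le x0 andbT; apply/ler_addgt0Pl => e e0; rewrite addr0 h.
have inv : nrm (tw z 1 P - P) = 0.
  apply: small => [|e e0]; first exact: nrm_ge0.
  have e4 : 0 < e / 4 by rewrite divr_gt0.
  have [n0 hn0] := cv _ e4; have [n1 hn1] := ex_div_small 2 e4.
  pose H := maxn n0 n1; have [H0 hs] := hn1 H (leq_maxr _ _); have hc := hn0 H (leq_maxl _ _).
  have -> : tw z 1 P - P = (tw z 1 P - tw z 1 (erg z H G)) + (tw z 1 (erg z H G) - erg z H G) + (erg z H G - P).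
    by ring.
  have s : nrm (tw z 1 (erg z H G) - erg z H G) <= 2 / H%:R.
    have := erg_shift 1 z1 G1' H0; rewrite mulr1; congr (_ <= _); congr nrm; congr (_ - _).
    rewrite /erg /tw U_amean ameanMl; apply: eq_amean => h.
    by rewrite -/(tw z h _) -/(tw z 1 _) -/(tw z 1 _) -!twD// addrC.
  apply: le_trans (nrmD _ _) _.
  have := nrmD (tw z 1 P - tw z 1 (erg z H G)) (tw z 1 (erg z H G) - erg z H G).
  by rewrite -twB nrm_tw// nrmBC; lra.
exists P; split=> //.
- have : eqv (sc S z * tw z 1 P) (sc S z * P) by apply: eqvM => //; exact: eqv_refl.
  by rewrite /tw mulrA -rmorphM exprN1 divff ?unim_neq0// rmorph1 mul1r.
have ipt n f : ip (tw z n%:Z f) P = ip f P.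
  have -> : ip f P = ip (tw z n%:Z f) (tw z n%:Z P) by rewrite ip_tw.
  have nul k : nrm (tw z k%:Z P - P) = 0.
    elim: k => [|k ih]; first by rewrite tw0 subrr nrm0.
    have -> : tw z k.+1%:Z P - P = tw z k%:Z (tw z 1 P - P) + (tw z k%:Z P - P).
      by rewrite twB -twD// -[k.+1]addn1 PoszD; ring.
    by apply: nullD ih; rewrite /null nrm_tw.
  apply/eqP; rewrite -subr_eq0 -ipNr -ipDr -normr_le0; apply: le_trans (CS _ _) _.
  by rewrite nrmBC nul mulr0.
have ipe H : (0 < H)%N -> ip (erg z H G) P = ip G P.
  move=> H0; rewrite /erg ip_ameanl -[RHS](@mean_cst R nat (iota 0 H)) ?size_iota//.
  by apply: eq_mean => h; exact: ipt.
apply/eqP; rewrite -subr_eq0 -normr_eq0; apply/eqP; apply: small => // e e0.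
have [n0 hn0] := cv _ e0; have := hn0 n0.+1 (leqnSn _) => h.
rewrite -(ipe n0.+1)// -ipff -ipNl -ipDl; apply: le_trans (CS _ _) _.
by apply: le_trans (ltW h); rewrite ler_piMr ?nrm_ge0 ?le1_nrm1.
Qed.

End MeanErgodic.

Lemma ex_uniform (T : eqType) (s : seq T) (P : T -> nat -> Prop) :
  {in s, forall x, exists n0, forall n, (n0 <= n)%N -> P x n} ->
  exists n0, forall n, (n0 <= n)%N -> {in s, forall x, P x n}.
Proof.
elim: s => [|x s ih] h; first by exists 0%N.
have [n1 h1] := h x (mem_head _ _).
have [|n2 h2] := ih; first by move=> y ys; apply: h; rewrite inE ys orbT.
exists (maxn n1 n2) => n; rewrite geq_max => /andP[n1n n2n] y.
by rewrite inE => /predU1P[->|]; [exact: h1|exact: h2].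
Qed.

(** * The complex integral *)

Section ComplexTrace.
Variables (R : realType) (S : system R).
Implicit Types (f g F G P : S) (z w : R[i]).

Definition sqn z : R := complex.Re z ^+ 2 + complex.Im z ^+ 2.
(** The integral, recovered from its real part. *)
Definition ctr f : R[i] := Complex (tau S f) (- tau S (sc S (Complex 0 1) * f)).

Lemma mul_conjc z : z * conjc z = real_complex R (sqn z).
Proof. by case: z => a b; apply/eqP; rewrite eq_complex /sqn /=; apply/andP; split; apply/eqP; ring. Qed.

Lemma sqn_ge0 z : 0 <= sqn z. Proof. by rewrite addr_ge0 ?sqr_ge0. Qed.

Lemma unim_sqn z : unim z <-> sqn z = 1.
Proof.
rewrite /unim mul_conjc; split=> [h|->//].
by have := congr1 (@complex.Re R) h.
Qed.

Lemma ctrD f g : ctr (f + g) = ctr f + ctr g.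
Proof.
apply/eqP; rewrite eq_complex /=; apply/andP; split; apply/eqP; first by rewrite raddfD.
by rewrite mulrDr raddfD opprD.
Qed.

Lemma ctr0 : ctr 0 = 0.
Proof. by rewrite /ctr mulr0 !raddf0 ?oppr0. Qed.

Lemma ctr_sum (I : Type) (s : seq I) (v : I -> S) :
  ctr (\sum_(i <- s) v i) = \sum_(i <- s) ctr (v i).
Proof. by elim/big_rec2: _ => [|i x y _ <-]; [exact: ctr0|exact: ctrD]. Qed.

Lemma scE z : sc S z = rs S (complex.Re z) + rs S (complex.Im z) * sc S (Complex 0 1).
Proof.
rewrite /rs -rmorphM -rmorphD; congr (sc S _).
by case: z => a b; apply/eqP; rewrite eq_complex /=; apply/andP; split; apply/eqP; ring.
Qed.

Lemma ctr_sc w f : ctr (sc S w * f) = w * ctr f.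
Proof.
have ii : sc S (Complex 0 1) * sc S (Complex 0 1) = - 1.
  rewrite -rmorphM -(rmorphN1 (sc S)); congr (sc S _).
  by apply/eqP; rewrite eq_complex /=; apply/andP; split; apply/eqP; ring.
apply/eqP; rewrite eq_complex /=; apply/andP; split; apply/eqP.
  rewrite (scE w) mulrDl raddfD -mulrA !tau_rs; case: w => a b /=; ring.
rewrite (scE w) (_ : _ * _ = rs S (complex.Re w) * (sc S (Complex 0 1) * f) + rs S (complex.Im w) * (sc S (Complex 0 1) * sc S (Complex 0 1)) * f); last by ring.
rewrite ii raddfD mulrN1 mulNr raddfN /= !tau_rs.
by case: w => a b /=; ring.
Qed.

Lemma ctr_star f : ctr (star S f) = conjc (ctr f).
Proof.
apply/eqP; rewrite eq_complex /= tau_star eqxx /=; apply/eqP.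
rewrite -[in LHS]tau_star rmorphM /= starK star_sc.
have -> : conjc (Complex 0 1) = - (Complex 0 1) :> R[i].
  by apply/eqP; rewrite eq_complex /= oppr0 !eqxx.
by rewrite rmorphN mulNr raddfN.
Qed.

Lemma ctr1 : ctr 1 = 1.
Proof.
have h := ctr_star 1; rewrite rmorph1 in h.
apply/eqP; rewrite eq_complex /= tau1 eqxx /=; apply/eqP.
have := congr1 (@complex.Im R) h; rewrite /= opprK.
set t := tau S _ => e; have : t = 0 by move: e; lra.
by move=> ->; rewrite oppr0.
Qed.

Lemma ctrU n f : ctr (U S n f) = ctr f.
Proof.
congr Complex; first exact: tauU.
by congr (- _); rewrite -[RHS](tauU n) rmorphM /= U_sc.
Qed.

Lemma ctr_eqv f g : eqv f g -> ctr f = ctr g.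
Proof.
move=> h; congr Complex; first exact: eqv_tau.
by congr (- _); apply/eqv_tau/eqvM => //; exact: eqv_refl.
Qed.

Lemma ctr_sqr f : ctr (f * star S f) = real_complex R (nrm2 f).
Proof.
apply/eqP; rewrite eq_complex /= eqxx /=; apply/eqP.
have := congr1 (@complex.Im R) (ctr_star (f * star S f)).
rewrite rmorphM /= starK [star S f * f]mulrC => /= e; move: e.
by set t := tau S _ => e; have : t = 0 by [move: e; lra]; move=> ->; rewrite oppr0.
Qed.

Lemma ctr_scalar z : ctr (sc S z) = z.
Proof. by rewrite -[sc S z]mulr1 ctr_sc ctr1 mulr1. Qed.

Lemma nrm2_sc z f : nrm2 (sc S z * f) = sqn z * nrm2 f.
Proof.
rewrite /nrm2 rmorphM /= star_sc.
have -> : sc S z * f * (sc S (conjc z) * star S f) = sc S (z * conjc z) * (f * star S f).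
  by rewrite rmorphM; ring.
by rewrite mul_conjc tau_rs.
Qed.

Lemma nrm2_scalar z : nrm2 (sc S z) = sqn z.
Proof. by rewrite -[sc S z]mulr1 nrm2_sc nrm2_1 mulr1. Qed.

Lemma invariant_const P : eqv (U S 1 P) P -> eqv P (sc S (ctr P)).
Proof.
rewrite /eqv {1}/null => h.
have [|z hz] := @ergodic_alg R S P; first by rewrite -/(nrm2 _) -nrmE h expr2 mulr0.
have e : eqv P (sc S z) by rewrite /eqv /null /nrm /nrm2 hz sqrtr0.
by rewrite (ctr_eqv e) ctr_scalar.
Qed.

Lemma erg1E H G : erg 1 H G = amean (iota 0 H) (fun j => U S j%:Z G).
Proof. by apply: eq_amean => j; rewrite /tw exp1rz rmorph1 mul1r. Qed.

Lemma erg1_limit G : le1 G -> forall e : R, 0 < e -> exists n0, forall J, (n0 <= J)%N ->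
  nrm2 (erg 1 J G) <= sqn (ctr G) + e.
Proof.
move=> G1 e e0; have [P [P1 PU _ cv]] := mean_ergodic (@unim1 R) G1.
have Pc : eqv P (sc S (ctr P)).
  by apply: invariant_const; apply: eqv_trans PU _; rewrite rmorph1 mul1r; exact: eqv_refl.
have small (x : R) : 0 <= x -> (forall e : R, 0 < e -> x <= e) -> x = 0.
  by move=> x0 h; apply/eqP; rewrite eq_le x0 andbT; apply/ler_addgt0Pl => e' e'0; rewrite addr0 h.
have tauP w : unim w -> tau S (sc S w * P) = tau S (sc S w * G).
  move=> w1; apply/eqP; rewrite -subr_eq0 -normr_eq0; apply/eqP; apply: small => // d d0.
  have [n0 hn0] := cv _ d0; have h := hn0 n0.+1 (leqnSn _).
  have -> : tau S (sc S w * G) = tau S (sc S w * erg 1 n0.+1 G).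
    rewrite (tau_amean_U _ (ltn0Sn n0)) erg1E ameanMl; congr (tau S _).
    by apply: eq_amean => j; rewrite rmorphM /= U_sc.
  rewrite -raddfB -mulrBr; apply: le_trans (tau_le _) _; rewrite nrm_unim// nrmBC; exact: ltW.
have ctrP : ctr P = ctr G.
  congr Complex; first by have := tauP 1 (@unim1 R); rewrite rmorph1 !mul1r.
  by rewrite tauP// unim_sqn /sqn /= expr0n expr1n add0r.
have e4 : 0 < e / 2 by rewrite divr_gt0.
have [n0 hn0] := cv _ e4; exists n0 => J /hn0 h.
have -> : sqn (ctr G) = nrm2 P by rewrite (eqv_nrm2 Pc) ctrP nrm2_scalar.
rewrite -!nrmE; have := nrm_le (erg 1 J G) P.
have := le1_nrm1 P1; have := le1_nrm1 (le1_erg J (@unim1 R) G1).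
by have := nrm_ge0 P; have := nrm_ge0 (erg 1 J G); nra.
Qed.

(** By ergodicity the averages of [U^a G * conj (U^b G)] tend to its integral, so
    the second box norm is the mean square of the autocorrelations of [G]. *)
Lemma trace_box G (t : R) : le1 G ->
  (forall H J, (0 < H)%N -> (0 < J)%N -> t <= boxnorm [:: H; J] G) ->
  forall H, (0 < H)%N ->
  t <= \E_(a < H) \E_(b < H) sqn (ctr (U S a%:Z G * star S (U S b%:Z G))).
Proof.
move=> G1 h H H0; apply/ler_addgt0Pl => e e0.
have G1' (a b : nat) : le1 (U S a%:Z G * star S (U S b%:Z G)).
  by apply: le1M; [exact: le1U|exact/le1_star/le1U].
have [|n0 hn0] := @ex_uniform _ (allpairs pair (iota 0 H) (iota 0 H))
  (fun ab J => nrm2 (erg 1 J (U S ab.1%:Z G * star S (U S ab.2%:Z G))) <=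
     sqn (ctr (U S ab.1%:Z G * star S (U S ab.2%:Z G))) + e).
  by move=> [a b] _; exact: erg1_limit.
have := h H n0.+1 H0 isT; rewrite boxnorm_cons => hb; apply: le_trans hb _.
apply: le_trans (_ : \E_(a < H) \E_(b < H) (sqn (ctr (U S a%:Z G * star S (U S b%:Z G))) + e) <= _).
  apply: ler_mean_in => a aH; apply: ler_mean_in => b bH.
  rewrite boxnorm1 -erg1E; apply: (hn0 _ (leqnSn _) (a, b)).
  by apply/allpairsP; exists (a, b).
rewrite addrC -[X in _ <= _ + X](@mean_cst R nat (iota 0 H)) ?size_iota// -meanD.
apply: ler_mean => a; rewrite -[X in _ <= _ + X](@mean_cst R nat (iota 0 H)) ?size_iota//.
by rewrite -meanD.
Qed.

End ComplexTrace.

(** ** A finite Fourier transform *)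

Lemma prim_root_ex (R : realType) n : (0 < n)%N -> exists2 z : R[i], n.-primitive_root z & unim z.
Proof.
move=> n0; have [r Dp] := closed_field_poly_normal ('X^n - 1 : {poly R[i]}).
rewrite (monicP _) ?monicXnsubC // scale1r in Dp.
have [z zr pz] : exists2 z, z \in r & n.-primitive_root z.
  apply/hasP/(has_prim_root n0); first by apply/allP => z; rewrite -root_prod_XsubC -Dp.
    by rewrite -separable_prod_XsubC -Dp separable_Xn_sub_1 // pnatr_eq0 -lt0n.
  by rewrite -ltnS -(size_prod_XsubC r id) -Dp size_XnsubC.
exists z => //; apply/unim_sqn; have := prim_expr_order pz => zn.
have : sqn z ^+ n = 1.
  have : (z * conjc z) ^+ n = 1 by rewrite exprMn -rmorphXn /= zn conjc1 mulr1.
  by rewrite mul_conjc -rmorphXn => h; have := congr1 (@complex.Re R) h.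
by move/eqP; rewrite pexpr_eq1 ?sqn_ge0// => /eqP.
Qed.

Section DFT.
Variables (R : realType) (S : system R) (G : S).
Implicit Types (z w : R[i]).

Let gam (a b : nat) := ctr (U S a%:Z G * star S (U S b%:Z G)).

Lemma gam_shift k a b : gam (k + a) (k + b) = gam a b.
Proof. by rewrite /gam !PoszD !UD -U_star -rmorphM /= ctrU. Qed.

Lemma gam_conj a b : gam b a = conjc (gam a b).
Proof. by rewrite /gam -ctr_star rmorphM /= starK mulrC. Qed.

Definition twsum z K : S := \sum_(a <- iota 0 K) tw z a%:Z G.

Lemma erg_twsum z K : (0 < K)%N -> nrm2 (twsum z K) = K%:R ^+ 2 * nrm2 (erg z K G).
Proof.
move=> K0; rewrite /erg /amean size_iota nrm2Z mulrA -exprMn divff ?expr1n ?mul1r//.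
by rewrite pnatr_eq0 -lt0n.
Qed.

Lemma ctr_twsum z K : unim z -> real_complex R (nrm2 (twsum z K)) =
  \sum_(a <- iota 0 K) \sum_(b <- iota 0 K) (conjc z ^+ a * z ^+ b) * gam a b.
Proof.
move=> z1; rewrite -ctr_sqr /twsum rmorph_sum big_distrlr /= ctr_sum.
apply: eq_bigr => a _; rewrite ctr_sum; apply: eq_bigr => b _.
have zV (k : nat) : z ^ (- k%:Z) = conjc z ^+ k by rewrite -exprz_inv unimV.
have zJ : conjc (conjc z ^+ b) = z ^+ b by rewrite rmorphXn /= conjcK.
rewrite /gam -ctr_sc; congr (ctr _); rewrite /tw rmorphM /= star_sc !zV zJ.
by rewrite (rmorphM (sc S)); ring.
Qed.

Lemma geom_unity (x : R[i]) (M : nat) : x ^+ M = 1 ->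
  \sum_(m <- iota 0 M) x ^+ m = if x == 1 then M%:R else 0.
Proof.
move=> xM; rewrite -{1}[M]subn0 big_mkord; case: eqP => [->|/eqP x1].
  by rewrite (eq_bigr (fun=> 1)) ?sumr_const ?card_ord// => i _; rewrite expr1n.
have := subrX1 x M; rewrite xM subrr => /esym/eqP.
by rewrite mulf_eq0 subr_eq0 (negbTE x1) /= => /eqP.
Qed.

Variables (M : nat) (o : R[i]) (po : M.-primitive_root o) (o1 : unim o).

Lemma orthogonality (p q : nat) : (p < M)%N -> (q < M)%N ->
  \sum_(m <- iota 0 M) conjc (o ^+ m) ^+ p * (o ^+ m) ^+ q = if p == q then M%:R else 0.
Proof.
move=> pM qM; rewrite (eq_bigr (fun m => (conjc (o ^+ p) * o ^+ q) ^+ m)); last first.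
  move=> m _; rewrite exprMn -!rmorphXn /= -!exprM mulnC; congr (_ * _).
  by rewrite mulnC.
rewrite geom_unity; last first.
  rewrite exprMn -rmorphXn /= -!exprM mulnC exprM (prim_expr_order po) expr1n conjc1 mul1r.
  by rewrite mulnC exprM (prim_expr_order po) expr1n.
have op := unim_exp p o1.
have -> : (conjc (o ^+ p) * o ^+ q == 1) = (p == q).
  apply/eqP/eqP => [h|->]; last by rewrite mulrC; exact: unim_exp.
  have : o ^+ q = o ^+ p.
    by rewrite -[RHS]mulr1 -h mulrA op mul1r.
  move/eqP; rewrite (eq_prim_root_expr po) !modn_small// => /eqP->//.
by [].
Qed.

End DFT.

Lemma big_distr2 (T : comPzRingType) (s s1 s2 : seq nat) (A B : nat -> nat -> nat -> T) :
  \sum_(m <- s) (\sum_(c <- s2) \sum_(d <- s2) B m c d) * (\sum_(a <- s1) \sum_(b <- s1) A m a b) =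
  \sum_(a <- s1) \sum_(b <- s1) \sum_(c <- s2) \sum_(d <- s2) \sum_(m <- s) A m a b * B m c d.
Proof.
transitivity (\sum_(m <- s) \sum_(a <- s1) \sum_(b <- s1) \sum_(c <- s2) \sum_(d <- s2) A m a b * B m c d).
  apply: eq_bigr => m _; rewrite mulrC mulr_suml; apply: eq_bigr => a _.
  rewrite mulr_suml; apply: eq_bigr => b _; rewrite mulr_sumr; apply: eq_bigr => c _.
  by rewrite mulr_sumr.
rewrite exchange_big; apply: eq_bigr => a _; rewrite exchange_big; apply: eq_bigr => b _.
by rewrite exchange_big; apply: eq_bigr => c _; rewrite exchange_big.
Qed.

(** * Eigenfunctions from the second box norm *)

Section LargeCoefficient.
Variables (R : realType) (S : system R) (G : S).

Let gam (a b : nat) := ctr (U S a%:Z G * star S (U S b%:Z G)).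

(** Multiplying two Fejer-type sums and summing over all the roots of unity
    isolates the squares of the correlations; since one of the factors has a
    known mean, the other one must be large somewhere. *)
Lemma large_coefficient (t : R) H : 0 < t -> (0 < H)%N -> nrm2 G <= 1 ->
  t <= \E_(a < H) \E_(b < H) sqn (gam a b) ->
  exists2 z, unim z & t / 4 <= nrm2 (erg z H G).
Proof.
move=> t0 H0 G1 ht; pose K := (2 * H)%N; pose M := (3 * H)%N.
have K0 : (0 < K)%N by rewrite muln_gt0.
have M0 : (0 < M)%N by rewrite muln_gt0.
have [rho po o1] := prim_root_ex R M0.
have om m : unim (rho ^+ m) by exact: unim_exp.
apply: contrapT => nex.
have small m : nrm2 (twsum G (rho ^+ m) H) <= H%:R ^+ 2 * (t / 4).
  rewrite erg_twsum// ler_wpM2l ?exprn_ge0 ?ler0n// leNgt; apply/negP => h.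
  by apply: nex; exists (rho ^+ m) => //; exact: ltW.
pose sK m := nrm2 (twsum G (rho ^+ m) K); pose sH m := nrm2 (twsum G (rho ^+ m) H).
(* the mean of the squares of the longer sums, by orthogonality of the characters *)
have sumK : \sum_(m <- iota 0 M) sK m = M%:R * K%:R * nrm2 G.
  have e : real_complex R (\sum_(m <- iota 0 M) sK m) = real_complex R (M%:R * K%:R * nrm2 G).
    rewrite rmorph_sum /=.
    under eq_bigr do rewrite /sK ctr_twsum//.
    rewrite exchange_big /=; under eq_bigr do rewrite exchange_big /=.
    under eq_bigr => a _ do under eq_bigr => b _ do rewrite -mulr_suml.
    transitivity (\sum_(a <- iota 0 K) (M%:R * real_complex R (nrm2 G))).
      apply: eq_big_seq => a; rewrite mem_iota add0n => /andP[_ aK].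
      rewrite (bigD1_seq a) ?mem_iota ?add0n ?aK ?iota_uniq//=.
      rewrite (@orthogonality _ M rho) ?eqxx//; try by rewrite (leq_trans aK)// leq_mul2r orbT.
      rewrite big1_seq ?addr0; last first.
        move=> b /andP[ba]; rewrite mem_iota add0n => /andP[_ bK].
        rewrite (@orthogonality _ M rho)//; try by rewrite (leq_trans aK)// leq_mul2r orbT.
          by rewrite eq_sym (negbTE ba) mul0r.
        by rewrite (leq_trans bK)// leq_mul2r orbT.
      by congr (_ * _); rewrite -U_star -rmorphM ctrU ctr_sqr.
    rewrite big_const_seq count_predT iter_addr_0 size_iota !rmorphM /= !rmorph_nat -mulr_natl.
    by ring.
  by have := congr1 (@complex.Re R) e.
(* the number of ways to write a - b as a difference of numbers less than K = 2 H, at least H *)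
pose cnt (a b : nat) : nat := (\sum_(c <- iota 0 K) \sum_(d <- iota 0 K) (a + c == b + d))%N.
have sumKH : \sum_(m <- iota 0 M) sK m * sH m =
   M%:R * \sum_(a <- iota 0 H) \sum_(b <- iota 0 H) sqn (gam a b) * (cnt a b)%:R.
  have e : real_complex R (\sum_(m <- iota 0 M) sK m * sH m) = real_complex R
     (\sum_(a <- iota 0 H) \sum_(b <- iota 0 H) \sum_(c <- iota 0 K) \sum_(d <- iota 0 K)
        (M%:R * (sqn (gam a b) * (a + c == b + d)%:R))).
    rewrite rmorph_sum /=; under eq_bigr do rewrite rmorphM /= /sK /sH !ctr_twsum//.
    rewrite big_distr2 rmorph_sum; apply: eq_big_seq => a; rewrite mem_iota add0n => /andP[_ aH].
    rewrite rmorph_sum; apply: eq_big_seq => b; rewrite mem_iota add0n => /andP[_ bH].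
    rewrite rmorph_sum; apply: eq_big_seq => c; rewrite mem_iota add0n => /andP[_ cK].
    rewrite rmorph_sum; apply: eq_big_seq => d; rewrite mem_iota add0n => /andP[_ dK].
    transitivity ((\sum_(m <- iota 0 M) conjc (rho ^+ m) ^+ (a + c) * (rho ^+ m) ^+ (b + d)) * (gam a b * gam c d)).
      by rewrite mulr_suml; apply: eq_bigr => m _; rewrite !exprD /gam; ring.
    have sM : M = (H + K)%N by rewrite /M /K; lia.
    rewrite (@orthogonality _ M rho)//; try by rewrite sM; lia.
    rewrite !rmorphM /= !rmorph_nat; case: eqP => [e|_]; last by rewrite !mulr0 mul0r.
    have -> : gam c d = gam b a.
      by rewrite /gam -(gam_shift G a c d) e addnC (addnC a) gam_shift.
    by rewrite /gam (gam_conj G a b) mul_conjc mulr1.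
  have := congr1 (@complex.Re R) e => /= ->.
  rewrite mulr_sumr; apply: eq_bigr => a _; rewrite mulr_sumr; apply: eq_bigr => b _.
  rewrite /cnt natr_sum !mulr_sumr; apply: eq_bigr => c _.
  by rewrite natr_sum !mulr_sumr.
have cntH a b : (a < H)%N -> (b < H)%N -> (H <= cnt a b)%N.
  move=> aH bH; rewrite /cnt.
  have e : iota 0 K = iota 0 b ++ iota b H ++ iota (b + H) (H - b).
    by rewrite -!iotaD; congr iota; rewrite /K; lia.
  rewrite {1}e !big_cat /=; apply: leq_trans (leq_addl _ _); apply: leq_trans (leq_addr _ _).
  rewrite -[X in (X <= _)%N](size_iota b H) -sum1_size.
  rewrite big_seq [X in (_ <= X)%N]big_seq; apply: leq_sum => c; rewrite mem_iota => /andP[bc cH].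
  rewrite (big_rem (a + c - b)%N) /=; last by rewrite mem_iota /K; lia.
  by rewrite (_ : (a + c == b + (a + c - b))%N); [exact: leq_addr|apply/eqP; lia].
have HR : 0 < H%:R :> R by rewrite ltr0n.
have MR : 0 < M%:R :> R by rewrite ltr0n.
have sumsq : \sum_(a <- iota 0 H) \sum_(b <- iota 0 H) sqn (gam a b) =
    H%:R ^+ 2 * \E_(a < H) \E_(b < H) sqn (gam a b).
  rewrite /mean !size_iota -mulr_sumr; field; exact: lt0r_neq0.
have low : M%:R * (H%:R * (H%:R ^+ 2 * t)) <= \sum_(m <- iota 0 M) sK m * sH m.
  rewrite sumKH ler_wpM2l ?ler0n//.
  apply: le_trans (_ : H%:R * \sum_(a <- iota 0 H) \sum_(b <- iota 0 H) sqn (gam a b) <= _).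
    by rewrite sumsq ler_wpM2l ?ler0n// ler_wpM2l ?exprn_ge0 ?ler0n.
  rewrite mulr_sumr; rewrite big_seq [leRHS]big_seq; apply: ler_sum => a.
  rewrite mem_iota => /andP[_ aH].
  rewrite mulr_sumr; rewrite big_seq [leRHS]big_seq; apply: ler_sum => b.
  rewrite mem_iota => /andP[_ bH].
  by rewrite mulrC ler_wpM2l ?sqn_ge0// ler_nat cntH.
have up : \sum_(m <- iota 0 M) sK m * sH m <= H%:R ^+ 2 * (t / 4) * (M%:R * K%:R * nrm2 G).
  rewrite -sumK mulr_sumr; apply: ler_sum => m _; rewrite mulrC.
  by rewrite ler_wpM2r ?nrm2_ge0// small.
have : H%:R ^+ 2 * (t / 4) * (M%:R * K%:R * nrm2 G) <= H%:R ^+ 2 * (t / 4) * (M%:R * K%:R).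
  rewrite ler_wpM2l//; first by rewrite mulr_ge0 ?exprn_ge0 ?ler0n ?divr_ge0// ltW.
  by rewrite ler_piMr// mulr_ge0 ?ler0n.
have -> : H%:R ^+ 2 * (t / 4) * (M%:R * K%:R) = M%:R * (H%:R * (H%:R ^+ 2 * t)) / 2.
  by rewrite /K natrM; field.
have : 0 < M%:R * (H%:R * (H%:R ^+ 2 * t)) by rewrite !mulr_gt0 ?exprn_gt0.
lra.
Qed.

End LargeCoefficient.

Section Eigenfunction.
Variables (R : realType) (S : system R).
Variables (V : set_system nat) (hV : UltraFilter V) (Vinf : eventually `<=` V).
Implicit Types (G : S) (z w : R[i]).

Lemma tw_diff z w n G : unim z -> unim w -> le1 G ->
  nrm (tw z n%:Z G - tw w n%:Z G) <= n%:R * nrm (sc S z - sc S w).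
Proof.
move=> z1 w1 G1.
have zV (x : R[i]) (k : nat) : unim x -> x ^ (- k%:Z) = conjc x ^+ k.
  by move=> x1; rewrite -exprz_inv unimV.
rewrite /tw !zV// -mulrBl; apply: le_trans (le1_nrmr _ (le1U _ G1)) _.
elim: n => [|n ih]; first by rewrite !expr0 subrr nrm0 mul0r.
have -> : sc S (conjc z ^+ n.+1) - sc S (conjc w ^+ n.+1) =
   sc S (conjc z ^+ n) * star S (sc S z - sc S w) + sc S (conjc w) * (sc S (conjc z ^+ n) - sc S (conjc w ^+ n)).
  by rewrite rmorphB /= !star_sc !exprS !(rmorphM (sc S)); ring.
apply: le_trans (nrmD _ _) _; rewrite !nrm_unim ?nrm_star; [|exact: unimJ|exact/unim_exp/unimJ].
by rewrite -[n.+1]addn1 natrD mulrDl mul1r addrC lerD2r.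
Qed.

Lemma erg_diff z w H G : unim z -> unim w -> le1 G ->
  nrm (erg z H G - erg w H G) <= H%:R * nrm (sc S z - sc S w).
Proof.
move=> z1 w1 G1; rewrite /erg -ameanB; apply: le_trans (nrm_amean _ _) _.
apply: le_trans (_ : \E_(h < H) (H%:R * nrm (sc S z - sc S w)) <= _).
  apply: ler_mean_in => h; rewrite mem_iota add0n => /andP[_ hH].
  apply: le_trans (tw_diff _ _ _ _) _ => //; rewrite ler_wpM2r ?nrm_ge0// ler_nat; exact: ltnW.
by apply: mean_cst_le; rewrite mulr_ge0 ?ler0n ?nrm_ge0.
Qed.

(** The frequencies obtained at the scales [j`!] have a limit along the
    ultrafilter; as enlarging a scale to a multiple decreases the averages, the
    limit frequency works at all the scales at once. *)
Lemma eigenfunction G (t : R) : 0 < t -> le1 G ->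
  (forall H J, (0 < H)%N -> (0 < J)%N -> t <= boxnorm [:: H; J] G) ->
  exists chi w, [/\ unim w, eqv (chi * star S chi) 1, eqv (U S 1 chi) (sc S w * chi) &
     Num.sqrt t / 2 <= tau S (G * chi)].
Proof.
move=> t0 G1 hG.
have /choice[z hz] : forall j : nat, exists z, unim z /\ t / 4 <= nrm2 (erg z j`! G).
  move=> j; have [|z z1 h] := large_coefficient t0 (fact_gt0 j) (le1_nrm21 G1).
    exact: (trace_box G1 hG (fact_gt0 j)).
  by exists z.
have sq1 j : complex.Re (z j) ^+ 2 + complex.Im (z j) ^+ 2 = 1 by exact/unim_sqn/(hz j).1.
have le1sq (x y : R) : x ^+ 2 + y ^+ 2 = 1 -> `|x| <= 1.
  move=> h; rewrite -(@ler_pXn2r _ 2) ?nnegrE// expr1n real_normK ?num_real//.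
  by have := sqr_ge0 y; lra.
have [x hx] := ucvg_bounded hV (fun j => le1sq _ _ (sq1 j)).
have [y hy] : exists y, ucvg V (fun j => complex.Im (z j)) y.
  by apply: (ucvg_bounded hV (c := 1)) => j; apply: (le1sq _ (complex.Re (z j))); rewrite addrC sq1.
pose w : R[i] := Complex x y.
have near (e : R) : 0 < e -> V [set j | nrm (sc S (z j) - sc S w) < e].
  move=> e0; have e2 : 0 < e / 2 by rewrite divr_gt0.
  apply: filterS2 (hx _ e2) (hy _ e2) => j /= h1 h2.
  rewrite -(@ltr_pXn2r _ 2) ?nnegrE ?nrm_ge0 ?(ltW e0)// nrmE -rmorphB nrm2_scalar /sqn.
  rewrite -[X in X ^+ 2 + _](_ : complex.Re (z j) - x = _); last by case: (z j).
  rewrite -[X in _ + X ^+ 2](_ : complex.Im (z j) - y = _); last by case: (z j).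
  move: h1 h2; rewrite !ltr_norml => /andP[a b] /andP[c d].
  by nra.
have w1 : unim w.
  apply/unim_sqn; rewrite -(nrm2_scalar S) -nrmE; suff -> : nrm (sc S w) = 1 by rewrite expr1n.
  apply/eqP; rewrite -subr_eq0 -normr_le0; apply/ler_addgt0Pl => e e0; rewrite addr0.
  have [j /= h _] := V_ex hV Vinf 0 (near _ e0).
  have nz : nrm (sc S (z j)) = 1.
    by rewrite -[sc S _]mulr1 nrm_unim ?nrm1//; exact: (hz j).1.
  have := nrm_le (sc S (z j)) (sc S w); have := nrm_le (sc S w) (sc S (z j)).
  by rewrite nrmBC nz ler_norml => ? ?; apply/andP; split; lra.
pose c := Num.sqrt t / 2.
have c0 : 0 < c by rewrite divr_gt0 ?sqrtr_gt0.
have c2 : c ^+ 2 = t / 4.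
  rewrite /c expr_div_n sqr_sqrtr ?(ltW t0)//; congr (_ / _); ring.
(* at scale i!, compare with a scale j!, a multiple of it at which the frequency is near w *)
have low i : c <= nrm (erg w i`! G).
  apply/ler_addgt0Pl => e e0.
  have ei : 0 < e / (i`!)%:R by rewrite divr_gt0// ltr0n fact_gt0.
  have [j /= h ij] := V_ex hV Vinf i (near _ ei).
  have [zj1 hj] := hz j.
  have : c <= nrm (erg (z j) i`! G).
    rewrite -(@ler_pXn2r _ 2) ?nnegrE ?nrm_ge0 ?(ltW c0)// c2.
    apply: le_trans hj _; rewrite -nrmE ler_pXn2r ?nnegrE ?nrm_ge0//.
    have /dvdnP[k e'] : (i`! %| j`!)%N.
      by rewrite -(bin_fact ij) mulnCA dvdn_mulr.
    rewrite e' ergM// lt0n; apply/eqP => k0.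
    by have := fact_gt0 j; rewrite e' k0 mul0n.
  move: h; rewrite ltr_pdivlMr ?ltr0n ?fact_gt0// mulrC => h.
  have := erg_diff i`! zj1 w1 G1; have := nrm_le (erg (z j) i`! G) (erg w i`! G); lra.
have [P [P1 PU GP cv]] := mean_ergodic w1 G1.
have cP : c <= nrm P.
  apply/ler_addgt0Pl => e e0; have [n0 hn0] := cv _ e0.
  have := hn0 n0`! (fact_geq n0); have := low n0; have := nrm_le (erg w n0`! G) P; lra.
have P0 : 0 < nrm P by exact: lt_le_trans cP.
(* the modulus of an eigenfunction is invariant, hence constant *)
have PP : eqv (P * star S P) (rs S (nrm2 P)).
  have := @invariant_const R S (P * star S P); rewrite ctr_sqr; apply.
  rewrite rmorphM /= U_star.
  have -> : P * star S P = (sc S w * P) * star S (sc S w * P).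
    rewrite rmorphM /= (_ : _ * _ * _ = (sc S w * star S (sc S w)) * (P * star S P)); last by ring.
    by rewrite unim_star// mul1r.
  by apply: eqvM => //; exact: eqv_star.
exists (rs S (nrm P)^-1 * star S P), (conjc w); split.
- exact: unimJ.
- rewrite rmorphM /= star_rs starK.
  have -> : rs S (nrm P)^-1 * star S P * (rs S (nrm P)^-1 * P) = rs S ((nrm P)^-1 ^+ 2) * (P * star S P).
    by rewrite expr2 rsM; ring.
  apply: eqv_trans (eqvM (eqv_refl _) PP) _.
  by rewrite -rsM -nrmE -exprMn mulVf ?lt0r_neq0// expr1n rs1; exact: eqv_refl.
- rewrite rmorphM /= U_rs U_star mulrCA; apply: eqvM; first exact: eqv_refl.
  by have := eqv_star PU; rewrite rmorphM /= star_sc.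
rewrite mulrCA tau_rs.
by apply: le_trans cP _; rewrite -/(ip G P) GP -nrmE expr2 mulrA mulVf ?lt0r_neq0// mul1r.
Qed.

End Eigenfunction.

Fixpoint boxes (t H : nat) : seq (seq nat) :=
  if t is t'.+1 then [seq h :: r | h <- iota 0 H, r <- boxes t' H] else [:: [::]].

(** * Cubes and the box form of the Cauchy-Schwarz inequality *)

Section Boxes.
Variable R : realType.

Lemma mean_boxesS t H (a : seq nat -> R) :
  \E_(h <- boxes t.+1 H) a h = \E_(k < H) \E_(r <- boxes t H) a (k :: r).
Proof. by rewrite /= mean_allpairs. Qed.

Lemma mean_boxes0 H (a : seq nat -> R) : \E_(h <- boxes 0 H) a h = a [::].
Proof. by rewrite /mean /= big_seq1 invr1 mul1r. Qed.

Lemma size_boxes t H h : h \in boxes t H -> size h = t.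
Proof.
elim: t h => [|t ih] h /=; first by rewrite inE => /eqP ->.
by move=> /allpairsP[[k r] [_ /ih rt ->]] /=; rewrite rt.
Qed.

Lemma boxes_gt0 t H : (0 < H)%N -> (0 < size (boxes t H))%N.
Proof. by move=> H0; elim: t => // t ih; rewrite size_allpairs size_iota muln_gt0 H0. Qed.

Lemma mean_pow2_gen (I : Type) (s : seq I) (a : I -> R) t :
  (\E_(x <- s) a x) ^+ (2 ^ t) <= \E_(x <- s) (a x ^+ (2 ^ t)).
Proof.
case: t => [|t]; last exact: mean_pow2_even.
by rewrite expr1; apply: ler_mean => x; rewrite expr1.
Qed.

End Boxes.

Section Cubes.
Variables (R : realType) (S : system R).
Implicit Types (F G X : S) (x y b : seq nat -> S).

(** The product over the vertices of a cube with sides [h i] and [h' i]: every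
    vertex translates [F] by one of the two numbers in each coordinate, with a
    conjugation for each choice of [h']. *)
Fixpoint cube (h h' : seq nat) F : S :=
  match h, h' with
  | k :: r, k' :: r' => cube r r' (U S k%:Z F * star S (U S k'%:Z F))
  | _, _ => F
  end.

Lemma cubeM h h' F G : cube h h' (F * G) = cube h h' F * cube h h' G.
Proof.
elim: h h' F G => [|k r ih] [|k' r'] F G //=; rewrite -ih; congr cube.
by rewrite !rmorphM /=; ring.
Qed.

Lemma cube_star h h' F : cube h h' (star S F) = star S (cube h h' F).
Proof.
elim: h h' F => [|k r ih] [|k' r'] F //=; rewrite -ih; congr cube.
by rewrite !U_star rmorphM.
Qed.

Lemma cubeU h h' n F : cube h h' (U S n F) = U S n (cube h h' F).
Proof.
elim: h h' F => [|k r ih] [|k' r'] F //=; rewrite -ih; congr cube.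
by rewrite rmorphM /= U_star !(UC n).
Qed.

Lemma le1_cube h h' F : le1 F -> le1 (cube h h' F).
Proof.
elim: h h' F => [|k r ih] [|k' r'] F //= F1; apply: ih.
by apply: le1M; [exact: le1U|exact/le1_star/le1U].
Qed.

Lemma cube1 h h' : cube h h' 1 = 1.
Proof.
elim: h h' => [|k r ih] [|k' r'] //=.
by rewrite (rmorph1 (U S k%:Z)) (rmorph1 (U S k'%:Z)) rmorph1 mulr1.
Qed.

Lemma cube_unim h h' z : unim z -> h != [::] -> size h = size h' -> cube h h' (sc S z) = 1.
Proof.
by move=> z1; case: h h' => [|k r] [|k' r'] //= _ _; rewrite !U_sc unim_star// cube1.
Qed.

Lemma cube_prod h h' (I : Type) (s : seq I) (P : pred I) (F : I -> S) :
  cube h h' (\prod_(i <- s | P i) F i) = \prod_(i <- s | P i) cube h h' (F i).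
Proof. by elim/big_rec2: _ => [|i y1 y2 _ <-]; [exact: cube1|exact: cubeM]. Qed.

Lemma boxnorm_boxes t H Hs F : boxnorm (nseq t H ++ Hs) F =
  \E_(h <- boxes t H) \E_(h' <- boxes t H) boxnorm Hs (cube h h' F).
Proof.
elim: t F => [|t ih] F; first by rewrite !mean_boxes0.
rewrite mean_boxesS boxnorm_cons; apply: eq_mean => k.
transitivity (\E_(k' < H) \E_(r <- boxes t H) \E_(r' <- boxes t H) boxnorm Hs (cube (k :: r) (k' :: r') F)).
  by apply: eq_mean => k'; rewrite ih.
by rewrite mean_exch; apply: eq_mean => r; rewrite mean_boxesS.
Qed.

(** ** The box form of the Cauchy-Schwarz inequality *)

(** The product of [x] over the vertices, with the conjugations of [cube]. *)
Fixpoint bx x (h h' : seq nat) : S :=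
  match h, h' with
  | k :: r, k' :: r' => bx (fun s => x (k :: s) * star S (x (k' :: s))) r r'
  | _, _ => x [::]
  end.

Lemma eq_bx x y h h' : x =1 y -> bx x h h' = bx y h h'.
Proof.
elim: h h' x y => [|k r ih] [|k' r'] x y //= e; try exact: e.
by apply: ih => s; rewrite !e.
Qed.

Lemma bxM x y h h' : bx (fun s => x s * y s) h h' = bx x h h' * bx y h h'.
Proof.
elim: h h' x y => [|k r ih] [|k' r'] x y //=; rewrite -ih; apply: eq_bx => s.
by rewrite rmorphM; ring.
Qed.

Lemma bx_star x h h' : bx (fun s => star S (x s)) h h' = star S (bx x h h').
Proof.
elim: h h' x => [|k r ih] [|k' r'] x //=; rewrite -ih; apply: eq_bx => s.
by rewrite rmorphM.
Qed.

Lemma le1_bx x h h' : (forall s, le1 (x s)) -> le1 (bx x h h').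
Proof.
elim: h h' x => [|k r ih] [|k' r'] x x1 //=; apply: ih => s.
by apply: le1M => //; exact: le1_star.
Qed.

Lemma bx_translates F h h' : bx (fun s => U S (sumn s)%:Z F) h h' = cube h h' F.
Proof.
elim: h h' F => [|k r ih] [|k' r'] F /=; rewrite ?U0//.
rewrite -ih; apply: eq_bx => s.
by rewrite rmorphM /= U_star -!UD !PoszD ![(sumn s)%:Z + _]addrC.
Qed.

(** Products of contractions each of which does not see one of the
    coordinates. *)
Fixpoint low (t : nat) b : Prop :=
  if t is t'.+1 then exists b1 b', [/\ forall r, le1 (b1 r),
      forall k r, b (k :: r) = b1 r * b' (k :: r) & forall k, low t' (fun r => b' (k :: r))]
  else b [::] = 1.

Lemma lowM t b c : low t b -> low t c -> low t (fun r => b r * c r).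
Proof.
elim: t b c => [|t ih] b c /=; first by move=> -> ->; rewrite mulr1.
move=> [b1 [b' [b1l bE b'l]]] [c1 [c' [c1l cE c'l]]].
exists (fun r => b1 r * c1 r), (fun r => b' r * c' r); split=> [r|k r|k].
- exact: le1M.
- by rewrite bE cE; ring.
- exact: ih.
Qed.

Lemma low_star t b : low t b -> low t (fun r => star S (b r)).
Proof.
elim: t b => [|t ih] b /=; first by move=> ->; rewrite rmorph1.
move=> [b1 [b' [b1l bE b'l]]].
exists (fun r => star S (b1 r)), (fun r => star S (b' r)); split=> [r|k r|k].
- exact: le1_star.
- by rewrite bE rmorphM.
- exact: ih.
Qed.

Lemma lowU t n b : low t b -> low t (fun r => U S n (b r)).
Proof.
elim: t b => [|t ih] b /=; first by move=> ->; rewrite rmorph1.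
move=> [b1 [b' [b1l bE b'l]]].
exists (fun r => U S n (b1 r)), (fun r => U S n (b' r)); split=> [r|k r|k].
- exact: le1U.
- by rewrite bE rmorphM.
- exact: ih.
Qed.

(** Each application of the Cauchy-Schwarz inequality removes the factor of [b]
    that is independent of one coordinate, and doubles that coordinate. *)
Lemma box_CauchySchwarz t H x b : low t b ->
  (\E_(h <- boxes t H) tau S (x h * b h)) ^+ (2 ^ t) <=
  \E_(h <- boxes t H) \E_(h' <- boxes t H) tau S (bx x h h').
Proof.
elim: t x b => [|t ih] x b lb; first by rewrite !mean_boxes0 expr1 lb mulr1.
case: lb => b1 [b' [b1l bE b'l]].
pose z k k' := \E_(r <- boxes t H)
  tau S (x (k :: r) * star S (x (k' :: r)) * (b' (k :: r) * star S (b' (k' :: r)))).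
have sq : (\E_(h <- boxes t.+1 H) tau S (x h * b h)) ^+ 2 <= \E_(k < H) \E_(k' < H) z k k'.
  pose Y r := amean (iota 0 H) (fun k => x (k :: r) * b' (k :: r)).
  have -> : \E_(h <- boxes t.+1 H) tau S (x h * b h) = \E_(r <- boxes t H) tau S (b1 r * Y r).
    rewrite mean_boxesS mean_exch; apply: eq_mean => r; rewrite /Y ameanMl tau_amean.
    by apply: eq_mean => k; rewrite bE; congr (tau S _); ring.
  apply: le_trans (mean_sqr _ _) _.
  apply: le_trans (_ : \E_(r <- boxes t H) nrm2 (Y r) <= _).
    apply: ler_mean => r; rewrite -nrmE -real_normK ?num_real//.
    rewrite ler_pXn2r ?nnegrE ?nrm_ge0//; apply: le_trans (tau_le _) _; exact: le1_nrm.
  rewrite le_eqVlt; apply/orP; left; apply/eqP.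
  transitivity (\E_(r <- boxes t H) \E_(k < H) \E_(k' < H)
      tau S (x (k :: r) * star S (x (k' :: r)) * (b' (k :: r) * star S (b' (k' :: r))))).
    apply: eq_mean => r; rewrite /Y nrm2_amean; apply: eq_mean => k; apply: eq_mean => k'.
    by rewrite /ip rmorphM; congr (tau S _); ring.
  by rewrite mean_exch; apply: eq_mean => k; rewrite mean_exch.
rewrite expnS exprM; apply: le_trans (_ : (\E_(k < H) \E_(k' < H) z k k') ^+ (2 ^ t) <= _).
  by rewrite ler_pXn2r ?expn_gt0 ?nnegrE ?sqr_ge0 ?(le_trans _ sq) ?sqr_ge0.
apply: le_trans (mean_pow2_gen _ _ _) _; rewrite mean_boxesS; apply: ler_mean => k.
apply: le_trans (mean_pow2_gen _ _ _) _.
apply: le_trans (_ : \E_(k' < H) \E_(r <- boxes t H) \E_(r' <- boxes t H) tau S (bx x (k :: r) (k' :: r')) <= _).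
  apply: ler_mean => k'; apply: ih; apply: lowM; first exact: b'l.
  exact/low_star/b'l.
by rewrite mean_exch; apply: ler_mean => r; rewrite mean_boxesS.
Qed.

(** What remains of the cube without the vertex [h]; every other vertex takes a
    value of [h'], so does not see one of the coordinates of [h]. *)
Fixpoint cuberest (h h' : seq nat) F : S :=
  match h, h' with
  | k :: r, k' :: r' => U S k%:Z (cuberest r r' F) * star S (U S k'%:Z (cube r r' F))
  | _, _ => 1
  end.

Lemma cube_split h h' F : size h = size h' -> cube h h' F = U S (sumn h)%:Z F * cuberest h h' F.
Proof.
elim: h h' => [|k r ih] [|k' r'] //=; first by rewrite U0 mulr1.
by move=> [/ih e]; rewrite cubeM cube_star !cubeU {1}e PoszD UD [U S _ (_ * _)]rmorphM /= mulrA.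
Qed.

Lemma low_cuberest h' F : le1 F -> low (size h') (fun h => cuberest h h' F).
Proof.
move=> F1; elim: h' => [|k' r' ih] //=.
exists (fun r => star S (U S k'%:Z (cube r r' F))), (fun h => if h is k :: r then U S k%:Z (cuberest r r' F) else 1).
split=> [r|k r|k] /=; last exact: lowU.
  by apply/le1_star/le1U/le1_cube.
by rewrite mulrC.
Qed.

Fixpoint bxrest x (h h' : seq nat) : S :=
  match h, h' with
  | k :: r, k' :: r' => bxrest (fun s => x (k :: s)) r r' * star S (bx (fun s => x (k' :: s)) r r')
  | _, _ => 1
  end.

Lemma bx_split x h h' : size h = size h' -> bx x h h' = x h * bxrest x h h'.
Proof.
elim: h h' x => [|k r ih] [|k' r'] x //=; first by rewrite mulr1.
by move=> [/ih e]; rewrite bxM bx_star e mulrA.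
Qed.

Lemma low_bxrest x h' : (forall s, le1 (x s)) -> low (size h') (fun h => bxrest x h h').
Proof.
elim: h' x => [|k' r' ih] x x1 //=.
exists (fun r => star S (bx (fun s => x (k' :: s)) r r')),
  (fun h => if h is k :: r then bxrest (fun s => x (k :: s)) r r' else 1).
split=> [r|k r|k] /=; last exact: ih.
  exact/le1_star/le1_bx.
by rewrite mulrC.
Qed.

End Cubes.

(** * Lowering the degree of a box norm *)

Section Eigen.
Variables (R : realType) (S : system R).
Implicit Types (F G X : S) (z w : R[i]).

Definition eigen z X := unim z /\ eqv (U S 1 X) (sc S z * X).

Lemma eigenM z w X G : eigen z X -> eigen w G -> eigen (z * w) (X * G).
Proof.
move=> [z1 hX] [w1 hG]; split; first exact: unimM.
rewrite rmorphM /= (rmorphM (sc S)).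
have -> : sc S z * sc S w * (X * G) = (sc S z * X) * (sc S w * G) by ring.
exact: eqvM.
Qed.

Lemma eigen_star z X : eigen z X -> eigen (conjc z) (star S X).
Proof.
move=> [z1 hX]; split; first exact: unimJ.
by rewrite U_star -star_sc -rmorphM; exact: eqv_star.
Qed.

Lemma eigen_nat z X (n : nat) : eigen z X -> eqv (U S n%:Z X) (sc S (z ^+ n) * X).
Proof.
move=> [z1 hX]; elim: n => [|n ih]; first by rewrite U0 expr0 rmorph1 mul1r; exact: eqv_refl.
rewrite -[n.+1]addn1 PoszD UD.
apply: eqv_trans (eqvU n%:Z hX) _; rewrite rmorphM /= U_sc.
apply: eqv_trans (eqvM (eqv_refl (sc S z)) ih) _.
by rewrite addn1 exprS (rmorphM (sc S)) mulrA; exact: eqv_refl.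
Qed.

Lemma eigen_int z X (n : int) : eigen z X -> eqv (U S n X) (sc S (z ^ n) * X).
Proof.
move=> ez; have z1 := ez.1; case: n => n; first exact: eigen_nat.
rewrite NegzE; have h := eqvU (- n.+1%:Z) (eigen_nat n.+1 ez).
rewrite -UD addNr U0 rmorphM /= U_sc in h.
apply: eqv_sym; apply: eqv_trans (eqvM (eqv_refl _) h) _.
rewrite mulrA -rmorphM -exprz_inv.
rewrite (_ : z^-1 ^ n.+1 * z ^+ n.+1 = 1) ?rmorph1 ?mul1r; first exact: eqv_refl.
by rewrite -exprnP -exprMn mulVf ?unim_neq0// expr1n.
Qed.

(** Eigenfunctions of modulus one, with 0 as a placeholder for the cubes that
    correlate with none; the dichotomy survives products. *)
Definition zeroone X := X = 0 \/ eqv (X * star S X) 1.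

Lemma zeroone_mul X G : zeroone X -> zeroone G -> zeroone (X * G).
Proof.
move=> [->|hX]; first by rewrite mul0r; left.
move=> [->|hG]; first by rewrite mulr0; left.
right; rewrite rmorphM /=.
have -> : X * G * (star S X * star S G) = (X * star S X) * (G * star S G) by ring.
by have := eqvM hX hG; rewrite mulr1.
Qed.

Lemma zeroone_star X : zeroone X -> zeroone (star S X).
Proof. by move=> [->|h]; [left; rewrite rmorph0|right; rewrite starK mulrC]. Qed.

Lemma zeroone_le1 X : zeroone X -> le1 X.
Proof. by move=> [->|]; [exact: le1_0|exact: le1_eqv_iso]. Qed.

(** The eigenvalue of the product of the eigenfunctions at the vertices. *)
Fixpoint bxz (l : seq nat -> R[i]) (h h' : seq nat) : R[i] :=
  match h, h' with
  | k :: r, k' :: r' => bxz (fun s => l (k :: s) * conjc (l (k' :: s))) r r'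
  | _, _ => l [::]
  end.

Lemma bx_eigen (l : seq nat -> R[i]) (x : seq nat -> S) h h' :
  (forall s, eigen (l s) (x s)) -> eigen (bxz l h h') (bx x h h').
Proof.
elim: h h' l x => [|k r ih] [|k' r'] l x e //=; apply: ih => s.
by apply: eigenM => //; exact: eigen_star.
Qed.

Lemma bx_zeroone (x : seq nat -> S) h h' :
  (forall s, zeroone (x s)) -> zeroone (bx x h h').
Proof.
elim: h h' x => [|k r ih] [|k' r'] x e //=; apply: ih => s.
by apply: zeroone_mul => //; exact: zeroone_star.
Qed.

End Eigen.

Section Lowering.
Variables (R : realType) (S : system R).
Variables (V : set_system nat) (hV : UltraFilter V) (Vinf : eventually `<=` V).
Implicit Types (F G X : S) (z w : R[i]).

(** A lower bound for the seminorm of order [s], the infimum of the box norms. *)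
Definition NS s (eta : R) F := forall Hs, size Hs = s -> all (leq 1) Hs -> eta <= boxnorm Hs F.

Lemma V_all (T : eqType) (s : seq T) (A : T -> set nat) : (forall x, V (A x)) ->
  V [set k | {in s, forall x, A x k}].
Proof.
move=> VA; elim: s => [|x s ih]; first by apply: filterS filterT => k _ /=.
apply: filterS2 (VA x) ih => k /= Axk h y.
by rewrite inE => /predU1P[->//|]; exact: h.
Qed.

Lemma le_indic_mean (I : eqType) (s : seq I) (a : I -> R) (P : I -> Prop) (c e : R) :
  0 <= e -> c <= \E_(x <- s) a x -> (forall x, a x <= 1) ->
  {in s, forall x, ~ P x -> a x <= e} ->
  c - e <= \E_(x <- s) (`[< P x >])%:R.
Proof.
move=> e0 hc a1 ha; rewrite lerBlDr; apply: le_trans hc _.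
apply: le_trans (_ : \E_(x <- s) ((`[< P x >])%:R + e) <= _).
  apply: ler_mean_in => x xs; case: asboolP => [_|/(ha _ xs)]; last by rewrite add0r.
  by apply: le_trans (a1 x) _; rewrite lerDl.
by rewrite meanD lerD2l mean_cst_le.
Qed.

(** Only correlations with eigenfunctions whose eigenvalue is a root of unity
    of order at most [Q] can contribute. *)
Definition decorrelates (psi : nat -> nat -> S) (N : nat -> nat) t (e : R) Q :=
  forall h h' X w, size h = t -> size h' = t -> le1 X -> eigen w X ->
  (forall q, (0 < q <= Q)%N -> w ^+ q != 1) ->
  exists K, forall k, (K <= k)%N -> \E_(j < N k) tau S (X * cube h h' (psi k j)) <= e.

(** The box norm of degree [t + 2] is the average over the cubes of dimension
    [t] of the second box norms.  The finitely many bad cubes can be detected at a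
    common pair of lengths, because enlarging to multiples decreases box norms. *)
Lemma many_good_cubes t (eta : R) F H : 0 < eta -> le1 F -> NS t.+2 eta F -> (0 < H)%N ->
  eta / 2 <= \E_(a <- boxes t H) \E_(b <- boxes t H)
    (`[< forall H' J, (0 < H')%N -> (0 < J)%N -> eta / 2 <= boxnorm [:: H'; J] (cube a b F) >])%:R.
Proof.
move=> eta0 F1 hF H0.
pose P (a b : seq nat) := forall H' J, (0 < H')%N -> (0 < J)%N -> eta / 2 <= boxnorm [:: H'; J] (cube a b F).
have [|n hn] := @ex_uniform _ (allpairs pair (boxes t H) (boxes t H))
  (fun ab n => ~ P ab.1 ab.2 -> boxnorm [:: n`!; n`!] (cube ab.1 ab.2 F) <= eta / 2).
  move=> [a b] _ /=; have [p|np] := pselect (P a b); first by exists 0%N.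
  have [H' [J [H'0 J0 lt]]] : exists H' J, [/\ (0 < H')%N, (0 < J)%N & boxnorm [:: H'; J] (cube a b F) < eta / 2].
    apply: contrapT => h; apply: np => H' J H'0 J0; rewrite leNgt; apply/negP => lt.
    by apply: h; exists H', J.
  exists (maxn H' J) => n; rewrite geq_max => /andP[H'n Jn] _.
  apply: le_trans (ltW lt); apply: boxnorm_mono; rewrite /= !fact_gt0 !dvdn_fact//.
    by rewrite J0.
  by rewrite H'0.
have := hF (nseq t H ++ [:: n`!; n`!]); rewrite size_cat size_nseq addn2 => /(_ erefl).
rewrite all_cat /= !fact_gt0 !andbT all_nseq H0 orbT => /(_ isT).
rewrite boxnorm_boxes => h.
have h' : eta <= \E_(ab <- [seq (a, b) | a <- boxes t H, b <- boxes t H])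
    boxnorm [:: n`!; n`!] (cube ab.1 ab.2 F) by rewrite mean_allpairs.
suff : eta - eta / 2 <= \E_(ab <- [seq (a, b) | a <- boxes t H, b <- boxes t H]) (`[< P ab.1 ab.2 >])%:R.
  rewrite mean_allpairs; have -> // : eta - eta / 2 = eta / 2 by field.
apply: (le_indic_mean _ h').
- by rewrite divr_ge0// ltW.
- by move=> ab; apply/boxnorm_le1/le1_cube.
- by move=> ab abs; exact: hn.
Qed.

Lemma box_dilated t H J (Q : nat) F : (0 < t)%N -> (0 < Q)%N ->
  \E_(j < J) \E_(j' < J) boxnorm (nseq t H) (U S (Q * j)%N%:Z F * star S (U S (Q * j')%N%:Z F)) <=
  Q%:R * boxnorm ((Q * J)%N :: nseq t H) F.
Proof. by move=> t0 Q0; apply: boxnorm_dilate_nat => //; case: t t0. Qed.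

(** If the box norm of degree [t + 2] is large, many of the cubes of dimension
    [t] built from [F] correlate with eigenfunctions.  Replacing one vertex by
    the averages that define [F] and eliminating the others shows that, for many
    pairs of boxes, the product of the eigenvalues over the vertices is a root of
    unity of bounded order.  The eigenfunction attached to a cube is then a
    product of functions each independent of some coordinate, up to a function
    with a bounded period, so eliminating it costs only one degree. *)
Lemma lowering t (eta : R) : (0 < t)%N -> 0 < eta ->
  exists2 e1 : R, 0 < e1 & forall Q, exists2 eta' : R, 0 < eta' &
  forall F (psi : nat -> nat -> S) (N : nat -> nat), le1 F -> (forall k j, le1 (psi k j)) ->
    (forall k, (0 < N k)%N) ->
    (forall f, ucvg V (fun k => ip f (amean (iota 0 (N k)) (psi k))) (ip f F)) ->
    decorrelates psi N t e1 Q -> NS t.+2 eta F -> NS t.+1 eta' F.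
Proof.
move=> t0 eta0; pose c : R := Num.sqrt (eta / 2) / 2.
have eta2 : 0 < eta / 2 by rewrite divr_gt0.
have c0 : 0 < c by rewrite divr_gt0 ?sqrtr_gt0.
pose dl := c * (eta / 2); have dl0 : 0 < dl by rewrite mulr_gt0.
pose d1 := (dl / 2) ^+ (2 ^ t); have d10 : 0 < d1 by rewrite exprn_gt0 ?divr_gt0.
exists (d1 / 2) => [|Q]; first by rewrite divr_gt0.
(* a common period of all the roots of unity of order at most Q *)
pose Q' := Q`!; have Q'0 : (0 < Q')%N by exact: fact_gt0.
pose d2 := c ^+ 2 * (d1 / 2); have d20 : 0 < d2 by rewrite mulr_gt0 ?exprn_gt0// divr_gt0.
exists (d2 ^+ (2 ^ t) / Q'%:R); first by rewrite divr_gt0 ?exprn_gt0 ?ltr0n.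
move=> F psi N F1 psi1 N0 wk dec hF [|J Hs] // [sHs] /= /andP[J0 Hs0].
pose H := (\prod_(x <- Hs) x)%N.
have H0 : (0 < H)%N.
  by rewrite /H big_seq; apply: prodn_cond_gt0 => x /(allP Hs0).
(* it is enough to treat boxes with equal sides, apart from the one carrying the new coordinate *)
suff main : d2 ^+ (2 ^ t) <= Q'%:R * boxnorm ((Q' * J)%N :: nseq t H) F.
  rewrite ler_pdivrMr ?ltr0n// mulrC; apply: le_trans main _.
  rewrite ler_wpM2l ?ler0n//; apply: boxnorm_mono => /=.
  rewrite dvdn_mull//= muln_gt0 Q'0 J0 /= -sHs.
  have : {in Hs, forall x, (x %| H)%N} by move=> x xs; rewrite /H (big_rem x)//= dvdn_mulr.
  elim: (Hs) => //= x s ih hx; rewrite hx ?mem_head// H0 /=; apply: ih => y ys.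
  by apply: hx; rewrite inE ys orbT.
(* fix one of the two boxes so that many choices of the other give good cubes *)
have [b bb hb] : exists2 b, b \in boxes t H & eta / 2 <= \E_(a <- boxes t H)
    (`[< forall H' J, (0 < H')%N -> (0 < J)%N -> eta / 2 <= boxnorm [:: H'; J] (cube a b F) >])%:R.
  apply: mean_ex_in; first exact: boxes_gt0.
  by rewrite mean_exch; exact: many_good_cubes.
set good := (X in \E_(a <- _) (`[< X a >])%:R) in hb.
have sb := size_boxes bb.
have /choice[chi hchi] : forall a, exists X : S * R[i], [/\ eigen X.2 X.1, zeroone X.1,
    good a -> c <= tau S (cube a b F * X.1) & ~ good a -> X.1 = 0].
  move=> a; have [ga|nga] := pselect (good a); last first.
    exists (0, 1); split=> //=; last by left.
    split; [exact: unim1|rewrite rmorph0 mulr0; exact: eqv_refl].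
  have [X [w [w1 X1 Xw hX]]] := eigenfunction hV Vinf eta2 (le1_cube a b F1) ga.
  by exists (X, w); split=> //=; right.
pose x a := (chi a).1; pose l a := (chi a).2.
have xe a : eigen (l a) (x a) by case: (hchi a).
have xz a : zeroone (x a) by case: (hchi a).
have x1 a : le1 (x a) by exact: zeroone_le1.
have step3 : dl <= \E_(a <- boxes t H) tau S (cube a b F * x a).
  have low : dl <= c * \E_(a <- boxes t H) ((`[< good a >])%:R : R) by rewrite ler_wpM2l// ltW.
  apply: le_trans low _.
  rewrite -meanZ; apply: ler_mean => a; case: (hchi a) => _ _ h1 h2.
  case: asboolP => [ga|nga]; first by rewrite mulr1; exact: h1.
  by rewrite mulr0 /x h2// mulr0 raddf0.
pose L a := cuberest a b F.
have cubeE a : a \in boxes t H -> cube a b F = U S (sumn a)%:Z F * L a.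
  by move=> ab; rewrite /L -cube_split// (size_boxes ab) sb.
pose ph a := star S (U S (- (sumn a)%:Z) (L a * x a)).
have phE a G : tau S (U S (sumn a)%:Z G * x a * L a) = ip (ph a) G.
  rewrite /ip /ph -rmorphM tau_star -[RHS](tauU (sumn a)%:Z) rmorphM /= UK.
  by congr (tau S _); ring.
(* in the vertex that carries no conjugate, replace F by the averages that converge to it *)
have step4 : V [set k | dl / 2 <= \E_(j < N k) \E_(a <- boxes t H)
    tau S (U S (sumn a)%:Z (psi k j) * x a * L a)].
  have dl2 : 0 < dl / 2 by rewrite divr_gt0.
  apply: filterS (V_all (boxes t H) (fun a => wk (ph a) _ dl2)) => k /= hk.
  have -> : \E_(j < N k) \E_(a <- boxes t H) tau S (U S (sumn a)%:Z (psi k j) * x a * L a) =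
      \E_(a <- boxes t H) ip (ph a) (amean (iota 0 (N k)) (psi k)).
    rewrite mean_exch; apply: eq_mean => a; rewrite ip_ameanr; apply: eq_mean => j; exact: phE.
  apply: le_trans (_ : \E_(a <- boxes t H) (tau S (cube a b F * x a) - dl / 2) <= _).
    rewrite meanB mean_cst ?boxes_gt0//; move: step3; set m := mean _ _; lra.
  apply: ler_mean_in => a ab; have := hk a ab; rewrite ltr_norml => /andP[h _].
  rewrite cubeE// mulrAC phE; lra.
pose X h h' := bx x h h'; pose w h h' := bxz l h h'.
(* outside P the hypothesis of decorrelation applies *)
pose P h h' := (exists2 q, (0 < q <= Q)%N & w h h' ^+ q = 1) /\ X h h' <> 0.
have [K hK] : exists K, forall k, (K <= k)%N -> {in [seq (h, h') | h <- boxes t H, h' <- boxes t H],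
    forall hh, ~ P hh.1 hh.2 -> \E_(j < N k) tau S (X hh.1 hh.2 * cube hh.1 hh.2 (psi k j)) <= d1 / 2}.
  apply: ex_uniform => -[h h'] /allpairsP[[a a'] [/= ha ha' [-> ->]]].
  have [|np] := pselect (P a a'); first by exists 0%N.
  have [X0|X0] := pselect (X a a' = 0).
    exists 0%N => k _ _; rewrite X0; apply: mean_le; first by rewrite divr_ge0// ltW.
    by move=> j; rewrite mul0r raddf0 divr_ge0// ltW.
  have [||||q hq|K hK] := dec a a' (X a a') (w a a').
  - exact: size_boxes ha.
  - exact: size_boxes ha'.
  - exact/zeroone_le1/bx_zeroone.
  - exact: bx_eigen.
  - by apply/eqP => e; apply: np; split=> //; exists q.
  by exists K => k Kk _; exact: hK.
have [k hk Kk] := V_ex hV Vinf K step4.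
have step5 : d1 <= \E_(h <- boxes t H) \E_(h' <- boxes t H) \E_(j < N k) tau S (X h h' * cube h h' (psi k j)).
  apply: le_trans (_ : (\E_(j < N k) \E_(a <- boxes t H) tau S (U S (sumn a)%:Z (psi k j) * x a * L a)) ^+ (2 ^ t) <= _).
    by rewrite ler_pXn2r ?expn_gt0 ?nnegrE ?(le_trans _ hk) ?divr_ge0// ltW.
  apply: le_trans (mean_pow2_gen _ _ _) _.
  apply: le_trans (_ : \E_(j < N k) \E_(h <- boxes t H) \E_(h' <- boxes t H)
      tau S (bx (fun a => U S (sumn a)%:Z (psi k j) * x a) h h') <= _).
    by apply: ler_mean => j; apply: box_CauchySchwarz; rewrite -sb; exact: low_cuberest.
  rewrite mean_exch; apply: ler_mean => h; rewrite mean_exch; apply: ler_mean => h'.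
  by apply: ler_mean => j; rewrite bxM bx_translates mulrC.
(* fix the second box again, now for the eigenfunctions *)
have [h' h'b hh'] : exists2 h', h' \in boxes t H & d1 / 2 <= \E_(h <- boxes t H) (`[< P h h' >])%:R.
  apply: mean_ex_in; first exact: boxes_gt0.
  rewrite mean_exch.
  suff : d1 - d1 / 2 <= \E_(hh <- [seq (h, h') | h <- boxes t H, h' <- boxes t H]) (`[< P hh.1 hh.2 >])%:R.
    by rewrite mean_allpairs; have -> // : d1 - d1 / 2 = d1 / 2 by field.
  apply: (le_indic_mean (a := fun hh => \E_(j < N k) tau S (X hh.1 hh.2 * cube hh.1 hh.2 (psi k j)))).
  - by rewrite divr_ge0// ltW.
  - by rewrite mean_allpairs.
  - move=> hh; apply: mean_le => // j; apply: le_trans (tau_le' _) _; apply: le1_nrm1.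
    by apply: le1M; [exact/zeroone_le1/bx_zeroone|exact: le1_cube].
  - by move=> hh; exact: hK.
have sh' := size_boxes h'b.
(* the eigenfunction x h is X h h', of period dividing Q', times factors not seeing a coordinate of h *)
pose rest h := bxrest x h h'.
pose W h := cube h b F * star S (rest h).
have step6 h : h \in boxes t H -> P h h' ->
    c ^+ 2 <= nrm2 (amean (iota 0 J) (fun j => U S (Q' * j)%N%:Z (W h))).
  move=> hb' [[q /andP[q0 qQ] wq] X0].
  have Xs : X h h' = x h * rest h by apply: bx_split; rewrite (size_boxes hb') sh'.
  have [//|XX] : zeroone (X h h') by exact: bx_zeroone.
  case: (hchi h) => _ xz' hc hnc.
  have xh0 : x h <> 0 by move=> x0; apply: X0; rewrite Xs x0 mul0r.
  have [//|xx] : zeroone (x h) by [].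
  have gh : good h by apply: contrapT => /hnc.
  have rr : eqv (rest h * star S (rest h)) 1.
    apply: eqv_trans XX; rewrite Xs rmorphM /=.
    have -> : x h * rest h * (star S (x h) * star S (rest h)) = (x h * star S (x h)) * (rest h * star S (rest h)) by ring.
    by apply: eqv_sym; rewrite -[X in eqv _ X]mul1r; apply: eqvM => //; exact: eqv_refl.
  have xX : eqv (x h) (X h h' * star S (rest h)).
    rewrite Xs -mulrA -[X in eqv X _]mulr1; apply: eqvM; first exact: eqv_refl.
    exact: eqv_sym.
  have cW : c <= tau S (W h * X h h').
    apply: le_trans (hc gh) _; rewrite le_eqVlt; apply/orP; left; apply/eqP.
    rewrite -/(x h) (eqv_tau (eqvM (eqv_refl (cube h b F)) xX)); congr (tau S _).
    by rewrite /W; ring.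
  have per j : eqv (U S (Q' * j)%N%:Z (X h h')) (X h h').
    have := eigen_nat (Q' * j) (bx_eigen h h' xe).
    have /dvdnP[m ->] : (q %| Q' * j)%N by rewrite dvdn_mulr// dvdn_fact// q0.
    by rewrite mulnC exprM wq expr1n rmorph1 mul1r.
  apply: le_trans (_ : tau S (W h * X h h') ^+ 2 <= _).
    by rewrite ler_pXn2r ?nnegrE ?(ltW c0)// (le_trans _ cW) ?ltW.
  have X1 : le1 (X h h') by exact/zeroone_le1/bx_zeroone.
  have -> : tau S (W h * X h h') = tau S (X h h' * amean (iota 0 J) (fun j => U S (Q' * j)%N%:Z (W h))).
    rewrite ameanMl tau_amean -[LHS](@mean_cst R nat (iota 0 J)) ?size_iota//.
    apply: eq_mean => j; rewrite -(tauU (Q' * j)%N%:Z) rmorphM /= mulrC.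
    by apply: eqv_tau; apply: eqvM => //; exact: eqv_refl.
  rewrite -nrmE -real_normK ?num_real// ler_pXn2r ?nnegrE ?nrm_ge0//.
  by apply: le_trans (tau_le _) _; exact: le1_nrm.
pose Fj j j' := U S (Q' * j)%N%:Z F * star S (U S (Q' * j')%N%:Z F).
have step7 : d2 <= \E_(j < J) \E_(j' < J) \E_(h <- boxes t H)
    tau S (U S (Q' * j)%N%:Z (W h) * star S (U S (Q' * j')%N%:Z (W h))).
  have -> : \E_(j < J) \E_(j' < J) \E_(h <- boxes t H)
      tau S (U S (Q' * j)%N%:Z (W h) * star S (U S (Q' * j')%N%:Z (W h))) =
      \E_(h <- boxes t H) nrm2 (amean (iota 0 J) (fun j => U S (Q' * j)%N%:Z (W h))).
    rewrite [RHS](_ : _ = \E_(h <- boxes t H) \E_(j < J) \E_(j' < J)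
      tau S (U S (Q' * j)%N%:Z (W h) * star S (U S (Q' * j')%N%:Z (W h)))).
      by rewrite [RHS]mean_exch; apply: eq_mean => j; rewrite mean_exch.
    by apply: eq_mean => h; rewrite nrm2_amean.
  have low : d2 <= c ^+ 2 * \E_(h <- boxes t H) ((`[< P h h' >])%:R : R).
    by rewrite ler_wpM2l// exprn_ge0// ltW.
  apply: le_trans low _.
  rewrite -meanZ; apply: ler_mean_in => h hb'; case: asboolP => [Ph|_].
    by rewrite mulr1; exact: step6.
  by rewrite mulr0 nrm2_ge0.
apply: le_trans (box_dilated _ _ _ t0 Q'0).
apply: le_trans (_ : (\E_(j < J) \E_(j' < J) \E_(h <- boxes t H)
    tau S (U S (Q' * j)%N%:Z (W h) * star S (U S (Q' * j')%N%:Z (W h)))) ^+ (2 ^ t) <= _).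
  by rewrite ler_pXn2r ?expn_gt0 ?nnegrE ?(le_trans _ step7) ?(ltW d20).
apply: le_trans (mean_pow2_gen _ _ _) _; apply: ler_mean => j.
apply: le_trans (mean_pow2_gen _ _ _) _; apply: ler_mean => j'.
pose lw h := cuberest h b (Fj j j') *
  (U S (Q' * j)%N%:Z (star S (rest h)) * star S (U S (Q' * j')%N%:Z (star S (rest h)))).
have lowlw : low t lw.
  have lr : low t (fun h => star S (rest h)) by apply: low_star; rewrite -sh'; exact: low_bxrest.
  apply: lowM; last by apply: lowM; [exact: lowU|apply: low_star; exact: lowU].
  rewrite -sb; apply: low_cuberest; apply: le1M; first exact: le1U.
  by apply/le1_star/le1U.
have -> : \E_(h <- boxes t H) tau S (U S (Q' * j)%N%:Z (W h) * star S (U S (Q' * j')%N%:Z (W h))) =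
    \E_(h <- boxes t H) tau S (U S (sumn h)%:Z (Fj j j') * lw h).
  apply: eq_mean_in => h hb'; rewrite /lw mulrA -cube_split ?(size_boxes hb') ?sb//.
  rewrite /Fj cubeM cube_star !cubeU /W !rmorphM /=.
  by congr (tau S _); ring.
apply: le_trans (box_CauchySchwarz _ _ lowlw) _.
have -> : boxnorm (nseq t H) (Fj j j') = boxnorm (nseq t H ++ [::]) (Fj j j') by rewrite cats0.
rewrite boxnorm_boxes; apply: ler_mean => h; apply: ler_mean => h2.
by rewrite bx_translates.
Qed.

End Lowering.

(** * Exponential sums of polynomials *)

Section PolySeq.
Variable R : realType.
Implicit Types (u v : int -> R[i]) (z w : R[i]).

Definition udiff (h : int) u n := u (n + h) * conjc (u n).

(** Polynomial sequences in the unit circle, by iterated differences. *)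
Fixpoint pdeg d u : Prop :=
  if d is d'.+1 then forall h, pdeg d' (udiff h u) else forall n, u n = u 0.

Definition unims u := forall n, unim (u n).

Lemma unims_udiff h u : unims u -> unims (udiff h u).
Proof. by move=> u1 n; apply: unimM => //; exact: unimJ. Qed.

Lemma eq_pdeg d u v : u =1 v -> pdeg d u -> pdeg d v.
Proof.
elim: d u v => [|d ih] u v e /= h; first by move=> n; rewrite -!e.
by move=> k; apply: ih (h k) => n; rewrite /udiff !e.
Qed.

Lemma pdegM d u v : pdeg d u -> pdeg d v -> pdeg d (fun n => u n * v n).
Proof.
elim: d u v => [|d ih] u v /= hu hv; first by move=> n; rewrite hu hv.
move=> k; apply: eq_pdeg (ih _ _ (hu k) (hv k)) => n.
by rewrite /udiff rmorphM /=; ring.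
Qed.

Lemma pdeg_shift d u k : pdeg d u -> pdeg d (fun n => u (n + k)).
Proof.
elim: d u => [|d ih] u /= hu; first by move=> n; rewrite hu [RHS]hu.
by move=> h; apply: eq_pdeg (ih _ (hu h)) => n; rewrite /udiff addrAC.
Qed.

Lemma pdeg_exp d u (q : nat) : pdeg d u -> pdeg d (fun n => u n ^+ q).
Proof.
elim: d u => [|d ih] u /= hu; first by move=> n; rewrite hu.
move=> h; apply: eq_pdeg (ih _ (hu h)) => n.
by rewrite /udiff exprMn rmorphXn.
Qed.

Lemma pdeg_cst d z : unim z -> pdeg d (fun=> z).
Proof.
elim: d z => [|d ih] z z1 //= h; apply: eq_pdeg (ih 1 (@unim1 _)) => n.
by rewrite /udiff z1.
Qed.

Lemma step_const (T : Type) (f : int -> T) : (forall n, f (n + 1) = f n) -> forall n, f n = f 0.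
Proof.
move=> h; have hn (n : nat) : f n%:Z = f 0.
  by elim: n => // n ih; rewrite -addn1 PoszD h.
case=> n; first exact: hn.
rewrite NegzE; elim: n => [|n ih]; first by rewrite -h addNr.
by rewrite -ih -h; congr f; lia.
Qed.

Lemma unim_udiffE z w : unim w -> z = z * conjc w * w.
Proof. by move=> w1; rewrite -mulrA [_ * w]mulrC w1 mulr1. Qed.

Lemma geometric_int u c (k : nat) : (forall n, u (n + 1) = c * u n) -> forall n, u (n + k%:Z) = c ^+ k * u n.
Proof.
move=> h n; elim: k => [|k ih]; first by rewrite addr0 expr0 mul1r.
by rewrite -addn1 PoszD addrA h ih addn1 exprS mulrA.
Qed.

(** The difference has the same period, so a power of it is a constant [c]; then
    that power of [u] is geometric of ratio [c], and the period makes [c] a root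
    of unity. *)
Lemma pdeg_periodic d u (g : nat) : (0 < g)%N -> unims u -> pdeg d u ->
  (forall n, u (n + g%:Z) = u n) -> forall n, u n ^+ (g ^ d) = u 0 ^+ (g ^ d).
Proof.
move=> g0; elim: d u => [|d ih] u u1 /= hu per; first by move=> n; rewrite !expr1.
have := ih _ (unims_udiff 1 u1) (hu 1); set c := _ ^+ _ => hc.
have {}hc n : udiff 1 u n ^+ (g ^ d) = c.
  by apply: hc => m; rewrite /udiff addrAC !per.
pose W n := u n ^+ (g ^ d).
have W1 n : unim (W n) by exact/unim_exp.
have WS n : W (n + 1) = c * W n.
  by rewrite -(hc n) /udiff exprMn -rmorphXn /= -/(W _) -/(W _) -unim_udiffE.
have cg : c ^+ g = 1.
  have := geometric_int g WS 0; rewrite /W per => e.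
  apply: (mulIf (unim_neq0 (W1 0))); by rewrite -[LHS]e mul1r.
move=> n; rewrite expnSr !exprM -/(W _) -/(W _).
apply: (step_const (f := fun n => W n ^+ g)) => m.
by rewrite WS exprMn cg mul1r.
Qed.

(** If the difference has period [P], then [u (n + P) / u n] is constant, and it
    is a root of unity of order [q]. *)
Lemma pdeg_torsion d u (q : nat) : unims u -> pdeg d u -> (forall n, u n ^+ q = 1) ->
  forall n, u (n + (q ^ d)%N%:Z) = u n.
Proof.
elim: d u => [|d ih] u u1 /= hu tor n; first by rewrite hu [RHS]hu.
set P := (q ^ d)%N.
have per m : udiff 1 u (m + P%:Z) = udiff 1 u m.
  apply: ih => //; first exact: unims_udiff.
  by move=> k; rewrite /udiff exprMn -rmorphXn /= !tor conjc1 mulr1.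
pose pi0 m := u (m + P%:Z) * conjc (u m).
have pc m : pi0 m = pi0 0.
  apply: step_const => {}m; have := per m; rewrite /udiff /pi0 => e.
  rewrite -[RHS]mulr1 -(u1 (m + 1)) addrAC.
  rewrite [u (m + P%:Z + 1)](unim_udiffE _ (u1 (m + P%:Z))) e; ring.
have pE m : u (m + P%:Z) = pi0 0 * u m by rewrite -(pc m) /pi0 -unim_udiffE.
have it (k : nat) m : u (m + (k * P)%N%:Z) = pi0 0 ^+ k * u m.
  elim: k m => [|k ihk] m; first by rewrite mul0n addr0 expr0 mul1r.
  by rewrite mulSn PoszD addrA ihk pE exprS; ring.
have pq : pi0 0 ^+ q = 1 by rewrite /pi0 exprMn -rmorphXn /= !tor conjc1 mulr1.
by rewrite expnS it pq mul1r.
Qed.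

End PolySeq.

Section Weyl.
Variables (R : realType) (S : system R).
Implicit Types (u v : int -> R[i]) (z w : R[i]).

Definition scavg u M N : S := amean (iota 0 N) (fun j => sc S (u (M + j%:Z))).

Definition often u (e : R) := forall L, exists M N, (L <= N)%N /\ e <= nrm2 (scavg u M N).

(** Van der Corput's inequality, in which the diagonal terms have total weight
    [1 / H]. *)
Lemma often_diff (e : R) : 0 < e -> exists H : nat, forall u, unims u -> often u e ->
  exists a b : nat, [/\ (a < H)%N, (b < H)%N, a != b &
    often (fun n => u (n + a%:Z) * conjc (u (n + b%:Z))) ((e / 8) ^+ 2)].
Proof.
move=> e0; have [H hH] := ex_nat_ge (8 / e).
have H0 : (0 < H)%N by rewrite -(@ltr0n R); apply: lt_le_trans hH; rewrite divr_gt0.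
exists H => u u1 hu; apply: contrapT => nex.
pose ab (a b : nat) n := u (n + a%:Z) * conjc (u (n + b%:Z)).
have ab1 a b : unims (ab a b) by move=> n; apply: unimM => //; exact: unimJ.
have [|n0 hn0] := @ex_uniform _ [seq (a, b) | a <- iota 0 H, b <- iota 0 H]
  (fun x N => x.1 != x.2 -> forall M, nrm2 (scavg (ab x.1 x.2) M N) < (e / 8) ^+ 2).
  move=> [a' b'] /allpairsP[[a b] [/=]]; rewrite !mem_iota !add0n => /andP[_ aH] /andP[_ bH] [-> ->].
  have [->|anb] := eqVneq a b; first by exists 0%N.
  apply: contrapT => h; apply: nex; exists a, b; split=> // L.
  apply: contrapT => h'; apply: h; exists L => N LN _ M; rewrite ltNge; apply/negP => h''.
  by apply: h'; exists M, N.
have [L hL] := ex_nat_ge (8 * H%:R / e).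
have [M [N [+ hN]]] := hu (maxn 1 (maxn n0 L)).
rewrite !geq_max => /and3P[N0 n0N LN].
have y1 a b : nrm (scavg (ab a b) M N) <= 1.
  by apply/le1_nrm1/le1_amean => j; exact/le1_unim/ab1.
have : e / 2 <= \E_(a < H) \E_(b < H) nrm (scavg (ab a b) M N).
  apply: (@van_der_corput_lower R S (fun n => sc S (u n)) M N H e _ _ _ _ _ _ hN) => //.
  - by move=> n; exact/le1_unim.
  - by apply: le_trans hL _; rewrite ler_nat.
  move=> a b; apply: le_trans (tau_le' _); rewrite tau_amean le_eqVlt; apply/orP; left; apply/eqP.
  by apply: eq_mean => j; rewrite /ip star_sc -rmorphM.
suff : \E_(a < H) \E_(b < H) nrm (scavg (ab a b) M N) <= e / 8 + e / 8 by lra.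
have diag (a : nat) : (a < H)%N -> \E_(b < H) (a == b)%:R <= e / 8.
  move=> aH; rewrite /mean size_iota (bigD1_seq a) ?mem_iota ?iota_uniq//= eqxx big1 ?addr0 ?mulr1.
    by rewrite -[e / 8]invf_div lef_pV2 ?posrE ?divr_gt0 ?ltr0n.
  by move=> b ba; rewrite eq_sym (negbTE ba).
apply: le_trans (_ : \E_(a < H) (e / 8 + e / 8) <= _); last by rewrite mean_cst_le// addr_ge0 ?divr_ge0// ltW.
apply: ler_mean_in => a; rewrite mem_iota add0n => /andP[_ aH].
apply: le_trans (lerD (lexx _) (diag a aH)).
rewrite -[X in _ <= X + _](@mean_cst R nat (iota 0 H)) ?size_iota// -meanD.
apply: ler_mean_in => b; rewrite mem_iota add0n => /andP[_ bH].
have [->|anb] := eqVneq a b.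
  by apply: le_trans (y1 b b) _; rewrite lerDr divr_ge0// ltW.
rewrite addr0 -(@ler_pXn2r _ 2) ?nnegrE ?nrm_ge0 ?divr_ge0 ?(ltW e0)// nrmE; apply: ltW.
apply: (hn0 N n0N (a, b)) => //; apply/allpairsP; exists (a, b).
by rewrite /= !mem_iota !add0n aH bH.
Qed.

Lemma leq_expl m n k : (m <= n)%N -> (m ^ k <= n ^ k)%N.
Proof. by case: k => // k; rewrite leq_exp2r. Qed.

(** If the averages of a polynomial sequence are often large, some difference
    of it has the same property; by induction a power of that difference is
    constant, which makes the sequence itself a geometric sequence along a
    progression, and a nontrivial geometric sequence has small averages. *)
Lemma weyl d (e : R) : 0 < e -> exists C : nat, forall u, unims u -> pdeg d u -> often u e ->
  exists2 Q, (0 < Q <= C)%N & forall n, u n ^+ Q = u 0 ^+ Q.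
Proof.
elim: d e => [|d ih] e e0.
  by exists 1%N => u u1 hu _; exists 1%N => // n; rewrite hu.
have [H hH] := often_diff e0.
have e8 : 0 < (e / 8) ^+ 2 by rewrite exprn_gt0 ?divr_gt0.
have [C hC] := ih _ e8.
exists ((((C * H ^ d) ^ d) ^ d.+1)%N) => u u1 hu ou.
have [a [b [aH bH anb oab]]] := hH u u1 ou.
have ab1 : unims (fun n => u (n + a%:Z) * conjc (u (n + b%:Z))).
  by move=> n; apply: unimM => //; exact: unimJ.
have [] := hC _ ab1 _ oab.
  apply: eq_pdeg (pdeg_shift b%:Z (hu (a%:Z - b%:Z))) => n.
  by rewrite /udiff -addrA [b%:Z + _]addrC subrK.
move=> Q /andP[Q0 QC] hQ.
have [g /andP[g0 gH] [kap hkap]] : exists2 g : nat, (0 < g <= H)%N & exists kap, forall n,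
    (u (n + g%:Z) * conjc (u n)) ^+ Q = kap.
  have [lt|gt|e'] := ltngtP a b; last by rewrite e' eqxx in anb.
    exists (b - a)%N; first by rewrite subn_gt0 lt (leq_trans (leq_subr _ _))// ltnW.
    exists (conjc ((u (0 + a%:Z) * conjc (u (0 + b%:Z))) ^+ Q)) => n.
    have -> : n + (b - a)%N%:Z = n - a%:Z + b%:Z by rewrite -subzn 1?ltnW//; lia.
    by rewrite -(hQ (n - a%:Z)) subrK rmorphXn rmorphM /= conjcK mulrC.
  exists (a - b)%N; first by rewrite subn_gt0 gt (leq_trans (leq_subr _ _))// ltnW.
  exists ((u (0 + a%:Z) * conjc (u (0 + b%:Z))) ^+ Q) => n.
  have -> : n + (a - b)%N%:Z = n - b%:Z + a%:Z by rewrite -subzn 1?ltnW//; lia.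
  by rewrite -(hQ (n - b%:Z)) subrK.
pose y := udiff 1 u; have y1 : unims y by exact: unims_udiff.
have kap1 : unim kap by rewrite -(hkap 0); apply: unim_exp; apply: unimM => //; exact: unimJ.
have uQ n : u (n + g%:Z) ^+ Q = kap * u n ^+ Q.
  by rewrite -(hkap n) -exprMn -unim_udiffE.
(* u ^+ Q is multiplied by a constant along steps of length g, so its differences have period g *)
have wper n : y (n + g%:Z) ^+ Q = y n ^+ Q.
  rewrite /y /udiff !exprMn -!rmorphXn /= addrAC !uQ rmorphM /=.
  rewrite (_ : _ * _ * _ = (kap * conjc kap) * (u (n + 1) ^+ Q * conjc (u n ^+ Q))); last by ring.
  by rewrite kap1 mul1r.
have ydeg : pdeg d y by exact: hu.
have := pdeg_periodic g0 (fun n => unim_exp Q (y1 n)) (pdeg_exp Q ydeg) wper.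
pose Q1 := (Q * g ^ d)%N.
have Q10 : (0 < Q1)%N by rewrite muln_gt0 Q0 expn_gt0 g0.
move=> hw; have {}hw n : y n ^+ Q1 = y 0 ^+ Q1 by rewrite /Q1 !exprM.
pose P := (Q1 ^ d)%N.
have P0 : (0 < P)%N by rewrite expn_gt0 Q10.
have yper n : y (n + P%:Z) = y n.
  have x1 : unims (fun n => y n * conjc (y 0)) by move=> m; apply: unimM => //; exact: unimJ.
  have xdeg : pdeg d (fun n => y n * conjc (y 0)).
    by apply: pdegM => //; apply/pdeg_cst/unimJ.
  have := pdeg_torsion x1 xdeg (q := Q1); rewrite -/P => /(_ _ n) h.
  rewrite [LHS](unim_udiffE _ (y1 0)) h -?unim_udiffE// => m.
  by rewrite exprMn -rmorphXn /= hw; apply: unim_exp.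
pose pi0 m := u (m + P%:Z) * conjc (u m).
have pc m : pi0 m = pi0 0.
  apply: step_const => {}m; have := yper m; rewrite /y /udiff /pi0 => h.
  rewrite -[RHS]mulr1 -(u1 (m + 1)) addrAC.
  rewrite [u (m + P%:Z + 1)](unim_udiffE _ (u1 (m + P%:Z))) h; ring.
have pE m : u (m + P%:Z) = pi0 0 * u m by rewrite -(pc m) /pi0 -unim_udiffE.
(* the averages are hardly changed by the shift P, which multiplies them by pi0 0 *)
have pi1 : pi0 0 = 1.
  apply/eqP; rewrite -subr_eq0; apply: contraT => pn.
  pose c := sqn (pi0 0 - 1).
  have c0 : 0 < c.
    rewrite lt0r sqn_ge0 andbT /c; apply: contra pn => /eqP c0.
    by have := mul_conjc (pi0 0 - 1); rewrite c0 rmorph0 => /eqP; rewrite mulf_eq0 conjc_eq0 orbb.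
  pose dl := Num.sqrt (c * e) / 2.
  have ce0 : 0 < c * e by rewrite mulr_gt0.
  have dl0 : 0 < dl by rewrite divr_gt0 ?sqrtr_gt0.
  have [n0 hn0] := ex_div_small (2 * P%:R) dl0.
  have [M [N [Nn0 hN]]] := ou n0; have [N0 hs] := hn0 N Nn0.
  have := nrm_amean_shift M P (fun n => le1_nrm1 (@le1_unim R S _ (u1 n))) N0.
  have -> : amean (iota 0 N) (fun j => sc S (u (M + P%:Z + j%:Z))) = sc S (pi0 0) * scavg u M N.
    by rewrite /scavg ameanMl; apply: eq_amean => j; rewrite addrAC pE rmorphM.
  rewrite -/(scavg u M N) -{2}[scavg u M N]mul1r -(rmorph1 (sc S)) -mulrBl -rmorphB => hs2.
  have : nrm2 (sc S (pi0 0 - 1) * scavg u M N) <= dl ^+ 2.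
    by apply: nrm_le2; [exact: ltW|exact: le_trans hs2 hs].
  rewrite nrm2_sc -/c /dl expr_div_n sqr_sqrtr ?(ltW ce0)// => h.
  have : c * e <= c * nrm2 (scavg u M N) by rewrite ler_pM2l.
  move: h ce0; have -> : c * e / 2 ^+ 2 = c * e / 4 by field.
  move: (c * e) (c * nrm2 _) => A B; lra.
exists (P ^ d.+1)%N.
  rewrite expn_gt0 P0 /=; apply/leq_expl/leq_expl/leq_mul => //; exact: leq_expl.
apply: pdeg_periodic => // n.
by rewrite pE pi1 mul1r.
Qed.

End Weyl.

(** * Rational independence *)

Section Independence.
Variables (R : realType) (k : nat) (p : 'I_k -> {poly R}).
Hypotheses (hp : forall i, integer_polynomial (p i)) (hind : rationally_independent p).

(** Translating and subtracting lowers the degree of a polynomial. *)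
Lemma pdeg_poly d (q : {poly R}) (z : R[i]) : integer_polynomial q -> (size q <= d.+1)%N -> unim z ->
  pdeg d (fun n => z ^ zeval q n).
Proof.
move=> + + z1; elim: d q => [|d ih] q iq sq /=; first by move=> n; rewrite (zeval_cst n)// .
move=> h; apply: eq_pdeg (ih (shp h q - q) _ _) => [n||].
- rewrite zevalB ?zeval_shp//; last exact: intp_shp.
  rewrite expfzDr ?unim_neq0// /udiff; congr (_ * _).
  by rewrite -invr_expz unimV//; exact: unim_expz.
- by apply: intpB => //; exact: intp_shp.
have [->|q0] := eqVneq q 0; first by rewrite /shp comp_poly0 subr0 size_poly0.
have s : size (shp h q) = size q by rewrite size_shp.
have q0' : shp h q != 0 by rewrite -size_poly_gt0 s size_poly_gt0.
rewrite -ltnS; apply: leq_trans sq; rewrite ltn_neqAle; apply/andP; split.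
  apply/eqP => e; have := (size_sub_same s q0').1; rewrite s => /(_ e).
  by rewrite lead_shp.
by apply: leq_trans (size_polyD _ _) _; rewrite size_polyN s maxnn.
Qed.

Lemma common_denominator (n : nat) (r : 'I_n -> rat) : exists D : nat, (0 < D)%N /\
  exists a : 'I_n -> int, forall i, (a i)%:~R = D%:R * r i.
Proof.
exists (\prod_(i < n) `|denq (r i)|)%N; split.
  by rewrite prodn_gt0// => i; rewrite absz_gt0 denq_neq0.
exists (fun i => numq (r i) * (\prod_(j < n | j != i) `|denq (r j)|)%N%:Z) => i.
rewrite /= [in RHS](bigD1 i)//= intrM natrM -!pmulrn [_ * r i]mulrAC; congr (_ * _).
by rewrite pmulrn absz_denq mulrC -numqE.
Qed.

Definition zmat (n : nat) (i : 'I_k) (m : 'I_n) : int := zeval (p i) m%:Z - zeval (p i) 0.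

(** Rational independence says that the sequences [p i n - p i 0] are linearly
    independent; a combination of finitely many of their values therefore
    isolates one of them. *)
Lemma indep_dual : exists n : nat, forall j, exists D : nat, (0 < D)%N /\
  exists a : 'I_n -> int, forall i, \sum_(m < n) zmat i m * a m = if i == j then D%:Z else 0.
Proof.
pose n := (\max_(i < k) size (p i)).+1; exists n.
pose B : 'M[rat]_(k, n) := \matrix_(i, m) (zmat i m)%:~R.
(* a relation between the rows is a combination of the p i that is constant at more points than its degree *)
have free : row_free B.
  apply/row_freeP; apply/row_freeP; rewrite -kermx_eq0; apply/eqP/row_matrixP => i0.
  set v := row i0 _.
  have vB : v *m B = 0 by rewrite /v -row_mul mulmx_ker row0.
  rewrite row0; clearbody v; apply/eqP; apply: contraT => v0.
  have [D [D0 [c hc]]] := common_denominator (fun i => v 0 i).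
  have cne : exists i, c i != 0.
    apply: contrapT => h; case/eqP: v0; apply/rowP => i; rewrite [RHS]mxE.
    have ci : c i = 0 by apply/eqP; apply: contraT => ci; case: h; exists i.
    have := hc i; rewrite ci => /esym/eqP; rewrite mulf_eq0 pnatr_eq0 -leqn0 leqNgt D0 /=.
    by move/eqP.
  case: (hind cne); exists (\sum_(i < k) p i *~ c i).[0].
  apply/eqP; rewrite -subr_eq0; apply/eqP; set q := _ - _.
  apply: contrapT => /eqP q0.
  have sq : (size q < n)%N.
    rewrite ltnS /q; apply: leq_trans (size_polyD _ _) _; rewrite size_polyN geq_max.
    have s1 : (size (\sum_(i < k) p i *~ c i)%R <= \max_(i < k) size (p i))%N.
      apply: leq_trans (size_sum _ _ _) _; apply/bigmax_leqP => i _.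
      apply: leq_trans (leq_bigmax i); rewrite -mulrzl.
      have -> : (c i)%:~R = ((c i)%:~R : R)%:P by rewrite rmorph_int.
      by rewrite mul_polyC size_scale_leq.
    rewrite s1 /=; apply: leq_trans (size_polyC_leq1 _) _.
    have [i ci] := cne; apply: leq_trans (leq_bigmax i).
    rewrite size_poly_gt0; apply/eqP => pi0.
    apply: (hind (c := fun i' => if i' == i then 1 else 0)); first by exists i; rewrite eqxx.
    exists 0; rewrite (bigD1 i)//= eqxx pi0 mul0rz add0r big1// => i' /negbTE ->.
    by rewrite mulr0z.
  have := max_poly_roots q0 (rs := [seq m%:R | m <- iota 0 n]).
  rewrite size_map size_iota ltnNge (ltnW sq) => h; suff : false by [].
  apply: h; last by rewrite map_inj_uniq ?iota_uniq// => x y /eqP; rewrite eqr_nat => /eqP.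
  apply/allP => _ /mapP[m + ->]; rewrite mem_iota add0n => /andP[_ mn].
  rewrite rootE /q hornerD hornerN hornerC !horner_sum -sumrB.
  have := congr1 (fun M : 'rV[rat]_n => M 0 (Ordinal mn)) vB; rewrite !mxE => e.
  have {}e : \sum_i (c i) * zmat i (Ordinal mn) = 0.
    apply: (@intr_inj rat); rewrite rmorph_sum /= -[RHS](mulr0 D%:R) -[in RHS]e mulr_sumr.
    by apply: eq_bigr => i _; rewrite rmorphM /= hc mxE mulrA.
  have := congr1 (fun x : int => x%:~R : R) e; rewrite rmorph_sum /= => {}e.
  apply/eqP; rewrite -[RHS]e; apply: eq_bigr => i _.
  by rewrite !hornerMz -mulrzBl rmorphM rmorphB /= !zevalE// mulrzl.
case/row_freeP: free => B' BB' j.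
have [D [D0 [a ha]]] := common_denominator (fun m => B' m j).
exists D; split=> //; exists a => i.
apply: (@intr_inj rat); rewrite rmorph_sum /=.
have := congr1 (fun M : 'M[rat]_k => M i j) BB'; rewrite !mxE => e.
transitivity (D%:R * (i == j)%:R : rat); last by case: eqP; rewrite ?mulr1 ?mulr0.
rewrite -e mulr_sumr; apply: eq_bigr => m _.
by rewrite rmorphM /= ha !mxE mulrCA.
Qed.

Variables (S : system R).

Definition phase (l : 'I_k -> R[i]) (A : pred 'I_k) (n : int) := \prod_(i | A i) l i ^ zeval (p i) n.

Lemma unim_phase l A n : (forall i, unim (l i)) -> unim (phase l A n).
Proof. by move=> l1; apply: unim_prod => i _; exact: unim_expz. Qed.

(** If the average is large, a bounded power of the sequence of phases is
    constant; combining its values by the dual family isolates [l j], which is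
    therefore a root of unity of bounded order. *)
Lemma phase_weyl (e : R) : 0 < e -> exists C : nat, forall l, (forall i, unim (l i)) ->
  (exists j, forall q, (0 < q <= C)%N -> l j ^+ q != 1) ->
  exists L, forall M N, (L <= N)%N -> nrm2 (scavg S (phase l xpredT) M N) < e.
Proof.
move=> e0; pose d := \max_(i < k) size (p i).
have [C hC] := weyl S d e0.
have [n hn] := indep_dual.
have /choice[D hD] := hn.
exists (C * \prod_(j < k) D j)%N => l l1 [j hj]; apply: contrapT => nex.
pose u := phase l xpredT.
have u1 : unims u by move=> m; exact: unim_phase.
have udeg : pdeg d u.
  rewrite /u /phase; elim: (index_enum _) => [|i s ih].
    by apply: eq_pdeg (pdeg_cst d (@unim1 R)) => m; rewrite big_nil.
  apply: eq_pdeg (pdegM (pdeg_poly (hp i) _ (l1 i)) ih) => [m|]; first by rewrite big_cons.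
  by apply: leqW; exact: (leq_bigmax (F := fun i => size (p i))).
have [|Q /andP[Q0 QC] hQ] := hC u u1 udeg.
  move=> L; apply: contrapT => h; apply: nex; exists L => M N LN; rewrite ltNge; apply/negP => h'.
  by apply: h; exists M, N.
have [D0 [a ha]] := hD j.
have /hj/eqP : (0 < Q * D j <= C * \prod_(j < k) D j)%N.
  rewrite muln_gt0 Q0 D0 /= leq_mul// (bigD1 j)//= leq_pmulr// prodn_gt0// => i.
  by case: (hD i).
apply; have uQ m : (u m * (u 0)^-1) ^+ Q = 1.
  by rewrite exprMn exprVn hQ divff// expf_neq0// unim_neq0.
have uE (m : 'I_n) : u m%:Z * (u 0)^-1 = \prod_i l i ^ zmat i m.
  rewrite /u /phase -prodfV -big_split; apply: eq_bigr => i _ /=.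
  by rewrite /zmat expfzDr ?unim_neq0// invr_expz.
transitivity (\prod_(m < n) (u m%:Z * (u 0)^-1) ^ (Q%:Z * a m)); last first.
  by rewrite big1// => m _; rewrite -exprz_exp -exprnP uQ exp1rz.
rewrite (eq_bigr (fun m : 'I_n => \prod_i l i ^ (Q%:Z * (zmat i m * a m)))); last first.
  move=> m _; rewrite uE.
  have aux (x : int) : (\prod_i l i ^ zmat i m) ^ x = \prod_i l i ^ (x * zmat i m).
    elim/big_rec2: _ => [|i y1 y2 _ <-]; first by rewrite exp1rz.
    rewrite expfzMl; congr (_ * _); by rewrite exprz_exp mulrC.
  by rewrite aux; apply: eq_bigr => i _; congr (_ ^ _); ring.
rewrite exchange_big /= (bigD1 j)//= [X in _ * X]big1 ?mulr1; last first.
  move=> i /negbTE ij.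
  have aux (s : seq 'I_n) : \prod_(m <- s) l i ^ (Q%:Z * (zmat i m * a m)) = l i ^ (Q%:Z * \sum_(m <- s) zmat i m * a m).
    elim: s => [|m s ih]; first by rewrite !big_nil mulr0.
    by rewrite !big_cons ih mulrDr expfzDr ?unim_neq0.
  by rewrite aux ha ij mulr0.
have aux (s : seq 'I_n) : \prod_(m <- s) l j ^ (Q%:Z * (zmat j m * a m)) = l j ^ (Q%:Z * \sum_(m <- s) zmat j m * a m).
  elim: s => [|m s ih]; first by rewrite !big_nil mulr0.
  by rewrite !big_cons ih mulrDr expfzDr ?unim_neq0.
by rewrite aux ha eqxx -PoszM.
Qed.

End Independence.

(** * Averages along independent polynomials *)

Section Main.
Variables (R : realType) (S : system R) (k : nat) (p : 'I_k -> {poly R}).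
Hypotheses (hp : forall i, integer_polynomial (p i)) (hind : rationally_independent p).
Variables (V : set_system nat) (hV : UltraFilter V) (Vinf : eventually `<=` V).
Implicit Types (A : {set 'I_k}) (l : 'I_k -> R[i]) (f : 'I_k -> S) (F G X : S).

Definition upd (T : Type) (f : 'I_k -> T) (m : 'I_k) (g : T) : 'I_k -> T :=
  fun i => if i == m then g else f i.

(** Averages in which the functions outside [A] have been replaced by
    characters. *)
Definition mavg A l f M N : S := amean (iota 0 N) (fun j =>
  sc S (phase p l (fun i => i \notin A) (M + j%:Z)) *
  \prod_(i in A) U S (zeval (p i) (M + j%:Z)) (f i)).

Lemma le1_mavg A l f M N : (forall i, unim (l i)) -> (forall i, le1 (f i)) -> le1 (mavg A l f M N).
Proof.
move=> l1 f1; apply: le1_amean => j; apply: le1M; first exact/le1_unim/unim_phase.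
by apply: le1_prod => i _; exact: le1U.
Qed.

Lemma phase_upd A l m w n : m \in A ->
  phase p (upd l m w) (fun i => i \notin A :\ m) n = w ^ zeval (p m) n * phase p l (fun i => i \notin A) n.
Proof.
move=> mA; rewrite /phase (bigD1 m) /=; last by rewrite !inE eqxx.
rewrite {1}/upd eqxx; congr (_ * _).
rewrite (eq_bigl (fun i => i \notin A)) => [|i]; last first.
  by rewrite !inE negb_and negbK; case: eqVneq => //= [->|]; rewrite ?mA ?andbT.
apply: eq_bigr => i iA; rewrite /upd; case: eqVneq => // e.
by rewrite e mA in iA.
Qed.

Lemma prod_split A f m n : m \in A ->
  \prod_(i in A) U S (zeval (p i) n) (f i) =
  U S (zeval (p m) n) (f m) * \prod_(i in A :\ m) U S (zeval (p i) n) (f i).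
Proof.
move=> mA; rewrite (bigD1 m)//=; congr (_ * _); apply: eq_bigl => i.
by rewrite !inE andbC.
Qed.

Lemma prod_upd A f m G n : \prod_(i in A :\ m) U S (zeval (p i) n) (upd f m G i) =
  \prod_(i in A :\ m) U S (zeval (p i) n) (f i).
Proof. by apply: eq_bigr => i; rewrite !inE /upd => /andP[/negbTE ->]. Qed.

Lemma eqv_amean (I : Type) (s : seq I) (v w : I -> S) :
  (forall x, eqv (v x) (w x)) -> eqv (amean s v) (amean s w).
Proof.
move=> h; rewrite /eqv -ameanB /null; apply/eqP; rewrite eq_le nrm_ge0 andbT.
apply: le_trans (nrm_amean _ _) _; apply: mean_le => // x; by rewrite (h x).
Qed.

(** An eigenfunction in place of the function at [m] comes out of the average
    and leaves the character of its eigenvalue. *)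
Lemma mavg_eigen A l f m w X M N : m \in A -> eigen w X ->
  eqv (mavg A l (upd f m X) M N) (X * mavg (A :\ m) (upd l m w) f M N).
Proof.
move=> mA wX; rewrite /mavg ameanMl; apply: eqv_amean => j; set n := M + _.
rewrite (prod_split _ _ mA) {1}/upd eqxx prod_upd phase_upd// (rmorphM (sc S)).
have e : eqv (U S (zeval (p m) n) X) (sc S (w ^ zeval (p m) n) * X) by exact: eigen_int.
set ph := sc S (phase _ _ _ _); set pr := \prod_(i in _) _.
have -> : X * (sc S (w ^ zeval (p m) n) * ph * pr) = ph * ((sc S (w ^ zeval (p m) n) * X) * pr) by ring.
by apply: eqvM; [exact: eqv_refl|apply: eqvM => //; exact: eqv_refl].
Qed.

(** Averages that carry a character of large order are small. *)
Definition SA A := forall e : R, 0 < e -> exists C : nat, forall l f,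
  (forall i, unim (l i)) -> (forall i, le1 (f i)) ->
  (exists2 j, j \notin A & forall q, (0 < q <= C)%N -> l j ^+ q != 1) ->
  exists L, forall M N, (L <= N)%N -> nrm2 (mavg A l f M N) < e.

(** Orthogonality to the functions with some period [r], which generate the
    rational Kronecker factor. *)
Definition rational_free G := forall r g, (0 < r)%N -> eqv (U S r%:Z g) g -> ip G g = 0.

(** Averages that carry a function orthogonal to the periodic ones tend to 0. *)
Definition SF A j := forall e : R, 0 < e -> forall l f,
  (forall i, unim (l i)) -> (forall i, le1 (f i)) -> rational_free (f j) ->
  exists L, forall M N, (L <= N)%N -> nrm2 (mavg A l f M N) < e.

Lemma nonconstant_indep : (forall i, (1 < size (p i))%N) /\
  (forall i j, i != j -> (1 < size (p i - p j)%R)%N).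
Proof.
split=> [i|i j ij]; rewrite ltnNge; apply/negP => /size1_polyC e.
  apply: (hind (c := fun i' => if i' == i then 1 else 0)); first by exists i; rewrite eqxx.
  exists (p i)`_0; rewrite (bigD1 i)//= eqxx mulr1z big1 ?addr0// => i' /negbTE ->.
  by rewrite mulr0z.
apply: (hind (c := fun i' => if i' == i then 1 else if i' == j then -1 else 0)).
  by exists i; rewrite eqxx.
exists (p i - p j)`_0; rewrite -e (bigD1 i)//= eqxx mulr1z; congr (_ + _).
rewrite (bigD1 j)//=; last by rewrite eq_sym.
rewrite eq_sym (negbTE ij) eqxx mulrNz mulr1z big1 ?addr0// => i' /andP[/negbTE -> /negbTE ->].
by rewrite mulr0z.
Qed.

Lemma boxnorm_nseq s Hs F : size Hs = s -> all (leq 1) Hs ->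
  boxnorm (nseq s (\prod_(x <- Hs) x)%N) F <= boxnorm Hs F.
Proof.
move=> sHs Hs0; apply: boxnorm_mono; set H := (\prod_(x <- _) _)%N.
have H0 : (0 < H)%N by rewrite /H big_seq; apply: prodn_cond_gt0 => x /(allP Hs0).
have : {in Hs, forall x, (x %| H)%N} by move=> x xs; rewrite /H (big_rem x)//= dvdn_mulr.
rewrite -sHs; elim: (Hs) => //= x t ih hx; rewrite hx ?mem_head// H0 /=; apply: ih => y ys.
by apply: hx; rewrite inE ys orbT.
Qed.

Lemma boxnorm_raises s H F d (x : R) : (0 < H)%N -> 0 <= x -> x <= boxnorm (nseq s H) F ->
  x ^+ (2 ^ d) <= boxnorm (nseq (s + d) H) F.
Proof.
move=> H0 x0 h; elim: d => [|d ih]; first by rewrite expr1 addn0.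
rewrite expnSr exprM addnS; apply: le_trans (_ : boxnorm (nseq (s + d) H) F ^+ 2 <= _).
  by rewrite ler_pXn2r ?nnegrE ?exprn_ge0 ?(le_trans _ ih) ?exprn_ge0.
have -> : nseq (s + d).+1 H = rcons (nseq (s + d) H) H.
  by elim: (s + d)%N => //= n {1}->.
exact: boxnorm_raise.
Qed.

Section Core.
Variables (A : {set 'I_k}) (m : 'I_k) (mA : m \in A).

(** The functions that define the dual function are again averages; a cube of
    them, tested against an eigenfunction, is an average with the eigenvalue as
    the character of [p m]. *)
Lemma decorrelates_SA l f (M : nat -> int) (N : nat -> nat) (g : nat -> S) t (e : R) C :
  (0 < t)%N -> 0 < e -> (forall i, unim (l i)) -> (forall i, le1 (f i)) -> (forall n, (n <= N n)%N) ->
  (forall n, le1 (g n)) ->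
  (forall l f, (forall i, unim (l i)) -> (forall i, le1 (f i)) ->
    (exists2 j, j \notin A :\ m & forall q, (0 < q <= C)%N -> l j ^+ q != 1) ->
    exists L, forall M N, (L <= N)%N -> nrm2 (mavg (A :\ m) l f M N) < e ^+ 2) ->
  decorrelates (fun n j => U S (- zeval (p m) (M n + j%:Z))
    (star S (sc S (phase p l (fun i => i \notin A) (M n + j%:Z)) *
       \prod_(i in A :\ m) U S (zeval (p i) (M n + j%:Z)) (f i)) * g n)) N t e C.
Proof.
move=> t0 e0 l1 f1 hN g1 hC h h' X w sh sh' X1 wX ord.
pose l' := upd (fun=> 1) m w; pose f' i := star S (cube h h' (f i)).
have l'1 i : unim (l' i) by rewrite /l' /upd; case: eqP => // _; [exact: wX.1|exact: unim1].
have f'1 i : le1 (f' i) by exact/le1_star/le1_cube.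
have [|L hL] := hC l' f' l'1 f'1.
  by exists m; rewrite ?inE ?eqxx// => q /ord; rewrite /l' /upd eqxx.
exists L => n Ln; have NL := leq_trans Ln (hN n).
apply: le_trans (_ : nrm (mavg (A :\ m) l' f' (M n) (N n)) <= _); last first.
  rewrite -(@ler_pXn2r _ 2) ?nnegrE ?nrm_ge0 ?(ltW e0)// nrmE; exact/ltW/hL.
have cg1 : le1 (X * cube h h' (g n)) by apply: le1M => //; exact: le1_cube.
apply: le_trans (le1_tauM _ cg1); rewrite /mavg ameanMl tau_amean.
rewrite le_eqVlt; apply/orP; left; apply/eqP; apply: eq_mean => j; set i0 := M n + _.
rewrite cubeU -(tauU (zeval (p m) i0)) rmorphM /= UK phase_upd//.
have -> : phase p (fun=> 1) (fun i => i \notin A) i0 = 1.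
  by rewrite /phase big1// => i _; rewrite exp1rz.
rewrite (eqv_tau (eqvM (eigen_int _ wX) (eqv_refl _))); congr (tau S _).
rewrite cubeM cube_star cubeM cube_unim ?mul1r; last first.
- by rewrite sh sh'.
- by case: (h) sh t0 => // <-.
- exact: unim_phase.
rewrite cube_prod rmorph_prod mulr1 /=.
rewrite [\prod_(i in A :\ m) star S _](_ : _ = \prod_(i in A :\ m) U S (zeval (p i) i0) (f' i)); first by ring.
by apply: eq_bigr => i _; rewrite /f' cubeU U_star.
Qed.

(** Degree lowering from an arbitrary degree down to the second one, where
    eigenfunctions become visible. *)
Lemma lower_to_two : SA (A :\ m) -> forall t (eta : R), 0 < eta -> exists2 eta2 : R, 0 < eta2 &
  forall l f (M : nat -> int) (N : nat -> nat) (g : nat -> S) F,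
  (forall i, unim (l i)) -> (forall i, le1 (f i)) -> (forall n, (n < N n)%N) ->
  (forall n, le1 (g n)) -> le1 F ->
  (forall h, ucvg V (fun n => ip h (amean (iota 0 (N n)) (fun j => U S (- zeval (p m) (M n + j%:Z))
    (star S (sc S (phase p l (fun i => i \notin A) (M n + j%:Z)) *
       \prod_(i in A :\ m) U S (zeval (p i) (M n + j%:Z)) (f i)) * g n)))) (ip h F)) ->
  NS t.+2 eta F -> NS 2 eta2 F.
Proof.
move=> hSA; elim=> [|t ih] eta eta0; first by exists eta.
have [e1 e10 h1] := lowering S hV Vinf (ltn0Sn t) eta0.
have [C hC] := hSA _ (exprn_gt0 2 e10).
have [eta' eta'0 heta'] := h1 C; have [eta2 eta20 h2] := ih _ eta'0.
exists eta2 => // l f M N g F l1 f1 hN g1 F1 wk hF.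
apply: (h2 l f M N g F) => //; apply: (heta' F _ N F1 _ _ wk) => //.
- move=> n j; apply/le1U/le1M => //; apply/le1_star/le1M; first exact/le1_unim/unim_phase.
  by apply: le1_prod => i _; exact: le1U.
- by move=> n; exact: leq_ltn_trans (hN n).
by apply: decorrelates_SA => // n; exact/ltnW/hN.
Qed.

(** Suppose that the averages stay large.  Replacing the function at [m] by the
    dual function [F], the weak limit of the averages solved for that function,
    keeps them large; polynomial exhaustion bounds a box norm of [F] from below,
    degree lowering brings it down to the second one, and that one gives an
    eigenfunction correlated with [F].  By definition of [F] this eigenfunction
    may take the place of the function at [m]. *)
Lemma core : SA (A :\ m) -> forall e : R, 0 < e -> exists2 c : R, 0 < c &
  forall l f (M : nat -> int) (N : nat -> nat), (forall i, unim (l i)) -> (forall i, le1 (f i)) ->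
  (forall n, (n < N n)%N) -> (forall n, e <= nrm2 (mavg A l f (M n) (N n))) ->
  exists X w, [/\ eigen w X, le1 X & forall K, exists2 n, (K <= n)%N &
    c <= ip (mavg A l (upd f m X) (M n) (N n)) (mavg A l f (M n) (N n))].
Proof.
move=> hSA e e0; pose e' : R := (e ^+ 2 / 2) ^+ 2.
have e'0 : 0 < e' by rewrite exprn_gt0// divr_gt0// exprn_gt0.
have [nc1 nc2] := nonconstant_indep.
pose P := [seq p i | i <- enum (A :\ m)].
have [mm hmm] : exists mm, forall H, (0 < H)%N -> exists L, forall N M c F Q, (L <= N)%N ->
    (forall n, unim (c n)) -> le1 F -> map fst Q = P -> {in Q, forall x, le1 x.2} ->
    e' <= nrm2 (polyavg c (p m) F Q M N) -> controls mm H F.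
  apply: (@controlled_poly R S (p m) P) => //.
  - by move=> q; rewrite inE => /predU1P[->//|]; rewrite /P => /mapP[i _ ->].
  - move=> q qP; have [i + ->] : exists2 i, i \in enum (A :\ m) & q = p i by apply/mapP.
    rewrite mem_enum !inE => /andP[im _]; apply: nc2.
    by rewrite eq_sym.
(* the lower bound of controls, raised to order mm by squaring *)
pose x : R := mm.+1%:R^-1.
have x0 : 0 < x by rewrite invr_gt0.
have x1 : x <= 1 by rewrite invf_le1// ler1n.
pose eta := x ^+ (2 ^ mm).
have eta0 : 0 < eta by rewrite exprn_gt0.
have [eta2 eta20 heta2] := lower_to_two hSA mm.-2 eta0.
exists (Num.sqrt eta2 / 2 / 2); first by rewrite !divr_gt0 ?sqrtr_gt0.
move=> l f M N l1 f1 hN he.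
pose g n := mavg A l f (M n) (N n).
have g1 n : le1 (g n) by exact: le1_mavg.
pose cf n j := sc S (phase p l (fun i => i \notin A) (M n + j%:Z)) *
   \prod_(i in A :\ m) U S (zeval (p i) (M n + j%:Z)) (f i).
have cf1 n j : le1 (cf n j).
  apply: le1M; first exact/le1_unim/unim_phase.
  by apply: le1_prod => i _; exact: le1U.
pose psi n (j : nat) := U S (- zeval (p m) (M n + j%:Z)) (star S (cf n j) * g n).
have [F F1 wk] := weak_limit hV (F := fun n => amean (iota 0 (N n)) (psi n))
  (fun n => le1_amean _ (fun j => le1U _ (le1M (le1_star (cf1 n j)) (g1 n)))).
have ipE n X : ip X (amean (iota 0 (N n)) (psi n)) = ip (mavg A l (upd f m X) (M n) (N n)) (g n).
  rewrite ip_ameanr /mavg ip_ameanl; apply: eq_mean => j.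
  rewrite /psi /ip -U_star rmorphM /= starK -[LHS](tauU (zeval (p m) (M n + j%:Z))) rmorphM /= UK.
  rewrite (prod_split _ _ mA) {1}/upd eqxx prod_upd /cf; congr (tau S _); ring.
have updm n : mavg A l (upd f m (f m)) (M n) (N n) = g n.
  apply: eq_amean => j; congr (_ * _); apply: eq_bigr => i _.
  by rewrite /upd; case: eqP => // ->.
have fF : e <= ip (f m) F.
  apply: (ucvg_le hV (ucvg_cst hV e) (wk (f m))) => n.
  by rewrite ipE updm; exact: he.
have nF : e <= nrm F.
  by apply: le_trans fF _; apply: le_trans (CS_le _ _) _; rewrite ler_piMl ?nrm_ge0 ?le1_nrm1.
have nF2 : e ^+ 2 <= ip F F by rewrite ipff -nrmE ler_pXn2r ?nnegrE ?nrm_ge0 ?(ltW e0).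
(* the averages with F at m are large along the ultrafilter *)
have oft : V [set n | e' <= nrm2 (mavg A l (upd f m F) (M n) (N n))].
  have e2 : 0 < e ^+ 2 / 2 by rewrite divr_gt0 ?exprn_gt0.
  apply: filterS (wk F _ e2) => n /=; rewrite ipE ltr_norml => /andP[h _].
  rewrite /e' -nrmE ler_pXn2r ?nnegrE ?nrm_ge0 ?(ltW e2)//.
  have := CS_le (mavg A l (upd f m F) (M n) (N n)) (g n).
  have : nrm (mavg A l (upd f m F) (M n) (N n)) * nrm (g n) <= nrm (mavg A l (upd f m F) (M n) (N n)).
    by rewrite ler_piMr ?nrm_ge0 ?le1_nrm1.
  lra.
have ctl H : (0 < H)%N -> controls mm H F.
  move=> H0; have [L hL] := hmm H H0; have [n /= hn Ln] := V_ex hV Vinf L oft.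
  apply: (hL (N n) (M n) (phase p l (fun i => i \notin A)) F [seq (p i, f i) | i <- enum (A :\ m)]) => //.
  - by apply: leq_trans Ln _; exact/ltnW/hN.
  - by move=> j; exact: unim_phase.
  - by rewrite -map_comp.
  - move=> y yQ; have [i _ ->] : exists2 i, i \in enum (A :\ m) & y = (p i, f i) by apply/mapP.
    exact: f1.
  apply: le_trans hn _; rewrite le_eqVlt; apply/orP; left; apply/eqP; congr nrm2.
  apply: eq_amean => j; rewrite (prod_split _ _ mA) {1}/upd eqxx prod_upd mulrA; congr (_ * _).
  by rewrite /polyprod big_map big_enum.
have mm2 : (2 <= mm)%N by have [s /andP[s2 sm] _] := ctl 1%N isT; exact: leq_trans sm.
have hNS : NS mm eta F.
  move=> Hs sHs Hs0; apply: le_trans (boxnorm_nseq F sHs Hs0).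
  set H := (\prod_(y <- _) _)%N.
  have H0 : (0 < H)%N by rewrite /H big_seq; apply: prodn_cond_gt0 => y /(allP Hs0).
  have [s /andP[s2 sm] hs] := ctl H H0.
  have := boxnorm_raises (mm - s) H0 (ltW x0) hs; rewrite subnKC// => h.
  apply: le_trans h; rewrite /eta ler_wiXn2l// ?(ltW x0)// leq_exp2l// leq_subr//.
have h2 : NS 2 eta2 F.
  apply: (heta2 l f M N g F) => //.
  by case: (mm) mm2 hNS => [|[|mm']].
have [X [w [w1 XX Xw hX]]] := eigenfunction hV Vinf eta20 F1 (fun H J H0 J0 => h2 [:: H; J] erefl
  (introT and3P (And3 H0 J0 isT))).
exists (star S X), (conjc w); split.
- by apply: eigen_star; split.
- by apply/le1_star/le1_eqv_iso.
have c0 : 0 < Num.sqrt eta2 / 2 / 2 by rewrite !divr_gt0 ?sqrtr_gt0.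
have := wk (star S X) _ c0 => hw K.
have [n /= hn Kn] := V_ex hV Vinf K hw.
exists n => //; rewrite -/(g n) -ipE; move: hn; rewrite ltr_norml => /andP[hn _].
have : ip (star S X) F = tau S (F * X) by rewrite /ip -rmorphM tau_star mulrC.
lra.
Qed.

End Core.

Lemma often_seq (P : int -> nat -> Prop) : ~ (exists L, forall M N, (L <= N)%N -> P M N) ->
  exists M N, forall n : nat, (n < N n)%N /\ ~ P (M n) (N n).
Proof.
move=> h; have /choice[MN hMN] : forall n : nat, exists x : int * nat, (n < x.2)%N /\ ~ P x.1 x.2.
  move=> n; apply: contrapT => h'; apply: h; exists n.+1 => M N nN; apply: contrapT => hP.
  by apply: h'; exists (M, N).
by exists (fun n => (MN n).1), (fun n => (MN n).2) => n; exact: hMN.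
Qed.

Lemma often_eigen A m l f X w (c : R) M N : m \in A -> (forall i, unim (l i)) -> (forall i, le1 (f i)) ->
  eigen w X -> le1 X -> 0 < c -> c <= ip (mavg A l (upd f m X) M N) (mavg A l f M N) ->
  c ^+ 2 <= nrm2 (mavg (A :\ m) (upd l m w) f M N).
Proof.
move=> mA l1 f1 wX X1 c0 h; rewrite -nrmE ler_pXn2r ?nnegrE ?nrm_ge0 ?(ltW c0)//.
apply: le_trans h _; apply: le_trans (CS_le _ _) _.
apply: le_trans (_ : nrm (mavg A l (upd f m X) M N) <= _).
  by rewrite ler_piMr ?nrm_ge0// le1_nrm1//; exact: le1_mavg.
by rewrite (eqv_nrm (mavg_eigen l f M N mA wX)); exact: le1_nrm.
Qed.

Lemma unim_upd l m w : (forall i, unim (l i)) -> unim w -> forall i, unim (upd l m w i).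
Proof. by move=> l1 w1 i; rewrite /upd; case: eqP. Qed.

(** By induction on the number of functions: the eigenfunction supplied by
    [core] becomes one more character. *)
Lemma SA_all A : SA A.
Proof.
move: {2}#|A| (erefl #|A|) => n; elim: n A => [|n ih] A.
  move=> /eqP; rewrite cards_eq0 => /eqP-> e e0.
  have [C hC] := phase_weyl hp hind S e0; exists C => l f l1 f1 [j _ hj].
  have [|L hL] := hC l l1; first by exists j.
  exists L => M N LN; have := hL M N LN; congr (nrm2 _ < _).
  apply: eq_amean => i; rewrite big_set0 mulr1; congr (sc S _).
  by apply: eq_bigl => i' /=; rewrite inE.
move=> cA e e0; have [m mA] : exists m, m \in A by apply/set0Pn; rewrite -card_gt0 cA.
have cAm : #|A :\ m| = n by have := cardsD1 m A; rewrite mA cA => -[].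
have hSA := ih _ cAm.
have [c c0 hc] := core mA hSA e0.
have [C hC] := hSA _ (exprn_gt0 2 c0); exists C => l f l1 f1 [j jA hj].
apply: contrapT => /often_seq[M [N hMN]].
have [|n'|X [w [wX X1 hX]]] := hc l f M N l1 f1.
- by move=> n'; exact: (hMN n').1.
- by rewrite leNgt; apply/negP; exact: (hMN n').2.
have jm : j != m by apply: contraNneq jA => ->.
have [|L hL] := hC (upd l m w) f (unim_upd m l1 wX.1) f1.
  exists j => [|q /hj]; first by rewrite !inE negb_and jA orbT.
  by rewrite /upd (negbTE jm).
have [n' Ln' h] := hX L.
have := often_eigen mA l1 f1 wX X1 c0 h; rewrite leNgt hL//.
by apply: leq_trans Ln' _; exact/ltnW/(hMN n').1.
Qed.

(** The functions other than the one at [j] are exchanged for characters in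
    turn.  When it is the only one left, the eigenfunction correlated with it
    has an eigenvalue of bounded order, since otherwise the average would be
    small; so it is periodic, which contradicts orthogonality. *)
Lemma SF_all A j : j \in A -> SF A j.
Proof.
move: {2}#|A| (erefl #|A|) => n; elim: n A => [|n ih] A cA jA.
  by move: jA; rewrite (cards0_eq cA) inE.
move=> e e0 l f l1 f1 fj; apply: contrapT => /often_seq[M [N hMN]].
have hN n' : (n' < N n')%N by exact: (hMN n').1.
have he n' : e <= nrm2 (mavg A l f (M n') (N n')) by rewrite leNgt; apply/negP; exact: (hMN n').2.
have [/existsP[m /andP[mA mj]]|/existsPn hA] := boolP [exists m, (m \in A) && (m != j)].
  have cAm : #|A :\ m| = n by have := cardsD1 m A; rewrite mA cA => -[].
  have [c c0 hc] := core mA (SA_all (A :\ m)) e0.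
  have [X [w [wX X1 hX]]] := hc l f M N l1 f1 hN he.
  have [|L hL] := ih (A :\ m) cAm _ _ (exprn_gt0 2 c0) (upd l m w) f (unim_upd m l1 wX.1) f1 fj.
    by rewrite !inE eq_sym mj.
  have [n' Ln' h] := hX L.
  have := often_eigen mA l1 f1 wX X1 c0 h; rewrite leNgt hL//.
  by apply: leq_trans Ln' _; exact/ltnW/hN.
have Aj : A = finset.set1 j.
  by apply/setP => i; rewrite finset.in_set1; have := hA i; case: eqP => [->|_]; rewrite ?jA// andbT => /negbTE.
have [c c0 hc] := core jA (SA_all (A :\ j)) e0.
have [X [w [wX X1 hX]]] := hc l f M N l1 f1 hN he.
have [C hC] := SA_all (A :\ j) (exprn_gt0 2 c0).
have [q /andP[q0 _] wq] : exists2 q, (0 < q <= C)%N & w ^+ q = 1.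
  apply: contrapT => nq.
  have [|L hL] := hC (upd l j w) f (unim_upd j l1 wX.1) f1.
    exists j; rewrite ?inE ?eqxx// => q hq; rewrite /upd eqxx; apply/eqP => wq.
    by apply: nq; exists q.
  have [n' Ln' h] := hX L.
  have := often_eigen jA l1 f1 wX X1 c0 h; rewrite leNgt hL//.
  by apply: leq_trans Ln' _; exact/ltnW/hN.
have [n' _] := hX 0%N.
suff -> : ip (mavg A l (upd f j X) (M n') (N n')) (mavg A l f (M n') (N n')) = 0 by rewrite leNgt c0.
rewrite /mavg ip_ameanl /mean big1 ?mulr0// => a _; rewrite ip_ameanr /mean big1 ?mulr0// => b _.
rewrite Aj !big_set1 /upd eqxx.
set x := phase _ _ _ _; set y := phase _ _ _ _; set s := zeval _ _; set t := zeval _ _.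
pose g := sc S (x * conjc y) * U S (s - t) X.
transitivity (ip g (f j)).
  rewrite /ip /g -[RHS](tauU t) !rmorphM /= !star_sc !U_sc -UD U_star addrC subrK.
  by congr (tau S _); ring.
rewrite ip_sym; apply: (fj q) => //.
rewrite /g rmorphM /= U_sc UC; apply: eqvM; first exact: eqv_refl.
by apply: eqvU; have := eigen_nat q wX; rewrite wq rmorph1 mul1r.
Qed.

End Main.

(** * Replacing the functions one at a time *)

Section Averages.
Variables (R : realType) (S : system R) (k : nat) (p : 'I_k -> {poly R}).
Hypotheses (hp : forall i, integer_polynomial (p i)) (hind : rationally_independent p).
Implicit Types (u v w : 'I_k -> S).

Definition pavg w (M : int) (N : nat) : S := amean (iota 0 N) (fun j =>
  \prod_i U S (zeval (p i) (M + j%:Z)) (w i)).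

Lemma U_rsM n r f : U S n (rs S r * f) = rs S r * U S n f.
Proof. by rewrite rmorphM /= U_rs. Qed.

Lemma ex_scale f : exists2 s : R, 0 < s & le1 (rs S s * f).
Proof.
have [c c0 hc] := bounded_alg f; have sc0 : 0 < Num.sqrt c by rewrite sqrtr_gt0.
exists (Num.sqrt c)^-1; first by rewrite invr_gt0.
move=> g; rewrite -mulrA nrm2Z exprVn sqr_sqrtr ?(ltW c0)// ler_pdivrMl//.
exact: hc.
Qed.

Lemma pavg_scale (s : 'I_k -> R) w M N :
  pavg (fun i => rs S (s i) * w i) M N = rs S (\prod_i s i) * pavg w M N.
Proof.
rewrite /pavg ameanMl; apply: eq_amean => j.
rewrite {2}/rs !rmorph_prod -big_split; apply: eq_bigr => i _; exact: U_rsM.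
Qed.

(** Functions are first scaled to contractions, since the abstract estimate
    concerns those only. *)
Lemma pavg_free w j : rational_free (w j) -> forall e : R, 0 < e ->
  exists L, forall M N, (L <= N)%N -> nrm2 (pavg w M N) < e.
Proof.
move=> wj e e0; have /choice[s hs] i : exists s : R, 0 < s /\ le1 (rs S s * w i).
  by have [s s0 hs] := ex_scale (w i); exists s.
have s0 : 0 < \prod_i s i by apply: prodr_gt0 => i _; exact: (hs i).1.
have [V [hV Vinf]] := ultraFilterLemma (@eventually_filter).
have [] := @SF_all R S k p hp hind V hV Vinf [set: 'I_k]%SET j (finset.in_setT j)
  ((\prod_i s i) ^+ 2 * e) _ (fun=> 1) (fun i => rs S (s i) * w i) (fun=> @unim1 R) (fun i => (hs i).2).
- by rewrite mulr_gt0// exprn_gt0.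
- by move=> r g r0 rg; rewrite ipZl (wj r g)// mulr0.
move=> L hL; exists L => M N LN; rewrite -(ltr_pM2l (exprn_gt0 2 s0)) -nrm2Z -pavg_scale.
have := hL M N LN; congr (nrm2 _ < _); apply: eq_amean => i.
rewrite /phase big_pred0 => [|i']; last by rewrite finset.in_setT.
by rewrite rmorph1 mul1r; apply: eq_bigl => i'; rewrite finset.in_setT.
Qed.

Lemma prod_telescope (A : comPzRingType) (a b : 'I_k -> A) :
  \prod_i a i - \prod_i b i =
  \sum_(j < k) \prod_(i < k) (if (i < j)%N then b i else if i == j then a i - b i else a i).
Proof.
pose H n := \prod_(i < k) (if (i < n)%N then b i else a i).
have -> : \prod_i a i = H 0%N by apply: eq_bigr.
have -> : \prod_i b i = H k by apply: eq_bigr => i _; rewrite ltn_ord.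
rewrite -opprB -(telescope_sumr _ (leq0n k)) big_mkord -sumrN; apply: eq_bigr => j _.
rewrite opprB /H !(bigD1 j (P := xpredT))//= ltnn leqnn eqxx.
set x := \prod_(i | _) _; set y := \prod_(i | _) _; set z := \prod_(i | _) _.
have xz : z = x.
  by apply: eq_bigr => i ij; rewrite (negbTE ij).
have yz : y = x.
  apply: eq_bigr => i ij; rewrite ltnS leq_eqVlt.
  by rewrite (_ : (i == j :> nat) = false)//; apply/negbTE.
by rewrite yz xz mulrBl.
Qed.

(** Replacing the functions one at a time leaves averages in which one of
    them is a difference [u j - v j]. *)
Lemma pavg_sub u v : (forall j, rational_free (u j - v j)) -> forall e : R, 0 < e ->
  exists L, forall M N, (L <= N)%N -> nrm2 (pavg u M N - pavg v M N) < e.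
Proof.
move=> uv e e0.
pose w (j i : 'I_k) := if (i < j)%N then v i else if i == j then u i - v i else u i.
have wE M N : pavg u M N - pavg v M N = \sum_j pavg (w j) M N.
  rewrite /pavg -ameanB /amean -mulr_sumr exchange_big; congr (_ * _); apply: eq_bigr => x _ /=.
  rewrite prod_telescope; apply: eq_bigr => j _; apply: eq_bigr => i _.
  by rewrite /w; case: ifP => // _; case: ifP => // _; rewrite rmorphB.
pose t : R := Num.sqrt e / k.+1%:R.
have t0 : 0 < t by rewrite divr_gt0// sqrtr_gt0.
have /choice[L hL] j : exists L, forall M N, (L <= N)%N -> nrm2 (pavg (w j) M N) < t ^+ 2.
  by apply: (@pavg_free _ j); rewrite ?exprn_gt0// /w ltnn eqxx.
exists (\max_j L j)%N => M N LN; rewrite wE -nrmE -[e]sqr_sqrtr ?(ltW e0)//.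
rewrite ltr_pXn2r ?nnegrE ?nrm_ge0 ?sqrtr_ge0//.
have sum_le : nrm (\sum_j pavg (w j) M N) <= \sum_(j < k) t.
  have : forall s : seq 'I_k, nrm (\sum_(j <- s) pavg (w j) M N) <= \sum_(j <- s) t.
    elim=> [|j s ih]; first by rewrite !big_nil nrm0.
    rewrite !big_cons; apply: le_trans (nrmD _ _) _; apply: lerD ih.
    apply: nrm2_le_sqr (ltW t0) (ltW (hL j M N _)).
    by apply: leq_trans LN; exact: leq_bigmax.
  exact.
apply: le_lt_trans sum_le _; rewrite sumr_const card_ord -mulr_natr.
by rewrite /t -mulrA gtr_pMr ?sqrtr_gt0// ltr_pdivrMl// mulr1 ltr_nat.
Qed.

End Averages.

(** * Bounded measurable functions *)

Section ComplexParts.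
Variable R : realType.
Implicit Types z w : R[i].

Local Notation Re := (@complex.Re R).
Local Notation Im := (@complex.Im R).

Lemma Re_add z w : Re (z + w) = Re z + Re w. Proof. by case: z; case: w. Qed.
Lemma Im_add z w : Im (z + w) = Im z + Im w. Proof. by case: z; case: w. Qed.
Lemma Re_opp z : Re (- z) = - Re z. Proof. by case: z. Qed.
Lemma Im_opp z : Im (- z) = - Im z. Proof. by case: z. Qed.
Lemma Re_mul z w : Re (z * w) = Re z * Re w - Im z * Im w. Proof. by case: z; case: w. Qed.
Lemma Im_mul z w : Im (z * w) = Re z * Im w + Im z * Re w. Proof. by case: z; case: w. Qed.
Lemma Re_conj z : Re (conjc z) = Re z. Proof. by case: z. Qed.
Lemma Im_conj z : Im (conjc z) = - Im z. Proof. by case: z. Qed.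

End ComplexParts.

Definition ReIm := (Re_add, Im_add, Re_opp, Im_opp, Re_mul, Im_mul, Re_conj, Im_conj).

Section BoundedFunctions.
Context (R : realType) (d : measure_display) (X : measurableType d).
Implicit Types f g : X -> R[i].

Definition cmeasurable f := measurable_fun setT (fun x => complex.Re (f x)) /\
  measurable_fun setT (fun x => complex.Im (f x)).

Definition cbounded f := exists c : R, forall x, `|complex.Re (f x)| <= c /\ `|complex.Im (f x)| <= c.

Definition bmeasurable : {pred X -> R[i]} := fun f => `[< cmeasurable f /\ cbounded f >].

Lemma cmeasurableB f g : cmeasurable f -> cmeasurable g -> cmeasurable (f - g).
Proof.
move=> [f1 f2] [g1 g2]; split.
  rewrite (_ : (fun x => _) = (fun x => complex.Re (f x)) \- (fun x => complex.Re (g x))).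
    exact: measurable_funB.
  by apply/funext => x; rewrite /= !ReIm.
rewrite (_ : (fun x => _) = (fun x => complex.Im (f x)) \- (fun x => complex.Im (g x))).
  exact: measurable_funB.
by apply/funext => x; rewrite /= !ReIm.
Qed.

Lemma cmeasurableM f g : cmeasurable f -> cmeasurable g -> cmeasurable (f * g).
Proof.
move=> [f1 f2] [g1 g2]; split.
  rewrite (_ : (fun x => _) = ((fun x => complex.Re (f x)) \* (fun x => complex.Re (g x)))
                           \- ((fun x => complex.Im (f x)) \* (fun x => complex.Im (g x)))).
    by apply: measurable_funB; exact: measurable_funM.
  by apply/funext => x; rewrite /= !ReIm.
rewrite (_ : (fun x => _) = ((fun x => complex.Re (f x)) \* (fun x => complex.Im (g x)))
                         \+ ((fun x => complex.Im (f x)) \* (fun x => complex.Re (g x)))).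
  by apply: measurable_funD; exact: measurable_funM.
by apply/funext => x; rewrite /= !ReIm.
Qed.

Lemma bmeasurable_subring : subring_closed bmeasurable.
Proof.
split=> [|f g /asboolP[fm [c fc]] /asboolP[gm [c' gc]]|f g /asboolP[fm [c fc]] /asboolP[gm [c' gc]]].
- apply/asboolP; split; first by split; exact: measurable_cst.
  by exists 1 => x /=; rewrite normr0 normr1.
- apply/asboolP; split; first exact: cmeasurableB.
  exists (c + c') => x; have [a1 a2] := fc x; have [b1 b2] := gc x.
  by split; rewrite !ReIm; apply: le_trans (ler_normB _ _) _; apply: lerD.
apply/asboolP; split; first exact: cmeasurableM.
exists (c * c' + c * c') => x; have [a1 a2] := fc x; have [b1 b2] := gc x.
split; rewrite !ReIm.
  by apply: le_trans (ler_normB _ _) _; apply: lerD; rewrite normrM ler_pM.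
by apply: le_trans (ler_normD _ _) _; apply: lerD; rewrite normrM ler_pM.
Qed.

(** The functions are bounded everywhere, not only almost everywhere, so that
    the pointwise operations make a ring of them. *)
Record bfun := BFun { bval :> X -> R[i]; bvalP : bval \in bmeasurable }.

HB.instance Definition _ := [isSub for bval].
HB.instance Definition _ := [Choice of bfun by <:].
HB.instance Definition _ :=
  GRing.SubChoice_isSubComPzRing.Build (X -> R[i]) bmeasurable bfun bmeasurable_subring.

End BoundedFunctions.

Section Integral.
Context (R : realType) (d : measure_display) (X : measurableType d).
Variable mu : probability X R.
Implicit Types (f g : bfun R X) (z : R[i]).

Lemma bfun_cmeasurable f : cmeasurable f.
Proof. by have /asboolP[] := bvalP f. Qed.

Lemma bfun_cbounded f : cbounded f.
Proof. by have /asboolP[] := bvalP f. Qed.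

Lemma bfunP f g : f =1 g -> f = g.
Proof. by move=> fg; apply/val_inj/funext. Qed.

Lemma bmeasurable_cst z : (fun=> z) \in @bmeasurable R d X.
Proof.
apply/asboolP; split; first by split; exact: measurable_cst.
by exists (`|complex.Re z| + `|complex.Im z|) => _; rewrite lerDl lerDr !normr_ge0.
Qed.

Definition bcst z : bfun R X := BFun (bmeasurable_cst z).

Lemma bmeasurable_conj f : (fun x => conjc (f x)) \in @bmeasurable R d X.
Proof.
have [fr fi] := bfun_cmeasurable f; have [c fc] := bfun_cbounded f.
apply/asboolP; split; last by exists c => x; rewrite !ReIm normrN; exact: fc.
split; first by under eq_fun do rewrite Re_conj.
by under eq_fun do rewrite Im_conj; exact: measurable_funN.
Qed.

Definition bconj f : bfun R X := BFun (bmeasurable_conj f).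

Lemma bmeasurable_comp f (t : X -> X) : measurable_fun setT t ->
  (fun x => f (t x)) \in @bmeasurable R d X.
Proof.
move=> mt; have [fr fi] := bfun_cmeasurable f; have [c fc] := bfun_cbounded f.
apply/asboolP; split; last by exists c => x; exact: fc.
by split; [exact: (measurableT_comp fr)|exact: (measurableT_comp fi)].
Qed.

Definition bcomp (t : X -> X) (mt : measurable_fun setT t) f : bfun R X :=
  BFun (bmeasurable_comp f mt).

Lemma bcst_zmod : zmod_morphism bcst. Proof. by move=> z w; exact: bfunP. Qed.
Lemma bcst_monoid : monoid_morphism bcst. Proof. by split=> [|z w]; exact: bfunP. Qed.
HB.instance Definition _ := GRing.isZmodMorphism.Build R[i] (bfun R X) bcst bcst_zmod.
HB.instance Definition _ := GRing.isMonoidMorphism.Build R[i] (bfun R X) bcst bcst_monoid.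

Lemma bconj_zmod : zmod_morphism bconj.
Proof. by move=> f g; apply: bfunP => x; exact: rmorphB. Qed.
Lemma bconj_monoid : monoid_morphism bconj.
Proof. by split=> [|f g]; apply: bfunP => x; [exact: rmorph1|exact: rmorphM]. Qed.
HB.instance Definition _ := GRing.isZmodMorphism.Build (bfun R X) (bfun R X) bconj bconj_zmod.
HB.instance Definition _ := GRing.isMonoidMorphism.Build (bfun R X) (bfun R X) bconj bconj_monoid.

Section Comp.
Variables (t : X -> X) (mt : measurable_fun setT t).
Lemma bcomp_zmod : zmod_morphism (bcomp mt). Proof. by move=> f g; exact: bfunP. Qed.
Lemma bcomp_monoid : monoid_morphism (bcomp mt). Proof. by split=> [|f g]; exact: bfunP. Qed.
HB.instance Definition _ := GRing.isZmodMorphism.Build (bfun R X) (bfun R X) (bcomp mt) bcomp_zmod.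
HB.instance Definition _ := GRing.isMonoidMorphism.Build (bfun R X) (bfun R X) (bcomp mt) bcomp_monoid.
End Comp.

Definition rint f : R := \int[mu]_x complex.Re (f x).

Lemma bounded_integrable (h : X -> R) (c : R) : measurable_fun setT h -> (forall x, `|h x| <= c) ->
  mu.-integrable setT (EFin \o h).
Proof.
move=> mh hc; apply: measurable_bounded_integrable => //; first by rewrite [X in (X < _)%E]probability_setT ltry.
exists c; split; first exact: num_real.
by move=> M cM x _ /=; apply: le_trans (hc x) (ltW cM).
Qed.

Lemma bfun_integrable f : mu.-integrable setT (EFin \o (fun x => complex.Re (f x))).
Proof.
have [c fc] := bfun_cbounded f.
by apply: (@bounded_integrable _ c) => [|x]; [exact: (bfun_cmeasurable f).1|exact: (fc x).1].
Qed.

Lemma rint_zmod : zmod_morphism rint.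
Proof.
move=> f g; rewrite /rint -RintegralB//; try exact: bfun_integrable.
by apply: eq_Rintegral => x _; rewrite !ReIm.
Qed.
HB.instance Definition _ := GRing.isZmodMorphism.Build (bfun R X) R rint rint_zmod.

Lemma rintZ r f : rint (bcst (real_complex R r) * f) = r * rint f.
Proof.
rewrite /rint -RintegralZl//; last exact: bfun_integrable.
by apply: eq_Rintegral => x _; rewrite !ReIm /= mul0r subr0.
Qed.

Lemma rint1 : rint 1 = 1.
Proof. by rewrite /rint /= Rintegral_cst//= probability_setT mul1r. Qed.

Lemma rint_conj f : rint (bconj f) = rint f.
Proof. by apply: eq_Rintegral => x _; rewrite Re_conj. Qed.

Lemma ler_rint f g : (forall x, complex.Re (f x) <= complex.Re (g x)) -> rint f <= rint g.
Proof. by move=> fg; apply: le_Rintegral => //; exact: bfun_integrable. Qed.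

Lemma sqnE z : complex.Re (z * conjc z) = sqn z.
Proof. by rewrite !ReIm /sqn; ring. Qed.

Lemma sqn_eq0 z : sqn z = 0 -> z = 0.
Proof.
move=> /eqP; rewrite paddr_eq0 ?sqr_ge0// !sqrf_eq0 => /andP[/eqP a0 /eqP b0].
by case: z a0 b0 => a b /= -> ->.
Qed.

Lemma rint_sq_ge0 f : 0 <= rint (f * bconj f).
Proof. by apply: Rintegral_ge0 => x _; rewrite sqnE sqn_ge0. Qed.

Lemma rint_eq0 f : (forall x, 0 <= complex.Re (f x)) ->
  rint f = 0 <-> {ae mu, forall x, complex.Re (f x) = 0}.
Proof.
move=> f0; have mf := (bfun_cmeasurable f).1.
have := ae_eq_integral_abs mu measurableT ((measurable_EFinP _ _).2 mf).
have -> : (\int[mu]_x `|(EFin \o (fun x => complex.Re (f x))) x|)%E = (rint f)%:E.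
  rewrite fineK; last exact: (integrable_fin_num _ (bfun_integrable _)).
  by apply: eq_integral => x _ /=; rewrite ger0_norm.
move=> [h1 h2]; split=> [r0|r0].
  by have := h1 (congr1 EFin r0); apply: filterS => x /(_ I) /= [].
have : (rint f)%:E = 0%E; last by case.
by apply: h2; apply: filterS r0 => x fx _; rewrite /= fx.
Qed.

(** Vanishing in mean square, the only notion of equality in the algebra, is
    vanishing almost everywhere. *)
Lemma rint_sq_eq0 f : rint (f * bconj f) = 0 <-> {ae mu, forall x, f x = 0}.
Proof.
have f0 x : 0 <= complex.Re ((f * bconj f) x) by rewrite sqnE sqn_ge0.
split=> [/(rint_eq0 f0)|h].
  by apply: filterS => x; rewrite sqnE => /sqn_eq0.
by apply/(rint_eq0 f0); apply: filterS h => x fx; rewrite /= sqnE fx /sqn /= expr0n addr0.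
Qed.

End Integral.

(** * The system of bounded functions of an ergodic transformation *)

Section Ziter.
Variables (X : Type) (T Tinv : X -> X).
Hypotheses (TK : cancel T Tinv) (TinvK : cancel Tinv T).

Lemma ziter1D n x : ziter T Tinv (1 + n) x = T (ziter T Tinv n x).
Proof.
case: n => [m|[|m]]; first by rewrite -intS.
  by rewrite NegzE subrr /= TinvK.
rewrite (_ : 1 + Negz m.+1 = Negz m); last by rewrite !NegzE intS opprD addrA subrr add0r.
by rewrite /= TinvK.
Qed.

Lemma ziterN1D n x : ziter T Tinv (-1 + n) x = Tinv (ziter T Tinv n x).
Proof. by have := ziter1D (-1 + n) x; rewrite addrA subrr add0r => ->; rewrite TK. Qed.

Lemma ziterD m n x : ziter T Tinv (m + n) x = ziter T Tinv m (ziter T Tinv n x).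
Proof.
elim/int_rect: m => [|m ih|m ih]; first by rewrite add0r.
  by rewrite intS -addrA !ziter1D ih.
by rewrite intS opprD -addrA !ziterN1D ih.
Qed.

End Ziter.

Section Essential.
Context (R : realType) (d : measure_display) (X : measurableType d).
Implicit Types (f : X -> R[i]).

Lemma cmeasurableP f : csigma f `<=` measurable <-> cmeasurable f.
Proof.
split=> [h|[f1 f2]].
  by split=> _ A mA; apply: h; apply: sub_sigma_algebra;
    [apply: or_introl|apply: or_intror]; exists A.
apply: smallest_sub; first exact: sigma_algebra_measurable.
by move=> B [] [A mA <-]; [exact: f1|exact: f2].
Qed.

Variable mu : probability X R.

Lemma normc_sqn (z : R[i]) : ComplexField.Normc.normc z = Num.sqrt (sqn z).
Proof. by case: z. Qed.

Lemma sqn_le (z : R[i]) (c : R) : `|complex.Re z| <= c -> `|complex.Im z| <= c -> sqn z <= c ^+ 2 *+ 2.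
Proof.
move=> h1 h2; rewrite mulr2n /sqn -[in leLHS]real_normK ?num_real// -[complex.Im z ^+ 2]real_normK ?num_real//.
by apply: lerD; rewrite ler_pXn2r ?nnegrE ?normr_ge0 ?(le_trans (normr_ge0 _) h1).
Qed.

Lemma Re_le_normc (z : R[i]) : `|complex.Re z| <= ComplexField.Normc.normc z.
Proof. by rewrite normc_sqn -sqrtr_sqr ler_wsqrtr// lerDl sqr_ge0. Qed.

Lemma Im_le_normc (z : R[i]) : `|complex.Im z| <= ComplexField.Normc.normc z.
Proof. by rewrite normc_sqn -sqrtr_sqr ler_wsqrtr// lerDr sqr_ge0. Qed.

Lemma ess_bounded (h : X -> \bar R) (c : R) : (\forall x \ae mu, (`|h x| <= c%:E)%E) ->
  (Lnorm mu +oo%E h < +oo)%E.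
Proof.
move=> hc; rewrite unlock; case: ifPn => [_|_]; last exact: ltry.
by apply: le_lt_trans (ltry c); apply/ess_supP.
Qed.

Lemma Linfty_bfun (f : bfun R X) : cLinfty mu f.
Proof.
split; first exact/cmeasurableP/bfun_cmeasurable.
have [c fc] := bfun_cbounded f; apply: (@ess_bounded _ (Num.sqrt (c ^+ 2 *+ 2))).
apply: nearW => x /=; rewrite lee_fin normc_sqn ger0_norm ?sqrtr_ge0// ler_wsqrtr//.
by apply: sqn_le; have [] := fc x.
Qed.

Lemma bmeasurable_if f (D : X -> bool) (c : R) : cmeasurable f -> measurable_fun setT D ->
  (forall x, D x -> `|complex.Re (f x)| <= c /\ `|complex.Im (f x)| <= c) ->
  (fun x => if D x then f x else 0) \in @bmeasurable R d X.
Proof.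
move=> [f1 f2] mD Dc; apply/asboolP; split.
  split.
    rewrite (_ : (fun x => _) = (fun x => if D x then complex.Re (f x) else 0)).
      by apply: measurable_fun_ifT.
    by apply/funext => x; case: (D x).
  rewrite (_ : (fun x => _) = (fun x => if D x then complex.Im (f x) else 0)).
    by apply: measurable_fun_ifT.
  by apply/funext => x; case: (D x).
exists `|c| => x; case: ifPn => [/Dc[h1 h2]|_]; last by rewrite /= normr0.
by split; [apply: le_trans h1 _|apply: le_trans h2 _]; exact: ler_norm.
Qed.

Lemma bfun_cut f (c : R) : cmeasurable f -> exists g : bfun R X,
  forall x, `|complex.Re (f x)| <= c -> `|complex.Im (f x)| <= c -> f x = g x.
Proof.
move=> mf; pose D := fun x => (`|complex.Re (f x)| <= c) && (`|complex.Im (f x)| <= c).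
have mD : measurable_fun setT D.
  have [f1 f2] := mf.
  by apply: measurable_and; apply: measurable_fun_ler => //; exact: measurableT_comp.
have bg := bmeasurable_if mf mD (fun x => @andP _ _).
by exists (BFun bg) => x h1 h2; rewrite /= /D h1 h2.
Qed.

Lemma bfun_of_Linfty f : cLinfty mu f -> exists g : bfun R X, {ae mu, forall x, f x = g x}.
Proof.
have mu0 : (0 < mu [set: X])%E by rewrite [X in (_ < X)%E]probability_setT lte01.
move=> [/cmeasurableP mf]; rewrite /cLnorm unlock mu0 => h.
have [c hc] : exists c : R, \forall x \ae mu, (ComplexField.Normc.normc (f x) <= c)%R.
  set s := ess_sup _ _ in h; exists (fine s).
  have s0 : (0 <= s)%E by apply: ess_sup_gee => //; apply: nearW => x /=.
  have sf : s \is a fin_num by rewrite ge0_fin_numE.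
  apply: filterS (ess_sup_ge mu (abse \o (fun x => (ComplexField.Normc.normc (f x))%:E))) => x /=.
  rewrite -/s -[s]fineK// lee_fin; apply: le_trans; exact: ler_norm.
have [g hg] := bfun_cut c mf; exists g; apply: filterS hc => x hx.
by apply: hg; apply: le_trans hx; [exact: Re_le_normc|exact: Im_le_normc].
Qed.

End Essential.

Section Action.
Context (R : realType) (d : measure_display) (X : measurableType d).
Variables (mu : probability X R) (T Tinv : X -> X).
Hypothesis hT : invertible_mps mu T Tinv.
Implicit Types f g : bfun R X.

Lemma measurable_ziter n : measurable_fun setT (ziter T Tinv n).
Proof.
have [[mT _] mTi _ _] := hT.
have mi (t : X -> X) m : measurable_fun setT t -> measurable_fun setT (iter m t).
  move=> mt; elim: m => [|m ih]; first exact: measurable_id.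
  exact: (measurableT_comp mt ih).
by case: n => m; exact: mi.
Qed.

Definition koopman n : {rmorphism bfun R X -> bfun R X} := bcomp (measurable_ziter n).

Lemma koopmanD m n f : koopman (m + n) f = koopman m (koopman n f).
Proof. by have [_ _ TK TiK] := hT; apply: bfunP => x /=; rewrite addrC ziterD. Qed.

Lemma rint_koopman1 f : rint mu (koopman 1 f) = rint mu f.
Proof.
have [[mT muT] _ _ _] := hT; rewrite /rint /Rintegral; congr fine.
have mf : measurable_fun setT (EFin \o (fun x => complex.Re (f x))).
  exact/measurable_EFinP/(bfun_cmeasurable f).1.
rewrite -[LHS](integral_pushforward mT mf _ measurableT)//.
  by apply: eq_measure_integral => A mA _; exact: muT.
by rewrite preimage_setT; exact: (bfun_integrable mu (koopman 1 f)).
Qed.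

Lemma rint_koopman n f : rint mu (koopman n f) = rint mu f.
Proof.
elim/int_rect: n => [|m ih|m ih]; first by congr rint; exact: bfunP.
  by rewrite intS koopmanD rint_koopman1.
by rewrite -[LHS]rint_koopman1 -koopmanD intS opprD addrA subrr add0r.
Qed.

Lemma koopman_ergodic : ergodic mu T -> forall f,
  rint mu ((koopman 1 f - f) * bconj (koopman 1 f - f)) = 0 ->
  exists z, rint mu ((f - bcst X z) * bconj (f - bcst X z)) = 0.
Proof.
move=> herg f /rint_sq_eq0 f0; have [|z fz] := herg f (Linfty_bfun mu f).
  by apply: filterS f0 => x /eqP; rewrite subr_eq0 => /eqP.
exists z; apply/rint_sq_eq0; apply: filterS fz => x fx.
by transitivity (f x - z) => //; rewrite fx subrr.
Qed.

End Action.

Section Contractions.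
Context (R : realType) (d : measure_display) (X : measurableType d).
Variable mu : probability X R.
Implicit Types (f g h : bfun R X).

Local Notation n2 f := (rint mu (f * bconj f)).

Lemma sqnM (z w : R[i]) : sqn (z * w) = sqn z * sqn w.
Proof. by rewrite /sqn !ReIm; ring. Qed.

Lemma sqnD (z w : R[i]) : sqn (z + w) <= sqn z *+ 2 + sqn w *+ 2.
Proof.
rewrite /sqn !ReIm -subr_ge0.
set a := complex.Re z; set b := complex.Im z; set a' := complex.Re w; set b' := complex.Im w.
have := addr_ge0 (sqr_ge0 (a - a')) (sqr_ge0 (b - b')); congr (_ <= _); ring.
Qed.

Lemma bfun_sqn f : exists2 c : R, 0 < c & forall x, sqn (f x) <= c.
Proof.
have [c fc] := bfun_cbounded f; exists (c ^+ 2 *+ 2 + 1).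
  by rewrite ltr_wpDl// mulrn_wge0// sqr_ge0.
by move=> x; apply: le_trans (sqn_le (fc x).1 (fc x).2) _; rewrite lerDl.
Qed.

Lemma n2_bounded f : exists2 c : R, 0 < c & forall g, n2 (f * g) <= c * n2 g.
Proof.
have [c c0 fc] := bfun_sqn f; exists c => // g; rewrite -rintZ; apply: ler_rint => x.
rewrite [complex.Re (_ * _ * _)]sqnE Re_mul /= mul0r subr0 sqnE sqnM.
by rewrite ler_wpM2r// sqn_ge0.
Qed.

Lemma n2x f x : complex.Re ((f * bconj f) x) = sqn (f x).
Proof. exact: sqnE. Qed.

Lemma rintD f g : rint mu f + rint mu g = rint mu (f + g).
Proof. exact/esym/raddfD. Qed.

Lemma ler_rintD f1 f2 g1 g2 :
  (forall x, complex.Re (f1 x) + complex.Re (f2 x) <= complex.Re (g1 x) + complex.Re (g2 x)) ->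
  rint mu f1 + rint mu f2 <= rint mu g1 + rint mu g2.
Proof. by move=> h; rewrite (rintD f1 f2) (rintD g1 g2); apply: ler_rint => x; have := h x; rewrite -!Re_add. Qed.

Lemma n2D f g : n2 (f + g) <= n2 f *+ 2 + n2 g *+ 2.
Proof.
rewrite !mulr2n !rintD; apply: ler_rint => x.
rewrite sqnE; apply: le_trans (sqnD _ _) _.
by rewrite !mulr2n !Re_add !sqnE.
Qed.

Lemma n2_sym f g : n2 (f - g) = n2 (g - f).
Proof. by congr rint; rewrite -(opprB g f) rmorphN mulrNN. Qed.

Lemma measurable_sqn (u : X -> R[i]) : cmeasurable u -> measurable_fun setT (fun x => sqn (u x)).
Proof. by move=> [u1 u2]; apply: measurable_funD; exact: measurable_funX. Qed.

Lemma sqn_bound (z : R[i]) (c : R) : sqn z <= c -> `|complex.Re z| <= c + 1 /\ `|complex.Im z| <= c + 1.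
Proof.
move=> zc; have c0 := le_trans (sqn_ge0 z) zc.
have h (r : R) : r ^+ 2 <= c -> `|r| <= c + 1.
  move=> rc; rewrite -(ler_pXn2r (ltn0Sn 1)) ?nnegrE ?addr_ge0// real_normK ?num_real//.
  by apply: le_trans rc _; nra.
by split; apply: h; apply: le_trans zc; rewrite ?lerDl ?lerDr sqr_ge0.
Qed.

Lemma bmeasurable_real (h : X -> R) (c : R) : measurable_fun setT h -> (forall x, `|h x| <= c) ->
  (fun x => real_complex R (h x)) \in @bmeasurable R d X.
Proof.
move=> mh hc; apply/asboolP; split; first by split => //=; exact: measurable_cst.
by exists c => x /=; rewrite normr0; split; rewrite ?hc// (le_trans (normr_ge0 _) (hc x)).
Qed.

(** Dividing by max(1, |f|) retracts the plane onto the closed disc, so it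
    moves [f] closer to every contraction. *)
Lemma n2_truncation f : exists2 g : bfun R X, (forall x, sqn (g x) <= 1) &
  forall h, (forall u, n2 (h * u) <= n2 u) -> n2 (g - h) <= n2 (f - h).
Proof.
pose m x : R := Num.max 1 (Num.sqrt (sqn (f x))).
have m1 x : 1 <= m x by rewrite le_max lexx.
have m0 x : 0 < m x := lt_le_trans ltr01 (m1 x).
have mm : measurable_fun setT m.
  apply: measurable_maxr => //.
  by apply: (measurableT_comp (continuous_measurable_fun (@sqrt_continuous R)));
    exact/measurable_sqn/bfun_cmeasurable.
have mV : measurable_fun setT (fun x => (m x)^-1).
  under eq_fun do rewrite -powR_inv1 ?(ltW (m0 _))//.
  exact: (measurableT_comp (@measurable_powR R (-1))).
have bV x : `|(m x)^-1| <= 1 by rewrite ger0_norm ?invr_ge0 ?(ltW (m0 x))// invf_le1 ?m0 ?m1.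
pose v : bfun R X := BFun (bmeasurable_real mV bV).
have [c c0 fc] := bfun_sqn f.
pose c' : R := Num.max 1 (Num.sqrt c).
have mc x : m x <= c'.
  by rewrite /m /c' ge_max le_max lexx/= le_max (ler_wsqrtr (fc x)) orbT.
have ms : measurable_fun setT (fun x => Num.sqrt (m x - 1)).
  apply: (measurableT_comp (continuous_measurable_fun (@sqrt_continuous R))).
  exact: measurable_funB.
have bs x : `|Num.sqrt (m x - 1)| <= Num.sqrt (c' - 1).
  by rewrite ger0_norm ?sqrtr_ge0// ler_wsqrtr// lerB.
pose s : bfun R X := BFun (bmeasurable_real ms bs).
have mE x : (m x = 1 /\ sqn (f x) <= 1) \/ sqn (f x) = m x ^+ 2.
  rewrite /m; case: (leP 1 (Num.sqrt _)) => [h|/ltW h]; first by right; rewrite sqr_sqrtr ?sqn_ge0.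
  by left; split=> //; rewrite -[sqn _]sqr_sqrtr ?sqn_ge0// expr_le1// sqrtr_ge0.
have gE x : sqn ((v * f) x) = (m x)^-2 * sqn (f x).
  by rewrite [(v * f) x]/(_ * _) sqnM {1}/sqn /= expr0n addr0 exprVn.
exists (v * f) => [x|h h1].
  rewrite gE; case: (mE x) => [[-> ?]|->]; first by rewrite expr1n invr1 mul1r.
  by rewrite mulVf// expf_neq0// gt_eqF.
rewrite -(lerD2r (n2 s)); apply: le_trans (_ : n2 (f - h) + n2 (h * s) <= _); last first.
  by rewrite lerD2l; exact: h1.
apply: ler_rintD.
move=> x. rewrite !n2x.
rewrite [(h * s) x]/(h x * real_complex R (Num.sqrt (m x - 1))).
rewrite [(v * f - h) x]/(real_complex R (m x)^-1 * f x - h x) sqnM.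
have -> : sqn (real_complex R (Num.sqrt (m x - 1))) = m x - 1.
  by rewrite /sqn /= expr0n addr0 sqr_sqrtr ?subr_ge0.
rewrite [(f - h) x]/(f x - h x).
have := mE x; have := gE x; rewrite [(v * f) x]/(real_complex R (m x)^-1 * f x).
set z := _ * f x; have -> : f x = real_complex R (m x) * z.
  by rewrite /z mulrA -rmorphM mulfV ?gt_eqF// rmorph1 mul1r.
move: z (m x) (m1 x) (m0 x) => z y y1 y0; rewrite sqnM /sqn !ReIm /=.
set u := complex.Re z; set w := complex.Im z; set a := complex.Re _; set b := complex.Im _.
rewrite !mul0r !subr0 expr0n /= !addr0 => _ [[-> _]|]; first by lra.
move=> yE; have uw : u ^+ 2 + w ^+ 2 = 1.
  have y2 : y ^+ 2 != 0 by rewrite expf_neq0// gt_eqF.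
  by apply: (mulfI y2); rewrite mulr1.
rewrite -subr_ge0.
have p : 0 <= (y - 1) * ((u - a) ^+ 2 + (w - b) ^+ 2 + (y - 1)).
  by apply: mulr_ge0; rewrite ?subr_ge0//; apply: addr_ge0; rewrite ?subr_ge0//;
    apply: addr_ge0; exact: sqr_ge0.
have z0 : y * (y - 1) * (u ^+ 2 + w ^+ 2 - 1) = 0 by rewrite uw subrr mulr0.
by apply: le_trans p _; rewrite -[leLHS]addr0 -z0 le_eqVlt; apply/orP; left; apply/eqP; ring.
Qed.

(** The sum of the series is integrable, hence finite almost everywhere. *)
Lemma ae_bounded_of_summable (h : nat -> X -> R) : (forall k, measurable_fun setT (h k)) ->
  (forall k x, 0 <= h k x) -> (forall k, (\int[mu]_x (h k x)%:E <= (1 / (2 ^ (k + 1))%:R)%:E)%E) ->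
  {ae mu, forall x, exists C : R, forall k, h k x <= C}.
Proof.
move=> mh h0 hI; pose s x := (\sum_(k <oo) (h k x)%:E)%E.
have s0 x : (0 <= s x)%E by apply: nneseries_ge0 => n _ _; rewrite lee_fin.
have mhE k : measurable_fun setT (fun x => (h k x)%:E) by exact/measurable_EFinP.
have ms : measurable_fun setT s.
  by apply: ge0_emeasurable_sum => // k x _ _; rewrite lee_fin.
have si : mu.-integrable setT s.
  apply/integrableP; split => //.
  under eq_integral do rewrite gee0_abs//.
  rewrite integral_nneseries//; last by move=> k x _; rewrite lee_fin.
  apply: (@le_lt_trans _ _ (\sum_(k <oo) (1 / (2 ^ (k + 1))%:R)%:E)%E).
    by apply: lee_nneseries => k *; [apply: integral_ge0 => x _; rewrite lee_fin|exact: hI].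
  by rewrite (cvg_lim _ (@cvg_geometric_eseries_half R 1 0))// ltry.
apply: filterS (integrable_ae measurableT si) => x /(_ I) sx.
exists (fine (s x)) => k; rewrite -lee_fin fineK//.
apply: le_trans (nneseries_lim_ge k.+1 _); last by move=> i _ _; rewrite lee_fin.
rewrite big_nat_recr//= leeDr//; apply: sume_ge0 => i _; rewrite lee_fin; exact: h0.
Qed.

(** Successive differences of order [2^- k] are compensated by the decreasing
    term [C * 2 * 2^- k], which makes the sequence monotone. *)
Lemma cvg_of_geometric_diff (u : nat -> R) (C : R) :
  (forall k, `|u k.+1 - u k| <= C * 2^-1 ^+ k) -> cvgn u.
Proof.
move=> hu; have C0 : 0 <= C by apply: le_trans (normr_ge0 _) (le_trans (hu 0%N) _); rewrite expr0 mulr1.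
pose b k := u k + C * 2 * 2^-1 ^+ k.
have g0 k : 0 <= 2^-1 ^+ k :> R by rewrite exprn_ge0// invr_ge0.
have bc : cvgn b.
  apply: nonincreasing_is_cvgn.
    apply/nonincreasing_seqP => k; have := hu k; rewrite ler_norml => /andP[_].
    by rewrite /b exprS; move: (2^-1 ^+ k) => y; lra.
  have lo k : u 0%N - C * 2 * (1 - 2^-1 ^+ k) <= u k.
    elim: k => [|k ih]; first by rewrite expr0 subrr mulr0 subr0.
    have := hu k; rewrite ler_norml => /andP[+ _]; move: ih; rewrite exprS; move: (2^-1 ^+ k) => y; lra.
  exists (u 0%N - C * 2) => _ [k _ <-]; rewrite /b; have := lo k.
  have := mulr_ge0 C0 (g0 k); move: (2^-1 ^+ k) => y; lra.
have -> : u = b - (geometric (C * 2) 2^-1).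
  by apply/funext => k; rewrite /b fctE /= addrK.
apply: is_cvgB => //; apply/cvgP/cvg_geometric.
by rewrite ger0_norm ?invr_ge0// invf_lt1// ltr1n.
Qed.

Lemma rintE f : (\int[mu]_x (complex.Re (f x))%:E)%E = (rint mu f)%:E.
Proof. by rewrite fineK//; exact: (integrable_fin_num _ (bfun_integrable mu f)). Qed.

Lemma n2E f : (\int[mu]_x (sqn (f x))%:E)%E = (n2 f)%:E.
Proof. by rewrite -rintE; apply: eq_integral => x _; rewrite sqnE. Qed.

Lemma Re_sqn (z : R[i]) : complex.Re z ^+ 2 <= sqn z.
Proof. by rewrite lerDl sqr_ge0. Qed.

Lemma Im_sqn (z : R[i]) : complex.Im z ^+ 2 <= sqn z.
Proof. by rewrite lerDr sqr_ge0. Qed.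

(** A rapidly Cauchy subsequence converges almost everywhere, and dominated
    convergence turns this into convergence in mean square. *)
Lemma n2_complete (F : nat -> bfun R X) : (forall k x, sqn (F k x) <= 1) ->
  (forall e : R, 0 < e -> exists n0, forall i j, (n0 <= i)%N -> (n0 <= j)%N -> n2 (F i - F j) < e) ->
  exists G : bfun R X, forall e : R, 0 < e -> exists n0, forall i, (n0 <= i)%N -> n2 (F i - G) < e.
Proof.
move=> F1 cF.
have e0 k : 0 < 4^-1 ^+ k * 2^-1 ^+ k.+1 :> R by rewrite mulr_gt0// exprn_gt0// invr_gt0.
have /choice[n0 hn0] : forall k, exists n0, forall i j, (n0 <= i)%N -> (n0 <= j)%N ->
    n2 (F i - F j) < 4^-1 ^+ k * 2^-1 ^+ k.+1 by move=> k; exact: cF.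
(* the subsequence; the summand k makes it tend to infinity *)
pose r k := (k + \max_(i < k.+1) n0 i)%N.
have rk k : (k <= r k)%N by rewrite leq_addr.
have rn j k : (j <= k)%N -> (n0 j <= r k)%N.
  move=> jk; apply: leq_trans (leq_addl _ _).
  exact: (leq_bigmax (F := fun i : 'I_k.+1 => n0 i) (Ordinal (jk : (j < k.+1)%N))).
pose D k := F (r k.+1) - F (r k).
have hD : {ae mu, forall x, exists C : R, forall k, 4 ^+ k * sqn (D k x) <= C}.
  apply: ae_bounded_of_summable => [k|k x|k].
  - by apply: measurable_funM => //; exact/measurable_sqn/bfun_cmeasurable.
  - by rewrite mulr_ge0 ?exprn_ge0 ?sqn_ge0.
  have -> : (\int[mu]_x (4 ^+ k * sqn (D k x))%:E)%E = (4 ^+ k * n2 (D k))%:E.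
    rewrite -rintZ -rintE; apply: eq_integral => x _.
    by rewrite Re_mul sqnE /= mul0r subr0.
  rewrite lee_fin; apply: le_trans (_ : 4 ^+ k * (4^-1 ^+ k * 2^-1 ^+ k.+1) <= _).
    by rewrite ler_pM2l ?exprn_gt0// ltW// hn0// rn.
  by rewrite mulrA -exprMn mulfV// expr1n mul1r natrX exprVn div1r addn1.
have cv (c : R[i] -> R) : (forall z, c z ^+ 2 <= sqn z) -> (forall z w, c (z - w) = c z - c w) ->
    forall x C, (forall k, 4 ^+ k * sqn (D k x) <= C) -> cvgn (fun k => c (F (r k) x)).
  move=> cs cB x C hC; apply: (@cvg_of_geometric_diff _ (C + 1)) => k; rewrite -cB.
  have C0 : 0 <= C by apply: le_trans (hC 0%N); rewrite mulr_ge0 ?exprn_ge0 ?sqn_ge0.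
  have t0 : 0 <= 2^-1 ^+ k :> R by rewrite exprn_ge0// invr_ge0.
  rewrite -(ler_pXn2r (ltn0Sn 1)) ?nnegrE ?mulr_ge0 ?addr_ge0// real_normK ?num_real//.
  apply: le_trans (cs _) _; apply: le_trans (_ : C * 4^-1 ^+ k <= _).
    by rewrite exprVn ler_pdivlMr ?exprn_gt0// mulrC; exact: hC.
  rewrite exprMn -!exprM mulnC exprM; have -> : 2^-1 ^+ 2 = 4^-1 :> R by field.
  by apply: ler_wpM2r; rewrite ?exprn_ge0 ?invr_ge0//; nra.
(* the upper limit is measurable, and is the limit wherever that exists *)
pose L (c : R[i] -> R) x := fine (limn_esup (fun k => (c (F (r k) x))%:E)).
have mL c : (forall k, measurable_fun setT (fun x => c (F (r k) x))) -> measurable_fun setT (L c).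
  move=> mc; apply: (measurableT_comp (fine_measurable measurableT)).
  by apply: measurable_fun_limn_esup => k; exact/measurable_EFinP.
have LE (c : R[i] -> R) x : (forall z, c z ^+ 2 <= sqn z) -> cvgn (fun k => c (F (r k) x)) ->
    `|L c x| <= 1 /\ (fun k => c (F (r k) x)) @ \oo --> L c x.
  move=> cs /cvg_ex[l hl].
  have hE : (fun k => (c (F (r k) x))%:E) @ \oo --> l%:E by apply: cvg_EFin; [exact: nearW|exact: hl].
  have -> : L c x = l by rewrite /L (cvg_limn_einf_sup hE).2.
  split=> //; have cb k : `|c (F (r k) x)| <= 1.
    by rewrite -(ler_pXn2r (ltn0Sn 1)) ?nnegrE// real_normK ?num_real// expr1n (le_trans (cs _)).
  rewrite -(cvg_lim _ (cvg_norm hl))//; apply: limr_le; first exact: (cvgP _ (cvg_norm hl)).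
  exact: nearW.
have [G hG] := @bfun_cut R d X (fun x => Complex (L (@complex.Re R) x) (L (@complex.Im R) x)) 1
  (conj (mL _ (fun k => (bfun_cmeasurable (F (r k))).1)) (mL _ (fun k => (bfun_cmeasurable (F (r k))).2))).
have [c c0 Gc] := bfun_sqn G.
have FG : {ae mu, forall x, (fun k => sqn (F (r k) x - G x)) @ \oo --> 0}.
  apply: filterS hD => x [C hC].
  have [a1 a2] := LE _ x (@Re_sqn) (cv _ (@Re_sqn) (fun z w => etrans (Re_add _ _) (congr1 _ (Re_opp _))) x C hC).
  have [b1 b2] := LE _ x (@Im_sqn) (cv _ (@Im_sqn) (fun z w => etrans (Im_add _ _) (congr1 _ (Im_opp _))) x C hC).
  pose u k := complex.Re (F (r k) x) - L (@complex.Re R) x.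
  pose v k := complex.Im (F (r k) x) - L (@complex.Im R) x.
  have u0 : u @ \oo --> (0 : R).
    by rewrite -(subrr (L (@complex.Re R) x)); apply: cvgB => //; exact: cvg_cst.
  have v0 : v @ \oo --> (0 : R).
    by rewrite -(subrr (L (@complex.Im R) x)); apply: cvgB => //; exact: cvg_cst.
  have -> : (fun k => sqn (F (r k) x - G x)) = (u \* u) \+ (v \* v).
    by apply/funext => k; rewrite -(hG x a1 b1) /sqn !ReIm !expr2.
  by rewrite -[0 : R](addr0 (0 : R)) -{1 2}[0 : R](mulr0 (0 : R)); apply: cvgD; exact: cvgM.
have [|||_ _ dc] := @dominated_convergence _ X R mu setT measurableT
  (fun k x => (sqn (F (r k) x - G x))%:E) (cst 0%E) (cst (1 *+ 2 + c *+ 2)%:E)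
  (fun k => (measurable_EFinP _ _).2 (measurable_sqn (bfun_cmeasurable (F (r k) - G))))
  (measurable_cst _) _ _ _.
- by apply: filterS FG => x hx _; apply: cvg_EFin; [exact: nearW|exact: hx].
- by apply: finite_measure_integrable_cst.
- apply: nearW => x k _ /=; rewrite ger0_norm ?sqn_ge0// lee_fin.
  apply: le_trans (sqnD _ _) _; apply: lerD; first by rewrite lerMn2r F1.
  by rewrite lerMn2r /= /sqn !ReIm !sqrrN; exact: Gc.
have {}dc : (fun k => n2 (F (r k) - G)) @ \oo --> (0 : R).
  move: dc; rewrite integral0 => /fine_cvg; apply: cvg_trans; apply: near_eq_cvg; apply: nearW => k /=.
  by rewrite -[RHS]/(fine (n2 (F (r k) - G))%:E) -n2E.
exists G => e e00; have e4 : 0 < e / 4 by rewrite divr_gt0.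
have [N hN] := cF _ e4.
have [k Nk hk] : exists2 k, (N <= k)%N & n2 (F (r k) - G) < e / 4.
  have [k0 _ hk0] := (cvgrPdist_lt _ _).1 dc _ e4.
  exists (maxn N k0); first exact: leq_maxl.
  by have := hk0 (maxn N k0) (leq_maxr _ _); rewrite sub0r normrN ger0_norm ?rint_sq_ge0.
exists N => i Ni; have -> : F i - G = (F i - F (r k)) + (F (r k) - G) by rewrite addrA subrK.
apply: le_lt_trans (n2D _ _) _; have := hN i (r k) Ni (leq_trans Nk (rk k)); lra.
Qed.

End Contractions.

Section System.
Context (R : realType) (d : measure_display) (X : measurableType d).
Variable mu : probability X R.
Implicit Types (f g h : bfun R X).

Local Notation n2 f := (rint mu (f * bconj f)).

Definition ncontraction f := forall u, n2 (f * u) <= n2 u.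

Lemma ncontraction_sqn f : (forall x, sqn (f x) <= 1) -> ncontraction f.
Proof.
move=> f1 u; apply: ler_rint => x; rewrite !n2x [(f * u) x]/(f x * u x) sqnM.
by rewrite ler_piMl ?sqn_ge0.
Qed.

Lemma contraction_truncation f : exists2 g, ncontraction g &
  forall h, ncontraction h -> n2 (g - h) <= n2 (f - h).
Proof.
by have [g g1 hg] := n2_truncation mu f; exists g => //; exact: ncontraction_sqn.
Qed.

(** The truncation of a contraction is at distance 0 from it, so the sequence
    may be taken bounded by 1 everywhere. *)
Lemma contraction_complete (F : nat -> bfun R X) : (forall k, ncontraction (F k)) ->
  (forall e : R, 0 < e -> exists n0, forall i j, (n0 <= i)%N -> (n0 <= j)%N -> n2 (F i - F j) < e) ->
  exists2 G, ncontraction G & forall e : R, 0 < e -> exists n0, forall i, (n0 <= i)%N -> n2 (F i - G) < e.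
Proof.
move=> F1 cF; have /choice[F' hF'] k : exists g : bfun R X, (forall x, sqn (g x) <= 1) /\ n2 (g - F k) = 0.
  have [g g1 hg] := n2_truncation mu (F k); exists g; split=> //.
  by apply/le_anti; rewrite rint_sq_ge0 (le_trans (hg _ (F1 k)))// subrr mul0r raddf0.
have F'E i : n2 (F' i - F i) = 0 by have [] := hF' i.
have FE i : n2 (F i - F' i) = 0 by rewrite n2_sym.
have [|e e0|G hG] := @n2_complete R d X mu F'; first by move=> k; have [] := hF' k.
  have [|n0 hn0] := cF (e / 4); first by rewrite divr_gt0.
  exists n0 => i j ni nj; have -> : F' i - F' j = (F' i - F i) + ((F i - F j) + (F j - F' j)).
    by rewrite !addrA !subrK.
  apply: le_lt_trans (n2D _ _ _) _; have := n2D mu (F i - F j) (F j - F' j).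
  have := hn0 i j ni nj; rewrite F'E FE; move: (n2 _) (n2 _) => *; lra.
have [G' G'1 hG'] := contraction_truncation G; exists G' => // e e0.
have [|n0 hn0] := hG (e / 2); first by rewrite divr_gt0.
exists n0 => i ni; rewrite n2_sym; apply: le_lt_trans (hG' _ (F1 i)) _; rewrite n2_sym.
have -> : F i - G = (F i - F' i) + (F' i - G) by rewrite addrA subrK.
apply: le_lt_trans (n2D _ _ _) _; have := hn0 i ni; rewrite FE; lra.
Qed.

Variables (T Tinv : X -> X).
Hypotheses (hT : invertible_mps mu T Tinv) (herg : ergodic mu T).

Lemma bconjK f : bconj (bconj f) = f.
Proof. by apply: bfunP => x; exact: conjcK. Qed.

Lemma bconj_cst (z : R[i]) : bconj (bcst X z) = bcst X (conjc z).
Proof. exact: bfunP. Qed.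

Lemma koopman0 f : koopman hT 0 f = f. Proof. exact: bfunP. Qed.

Lemma koopman_cst n (z : R[i]) : koopman hT n (bcst X z) = bcst X z. Proof. exact: bfunP. Qed.

Lemma koopman_conj n f : koopman hT n (bconj f) = bconj (koopman hT n f).
Proof. exact: bfunP. Qed.

Definition bounded_system : system R :=
  @System R (bfun R X) (@bcst R d X) (@bconj R d X) (koopman hT) (rint mu)
    bconjK bconj_cst koopman0 (koopmanD hT) koopman_cst koopman_conj
    (@rintZ R d X mu) (@rint1 R d X mu) (@rint_conj R d X mu) (@rint_sq_ge0 R d X mu) (rint_koopman hT)
    (@n2_bounded R d X mu) contraction_complete contraction_truncation
    (koopman_ergodic herg).

End System.

(** * Conditional expectation on the rational Kronecker factor *)

Section Kronecker.
Context (R : realType) (d : measure_display) (X : measurableType d).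
Variables (mu : probability X R) (T Tinv : X -> X).
Implicit Types (b g h : bfun R X) (u v f ft : X -> R[i]).

Local Notation n2 f := (rint mu (f * bconj f)).
Local Notation Kr := (rational_kronecker mu T).

Lemma kronecker_measurable : Kr `<=` measurable.
Proof.
apply: smallest_sub; first exact: sigma_algebra_measurable.
by move=> A [f [[mf _] _] Af]; exact: mf.
Qed.

Lemma invariant_kronecker g r : (0 < r)%N -> {ae mu, forall x, g (iter r T x) = g x} ->
  csigma g `<=` Kr.
Proof.
move=> r0 gr A Ag; apply: sub_sigma_algebra; exists (bval g) => //.
by split; [exact: Linfty_bfun|exists r].
Qed.

Lemma Lnorm2E u : cLnorm mu 2%:E u = poweR (\int[mu]_x (sqn (u x))%:E)%E 2^-1.
Proof.
rewrite /cLnorm unlock; congr poweR; apply: eq_integral => x _.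
rewrite /= ger0_norm; last by rewrite normc_sqn sqrtr_ge0.
by rewrite powR_mulrn ?normc_sqn ?sqrtr_ge0// sqr_sqrtr ?sqn_ge0.
Qed.

Lemma Lnorm2_bfun b : cLnorm mu 2%:E b = (Num.sqrt (n2 b))%:E.
Proof. by rewrite Lnorm2E n2E poweR_EFin powR12_sqrt// rint_sq_ge0. Qed.

Lemma eq_Lnorm2_ae u v : cmeasurable u -> cmeasurable v ->
  {ae mu, forall x, u x = v x} -> cLnorm mu 2%:E u = cLnorm mu 2%:E v.
Proof.
move=> mu' mv uv; rewrite !Lnorm2E; congr poweR; apply: ae_eq_integral => //.
- exact/measurable_EFinP/measurable_sqn.
- exact/measurable_EFinP/measurable_sqn.
- by apply: filterS uv => x ->.
Qed.

Lemma eq_Rint_ae u v : cmeasurable u -> cmeasurable v -> {ae mu, forall x, u x = v x} ->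
  \int[mu]_x complex.Re (u x) = \int[mu]_x complex.Re (v x).
Proof.
move=> mu' mv uv; congr fine; apply: ae_eq_integral => //.
- exact/measurable_EFinP/mu'.1.
- exact/measurable_EFinP/mv.1.
- by apply: filterS uv => x ->.
Qed.

(** Measurability with respect to the factor is measurability for the
    sigma-algebra it generates, so the usual closure properties apply. *)
Lemma kronecker_band ft (c m : R) : csigma ft `<=` Kr -> exists h, csigma h `<=` Kr /\
  forall x, h x = if (c < sqn (ft x)) && (sqn (ft x) <= m) then ft x else 0.
Proof.
rewrite /rational_kronecker; set G := (X in <<s X>>) => Kft.
pose Y := g_sigma_algebraType G.
have mft : @cmeasurable R _ Y ft by apply/cmeasurableP.
pose D (x : Y) := (c < sqn (ft x)) && (sqn (ft x) <= m).
have mD : measurable_fun setT D.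
  by apply: measurable_and; [apply: measurable_fun_ltr|apply: measurable_fun_ler] => //; exact: measurable_sqn.
have Db x : D x -> `|complex.Re (ft x)| <= m + 1 /\ `|complex.Im (ft x)| <= m + 1.
  move=> /andP[_ h]; exact: sqn_bound.
pose hY : bfun R Y := BFun (bmeasurable_if mft mD Db).
have Kh : csigma hY `<=` <<s G>> by apply/(@cmeasurableP _ _ Y)/bfun_cmeasurable.
have mh : (hY : X -> R[i]) \in @bmeasurable R d X.
  apply/asboolP; split; last exact: (bfun_cbounded hY).
  by apply/cmeasurableP; apply: subset_trans Kh kronecker_measurable.
by exists (BFun mh).
Qed.

Section CondExp.
Variables (f ft : X -> R[i]).
Hypotheses (Lf : cLinfty mu f) (Ef : is_cond_exp mu Kr f ft).

Lemma cond_exp_orthogonal h : csigma h `<=` Kr ->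
  \int[mu]_x complex.Re ((f x - ft x) * conjc (h x)) = 0.
Proof.
move=> Kh; have Lh : cLp mu Kr 2%:E h by split=> //; rewrite Lnorm2_bfun ltry.
by have [_ /(_ _ Lh)/(congr1 (@complex.Re R))] := Ef.
Qed.

Let mf : cmeasurable f. Proof. by apply/cmeasurableP; case: Lf. Qed.

Let mft : cmeasurable ft.
Proof. by apply/cmeasurableP; apply: subset_trans kronecker_measurable; case: Ef => -[]. Qed.

(** Testing against [ft] restricted to a band [c < |ft|^2 <= m], where [c]
    bounds [|f|^2], shows that the band is negligible. *)
Lemma cond_exp_bound b (c : R) : {ae mu, forall x, f x = b x} -> (forall x, sqn (b x) <= c) ->
  {ae mu, forall x, sqn (ft x) <= c}.
Proof.
move=> fb bc; suff H (m : nat) : {ae mu, forall x, sqn (ft x) <= c \/ m%:R < sqn (ft x)}.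
  apply: filterS (ae_foralln H) => x hx.
  by have [//|] := hx (Num.bound (sqn (ft x))); rewrite ltNge ltW// archi_boundP ?sqn_ge0.
have Kft : csigma ft `<=` Kr by case: Ef => -[].
have [h [Kh hE]] := kronecker_band c m%:R Kft.
(* h vanishes off the band, so ft may be replaced by h in the orthogonality relation *)
have r0 : rint mu ((h - b) * bconj h) = 0.
  apply: oppr_inj; rewrite oppr0 -raddfN -mulNr opprB -(cond_exp_orthogonal Kh).
  apply: eq_Rint_ae; first exact: bfun_cmeasurable.
    apply: (@cmeasurableM _ _ _ (f - ft) (bconj h)); last exact: bfun_cmeasurable.
    exact: cmeasurableB.
  apply: filterS fb => x fx; rewrite fx.
  transitivity ((b x - h x) * conjc (h x)) => //.
  by rewrite hE; case: ifP => // _; rewrite conjc0 !mulr0.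
have E x : complex.Re (((h - b) * bconj h) x) = sqn (h x) - complex.Re (b x * conjc (h x)).
  by rewrite -sqnE -Re_opp -Re_add -mulNr -mulrDl.
have lo x : (c < sqn (ft x)) && (sqn (ft x) <= m%:R) -> 0 < complex.Re (((h - b) * bconj h) x).
  move=> hx; rewrite E; have := hE x; rewrite hx => ->; case/andP: hx => h1 _.
  have := bc x; move: (b x) (ft x) h1 => z w.
  rewrite /sqn !ReIm; set a1 := complex.Re z; set a2 := complex.Im z; set b1 := complex.Re w; set b2 := complex.Im w.
  have := sqr_ge0 (a1 - b1); have := sqr_ge0 (a2 - b2); rewrite !sqrrB; lra.
have ge0 x : 0 <= complex.Re (((h - b) * bconj h) x).
  case: (boolP ((c < sqn (ft x)) && (sqn (ft x) <= m%:R))) => [/lo/ltW//|hx].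
  by rewrite E hE (negbTE hx) conjc0 mulr0 /sqn /= expr0n addr0 subr0.
apply: filterS ((rint_eq0 mu ge0).1 r0) => x hx.
case: (leP (sqn (ft x)) c) => [|h1]; [by left|right; rewrite ltNge; apply/negP => h2].
by have := lo x; rewrite h1 h2 => /(_ isT); rewrite hx ltxx.
Qed.

(** The conditional expectation is essentially bounded, and the periodic
    functions are measurable with respect to the factor, hence orthogonal to the
    difference. *)
Lemma cond_exp_bfun : exists b bt : bfun R X, [/\ {ae mu, forall x, f x = b x},
  {ae mu, forall x, ft x = bt x} & forall g r, (0 < r)%N ->
    {ae mu, forall x, g (iter r T x) = g x} -> rint mu ((b - bt) * bconj g) = 0].
Proof.
have [b fb] := bfun_of_Linfty Lf; have [c c0 bc] := bfun_sqn b.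
have [bt hbt] := bfun_cut (c + 1) mft.
have ftb : {ae mu, forall x, ft x = bt x}.
  by apply: filterS (cond_exp_bound fb bc) => x /sqn_bound[]; exact: hbt.
exists b, bt; split=> // g r r0 gr.
rewrite -(cond_exp_orthogonal (invariant_kronecker r0 gr)).
apply: eq_Rint_ae; first exact: bfun_cmeasurable.
  apply: (@cmeasurableM _ _ _ (f - ft) (bconj g)); last exact: bfun_cmeasurable.
  exact: cmeasurableB.
by apply: filterS2 fb ftb => x -> ->.
Qed.

End CondExp.
End Kronecker.

(** * From the algebra back to the space *)

Section Transfer.
Context (R : realType) (d : measure_display) (X : measurableType d).
Variables (mu : probability X R) (T Tinv : X -> X).
Hypotheses (hT : invertible_mps mu T Tinv) (herg : ergodic mu T).
Variables (k : nat) (p : 'I_k -> {poly R}).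

Lemma mu_ziter n A : measurable A -> mu (ziter T Tinv n @^-1` A) = mu A.
Proof.
have [[mT muT] mTi TK TiK] := hT.
have muTi B : measurable B -> mu (Tinv @^-1` B) = mu B.
  move=> mB; rewrite -muT; last by rewrite -[_ @^-1` _]setTI; exact: mTi.
  by congr (mu _); apply/seteqP; split=> x /=; rewrite TK.
have it (t : X -> X) m : measurable_fun setT t -> (forall B, measurable B -> mu (t @^-1` B) = mu B) ->
    forall B, measurable B -> mu (iter m t @^-1` B) = mu B.
  move=> mt hmt; elim: m => [//|m ih] B mB; rewrite -[RHS]hmt// -[RHS]ih//.
  by rewrite -[_ @^-1` _]setTI; exact: mt.
by case: n => m; exact: it.
Qed.

Lemma ae_ziter (P : X -> Prop) n : {ae mu, forall x, P x} -> {ae mu, forall x, P (ziter T Tinv n x)}.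
Proof.
move=> [N [mN N0 PN]]; exists (ziter T Tinv n @^-1` N); split.
- by rewrite -[_ @^-1` _]setTI; exact: (measurable_ziter hT).
- by rewrite -N0; exact: mu_ziter.
- by move=> x /= Px; exact: PN.
Qed.

Lemma cmeasurable_comp (f : X -> R[i]) (t : X -> X) : cmeasurable f -> measurable_fun setT t ->
  cmeasurable (fun x => f (t x)).
Proof.
by move=> [f1 f2] mt; split; [exact: (measurableT_comp f1)|exact: (measurableT_comp f2)].
Qed.

Lemma cmeasurable_cst (z : R[i]) : cmeasurable (fun _ : X => z).
Proof. by split; exact: measurable_cst. Qed.

Lemma cmeasurable_prod (I : Type) (s : seq I) (F : I -> X -> R[i]) : (forall i, cmeasurable (F i)) ->
  cmeasurable (fun x => \prod_(i <- s) F i x).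
Proof.
move=> mF; elim: s => [|i s ih].
  by under eq_fun do rewrite big_nil; exact: cmeasurable_cst.
by under eq_fun do rewrite big_cons; exact: (cmeasurableM (mF i) ih).
Qed.

Lemma cmeasurable_sum (I : Type) (s : seq I) (F : I -> X -> R[i]) : (forall i, cmeasurable (F i)) ->
  cmeasurable (fun x => \sum_(i <- s) F i x).
Proof.
move=> mF; elim: s => [|i s ih].
  by under eq_fun do rewrite big_nil; exact: cmeasurable_cst.
under eq_fun do rewrite big_cons -[\sum_(j <- s) F j _]opprK.
apply: (cmeasurableB (mF i)); under eq_fun do rewrite -sub0r.
exact: (cmeasurableB (cmeasurable_cst 0) ih).
Qed.

Lemma cmeasurable_poly_average (f : 'I_k -> X -> R[i]) M N : (forall i, cmeasurable (f i)) ->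
  cmeasurable (poly_average T Tinv p f M N).
Proof.
move=> mf; apply: (cmeasurableM (cmeasurable_cst _)); apply: cmeasurable_sum => j.
apply: cmeasurable_prod => i; apply: cmeasurable_comp => //; exact: (measurable_ziter hT).
Qed.

Lemma bfun_sumE (I : Type) (s : seq I) (F : I -> bfun R X) x : (\sum_(i <- s) F i) x = \sum_(i <- s) F i x.
Proof. by elim: s => [|i s ih]; rewrite ?big_nil// !big_cons -ih. Qed.

Lemma bfun_prodE (I : Type) (s : seq I) (F : I -> bfun R X) x : (\prod_(i <- s) F i) x = \prod_(i <- s) F i x.
Proof. by elim: s => [|i s ih]; rewrite ?big_nil// !big_cons -ih. Qed.

Local Notation S := (bounded_system hT herg).

Lemma poly_average_pavg (f : 'I_k -> X -> R[i]) (b : 'I_k -> S) M N : M < N ->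
  (forall i, {ae mu, forall x, f i x = (b i : bfun R X) x}) ->
  {ae mu, forall x, poly_average T Tinv p f M N x = (pavg p b M `|N - M|%N : bfun R X) x}.
Proof.
move=> MN fb; set n := `|N - M|%N.
have nE : (N - M)%:~R = n%:R :> R[i] by rewrite [RHS]pmulrn /n abszE ger0_norm ?subr_ge0 ?ltW.
(* only finitely many iterates occur, so the exceptional sets still add up to a null set *)
have all_eq : {ae mu, forall x (j : 'I_n) i,
    f i (ziter T Tinv (zeval (p i) (M + j%:Z)) x) = (b i : bfun R X) (ziter T Tinv (zeval (p i) (M + j%:Z)) x)}.
  by apply: filter_forall => j; apply: filter_forall => i; exact: (ae_ziter _ (fb i)).
apply: filterS all_eq => x hx.
rewrite /poly_average /pavg /amean nE.
rewrite [RHS]/(_ * (_ : bfun R X) x) bfun_sumE.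
congr (_ * _); first by rewrite /= size_iota fmorphV rmorph_nat.
have -> : iota 0 n = index_iota 0 n by rewrite /index_iota subn0.
rewrite big_mkord; apply: eq_bigr => j _.
by rewrite bfun_prodE; apply: eq_bigr => i _; exact: hx.
Qed.

End Transfer.

Theorem theorem1p1 (R : realType) (d : measure_display) (X : measurableType d)
    (mu : probability X R) (T Tinv : X -> X)
    (hT : invertible_mps mu T Tinv) (herg : ergodic mu T)
    (k : nat) (p : 'I_k -> {poly R})
    (hp : forall i, integer_polynomial (p i))
    (hind : rationally_independent p)
    (f ft : 'I_k -> X -> R[i])
    (hf : forall i, cLinfty mu (f i))
    (hft : forall i, is_cond_exp mu (rational_kronecker mu T) (f i) (ft i)) :
  forall eps : R, 0 < eps ->
    exists L : int, forall M N : int, M < N -> L <= N - M ->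
      (cLnorm mu 2%:E (fun x => poly_average T Tinv p f M N x
                              - poly_average T Tinv p ft M N x)%R < eps%:E)%E.
Proof.
move=> eps eps0; pose S := bounded_system hT herg.
have /choice[b /choice[bt hb]] i := cond_exp_bfun (hf i) (hft i).
have free j : rational_free (S := S) (b j - bt j).
  move=> r g r0 rg; have [_ _ H] := hb j; apply: (H g r r0).
  have /rint_sq_eq0 : rint mu ((koopman hT r g - g) * bconj (koopman hT r g - g)) = 0.
    by rewrite -[LHS]/(nrm2 (S := S) (U S r g - g)) -nrmE rg expr0n.
  by apply: filterS => x /eqP; rewrite subr_eq0 => /eqP.
have [L hL] := pavg_sub hp hind free (exprn_gt0 2 eps0); exists L%:Z => M N MN LMN.
have Lle : (L <= `|N - M|%N)%N by rewrite -lez_nat gez0_abs// subr_ge0 ltW.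
have mf i : cmeasurable (f i) by apply/cmeasurableP; case: (hf i).
have mft i : cmeasurable (ft i).
  apply/cmeasurableP; apply: subset_trans (@kronecker_measurable _ _ _ mu T); case: (hft i) => -[] //.
have fE : forall i, {ae mu, forall x, f i x = b i x} by move=> i; have [] := hb i.
have ftE : forall i, {ae mu, forall x, ft i x = bt i x} by move=> i; have [] := hb i.
rewrite (@eq_Lnorm2_ae _ _ _ mu _ (pavg (S := S) p b M `|N - M|%N - pavg (S := S) p bt M `|N - M|%N : bfun R X)).
- rewrite Lnorm2_bfun lte_fin -[eps]ger0_norm ?(ltW eps0)// -sqrtr_sqr ltr_sqrt ?exprn_gt0//.
  exact: hL.
- apply: cmeasurableB; exact: (cmeasurable_poly_average hT).
- exact: bfun_cmeasurable.
have bfun_subE (g h : bfun R X) x : (g - h) x = g x - h x by [].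
apply: filterS2 (@poly_average_pavg _ _ _ mu _ _ hT herg _ p f b M N MN fE)
  (@poly_average_pavg _ _ _ mu _ _ hT herg _ p ft bt M N MN ftE) => x Ex Etx.
by rewrite Ex Etx [RHS]bfun_subE.
Qed.
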